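(* Suppose that $K$ is a bounded kernel on $[0,1]^2$, let $\gamma_n$ be the smallest positive solution of $2\,\overline{\mathcal G}{}^K_n(\delta)\le\delta^2$, and let $R>0$. Then the reproducing kernel Hilbert space estimator $\hat f_{n,K}$ described in the context satisfies the oracle inequality $$E\left(\|f-\hat f_{n,K}\|_n^2\right)\le C\left(\gamma_n^2+E_{\mathbb X_n}\inf_{\|g\|_{\mathcal H}\le R}\|f-g\|_n^2\right).$$ Consequently, if $f\in\mathcal H$ with $\|f\|_{\mathcal H}\le R$, then $E(\|f-\hat f_{n,K}\|_n^2)\le C\gamma_n^2$. If moreover the eigenvalues of $K$ decay like $\mu_i\sim i^{-\alpha}$ with $\alpha>1$, then $E(\|f-\hat f_{n,K}\|_n^2)\le C\,n^{-\alpha/(\alpha+1)}$. Here $C$ denotes constants not depending on $n$ (possibly different at each occurrence, and allowed to depend on $K$, $R$, $C_0$).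
   Context: **Data.** $\mathbb X_n=\{x_1,\dots,x_n\}$ with $x_i$ i.i.d. uniform on $[0,1]$; $y_i=f(x_i)+z_i$ with $z_i$ i.i.d. $\mathcal N(0,1)$ independent of the design; $y=(y_1,\dots,y_n)^{T}$. For vectors or functions evaluated at the design points, $\langle a,b\rangle_n=\frac1n\sum_{i=1}^na_ib_i$ and $\|\cdot\|_n$ is the induced norm (for a function $g$, $g_i=g(x_i)$). $E_{\mathbb X_n}$ is expectation over the design. **Kernel.** $K$ is a positive semidefinite kernel function on $[0,1]^2$, $\mathcal H=\mathcal H(K)$ the associated reproducing kernel Hilbert space on $[0,1]$ with norm $\|\cdot\|_{\mathcal H}$, and $\mu_1\ge\mu_2\ge\cdots\ge0$ are the eigenvalues of $K$ viewed as an integral operator on $L^2[0,1]$. Define $$\overline{\mathcal G}{}^K_n(\delta)=\left\{\frac2n\sum_{j=1}^\infty\min(\mu_j,\delta^2)\right\}^{1/2}.$$ **Estimator.** $\hat f_{n,K}=\arg\min_{g\in\mathcal H}\left\{\frac12\|y-g\|_n^2+\lambda_n\|g\|_{\mathcal H}^2\right\}$. The regularization parameter $\lambda_n$ is chosen in the range $[2\delta_n^2,C_0\delta_n^2]$ for a fixed constant $C_0>2$, where $\delta_n$ (depending on the design) is the smallest positive solution of $2\,\mathcal G_n(\delta)\le\delta^2$ and $$\mathcal G_n(\delta)=E_w\left\{\sup_{g\in\partial\mathcal H_n(\delta)}|\langle w,g\rangle_n|\;\Big|\;\mathbb X_n\right\},\quad w\sim N(0,I_n),$$ $$\partial\mathcal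 H_n(\delta)=\{g\in\partial\mathcal H:\|g\|_{\mathcal H}\le3,\ \|g\|_n\le\delta\},\qquad \partial\mathcal H=\{g-h:g,h\in\mathcal H\}.$$
   Formalization: The Hilbert space H(K) is additionally assumed separable (automatic for continuous K); without this the claim fails, e.g. for K(x,y) = min(x,y) + 1{x=y}, whose eigenvalues ignore the diagonal term while δ_n² is at least of order n^{-1/2}. *)

(* Defs.v *)
From HB Require Import structures.
From mathcomp Require Import all_boot all_order all_algebra.
From mathcomp Require Import all_classical all_reals all_analysis.

Set Implicit Arguments.
Unset Strict Implicit.
Unset Printing Implicit Defensive.

Import Order.TTheory GRing.Theory Num.Theory.
Import numFieldNormedType.Exports.

Local Open Scope classical_set_scope.
Local Open Scope ring_scope.

(* Kernels are functions R -> R -> R of which only the values on [0,1]^2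
   matter. *)
Section Kernel.
Context {R : realType}.
Implicit Type K : R -> R -> R.

Definition I01 : set R := `[0, 1]%classic.

Definition psd_kernel K : Prop :=
  (forall x y : R, I01 x -> I01 y -> K x y = K y x) /\
  (forall (m : nat) (t a : 'I_m -> R), (forall i, I01 (t i)) ->
     0 <= \sum_(i < m) \sum_(j < m) a i * a j * K (t i) (t j)).

Definition bounded_kernel K : Prop :=
  exists B : R, forall x y : R, I01 x -> I01 y ->
    `|K x y| <= B.

Definition jointly_measurable K : Prop :=
  measurable_fun (I01 `*` I01) (fun p => K p.1 p.2).

Definition L2_01 : set (R -> R) :=
  [set phi : R -> R | measurable_fun I01 phi /\
    (\int[lebesgue_measure]_(x in I01) (phi x ^+ 2)%:E < +oo)%E].

Definition L2_01_ip (phi psi : R -> R) : R :=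
  \int[lebesgue_measure]_(x in I01) (phi x * psi x).

Definition integral_op K (phi : R -> R) (x : R) : R :=
  \int[lebesgue_measure]_(y in I01) (K x y * phi y).

Definition L2_01_eq (phi psi : R -> R) : Prop :=
  {ae lebesgue_measure, forall x, I01 x -> phi x = psi x}.

(* mu lists (0-based) the eigenvalues of the integral operator of K on
   L^2[0,1] with multiplicity, in nonincreasing order: there are orthonormal
   eigenfunctions phi_j for mu_j, and no eigenfunction with a nonzero
   eigenvalue is orthogonal to all of them.  If there are finitely many nonzero
   eigenvalues, the list continues with zeros; if there are infinitely many,
   an eigenvalue 0 is not listed. *)
Definition kernel_eigenvalues K (mu : nat -> R) : Prop :=
  [/\ forall j, 0 <= mu j,
      forall i j, (i <= j)%N -> mu j <= mu i
    & exists phi : nat -> R -> R,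
      [/\ forall j, L2_01 (phi j),
          forall i j, L2_01_ip (phi i) (phi j) = (i == j)%:R,
          forall j, L2_01_eq (integral_op K (phi j)) (fun x => mu j * phi j x)
        & forall (a : R) (psi : R -> R), a != 0 -> L2_01 psi ->
            L2_01_eq (integral_op K psi) (fun x => a * psi x) ->
            (forall j, L2_01_ip psi (phi j) = 0) ->
            L2_01_eq psi (fun=> 0)]].

(* The RKHS of K on [0,1].  An element g is identified with the function
   rkhs_eval g restricted to [0,1]; rkhs_section x is the function K(x, .). *)
Record rkhs K := RKHS {
  rkhs_space :> completeNormedModType R ;
  rkhs_ip : rkhs_space -> rkhs_space -> R ;
  rkhs_eval : rkhs_space -> R -> R ;
  rkhs_section : R -> rkhs_space ;
  rkhs_ipC : forall g h, rkhs_ip g h = rkhs_ip h g ;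
  rkhs_ip_linear : forall (a : R) g1 g2 h,
    rkhs_ip (a *: g1 + g2) h = a * rkhs_ip g1 h + rkhs_ip g2 h ;
  rkhs_ip_norm : forall g, rkhs_ip g g = `|g| ^+ 2 ;
  rkhs_eval_linear : forall (a : R) g h x, I01 x ->
    rkhs_eval (a *: g + h) x = a * rkhs_eval g x + rkhs_eval h x ;
  rkhs_eval_inj : forall g h,
    (forall x, I01 x -> rkhs_eval g x = rkhs_eval h x) -> g = h ;
  rkhs_sectionE : forall x y, I01 x -> I01 y ->
    rkhs_eval (rkhs_section x) y = K x y ;
  rkhs_reproducing : forall g x, I01 x ->
    rkhs_ip g (rkhs_section x) = rkhs_eval g x
}.

(* For a bounded measurable kernel, separability of the RKHS ties the
   eigenvalues to the values of K on the diagonal (\int K(x,x) dx = \sum mu_j).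
   It holds for continuous K and excludes kernels like K(x,y) = 1_{x = y},
   whose integral operator is zero although its kernel matrices are not. *)
Definition separable (T : topologicalType) : Prop :=
  exists D : set T, countable D /\ dense D.

End Kernel.

Section Radii.
Context {R : realType}.

Definition positive_solutions (G : R -> \bar R) : set R :=
  [set delta | 0 < delta /\ (2%:E * G delta <= (delta ^+ 2)%:E)%E].

(* Smallest positive solution of 2 G(delta) <= delta^2, as an infimum so that
   it is total: in the degenerate case where G vanishes identically, every
   delta > 0 is a solution and the value is 0. *)
Definition smallest_positive_solution (G : R -> \bar R) : R :=
  inf (positive_solutions G).

Lemma smallest_positive_solutionE (G : R -> \bar R) (delta : R) :
  positive_solutions G delta ->
  (forall e, positive_solutions G e -> delta <= e) ->
  smallest_positive_solution G = delta.
Proof.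
move=> Gd dmin; apply/eqP; rewrite eq_le; apply/andP; split.
  by apply: ge_inf => //; exists delta.
by apply: lb_le_inf => //; exists delta.
Qed.

Definition kernel_complexity (mu : nat -> R) (n : nat) (delta : R) : \bar R :=
  sqrte ((2 / n%:R)%:E *
         \sum_(0 <= j <oo) (Num.min (mu j) (delta ^+ 2))%:E)%E.

Definition gamma_radius (mu : nat -> R) (n : nat) : R :=
  smallest_positive_solution (kernel_complexity mu n).

Definition emp_ip (n : nat) (a b : 'I_n -> R) : R :=
  n%:R^-1 * \sum_(i < n) a i * b i.

Definition emp_norm (n : nat) (a : 'I_n -> R) : R := Num.sqrt (emp_ip a a).

(* E F(w) for w ~ N(0, I_n), as an iterated integral over the coordinates. *)
Fixpoint gauss_expectation (n : nat) : (n.-tuple R -> \bar R) -> \bar R :=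
  match n with
  | 0 => fun F => F [tuple]
  | m.+1 => fun F =>
      (\int[normal_prob 0 1]_z
         gauss_expectation (fun t : m.-tuple R => F [tuple of z :: t]))%E
  end.

Section Localized.
Variables (K : R -> R -> R) (H : rkhs K) (n : nat).
Implicit Type x : 'I_n -> R.

Definition at_design (g : H) x (i : 'I_n) : R := rkhs_eval g (x i).

Definition diff_class : set H := [set u | exists g h : H, u = g - h].

Definition local_diff_class x (delta : R) : set H :=
  [set g | [/\ diff_class g, `|g| <= 3 & emp_norm (at_design g x) <= delta]].

Definition local_complexity x (delta : R) : \bar R :=
  gauss_expectation (fun w : n.-tuple R =>
    ereal_sup [set (`|emp_ip (tnth w) (at_design g x)|)%:E
              | g in local_diff_class x delta]).

Definition delta_radius x : R :=
  smallest_positive_solution (local_complexity x).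

Definition krr_objective x (y : 'I_n -> R) (lambda : R) (g : H) : R :=
  2^-1 * emp_norm (fun i => y i - at_design g x i) ^+ 2 + lambda * `|g| ^+ 2.

Definition krr_minimizer x (y : 'I_n -> R) (lambda : R) (ghat : H) : Prop :=
  forall g : H, krr_objective x y lambda ghat <= krr_objective x y lambda g.

Definition emp_loss (f : R -> R) x (g : H) : R :=
  emp_norm (fun i => f (x i) - at_design g x i) ^+ 2.

Definition best_emp_loss (f : R -> R) x (r : R) : R :=
  inf [set emp_loss f x g | g in [set g : H | `|g| <= r]].

End Localized.
End Radii.

Section Model.
Context {R : realType} {d : measure_display} {Omega : measurableType d}
  (P : probability Omega R).

(* The product rule over the whole finite family, for arbitrary measurable
   A i, contains that of each subfamily (take A i = setT). *)
Definition mutually_independent (I : finType) (V : I -> {RV P >-> R}) : Prop :=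
  forall A : I -> set R, (forall i, measurable (A i)) ->
    P (\bigcap_(i in [set: I]) (V i @^-1` A i)) =
    (\prod_(i : I) P (V i @^-1` A i))%E.

Variables (K : R -> R -> R) (H : rkhs K) (n : nat).

Definition design_at (X : 'I_n -> {RV P >-> R}) (w : Omega) : 'I_n -> R :=
  fun i => X i w.

(* The random design model y_i = f(x_i) + z_i and the estimator fhat in H with
   random regularization parameter lambda. *)
Record rkhs_regression (C0 : R) (X Z : 'I_n -> {RV P >-> R}) (f : R -> R)
    (lambda : {RV P >-> R}) (fhat : Omega -> H) : Prop := {
  regression_fun_measurable : measurable_fun I01 f ;
  design_uniform : forall i (A : set R), measurable A ->
    distribution P (X i) A = uniform_prob (@ltr01 R) A ;
  noise_normal : forall i (A : set R), measurable A ->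
    distribution P (Z i) A = normal_prob 0 1 A ;
  design_noise_independent :
    mutually_independent (fun s : 'I_n + 'I_n =>
      match s with inl i => X i | inr i => Z i end) ;
  lambda_range : {ae P, forall w,
    2 * delta_radius H (design_at X w) ^+ 2 <= lambda w
      <= C0 * delta_radius H (design_at X w) ^+ 2} ;
  fhat_minimizer : {ae P, forall w,
    krr_minimizer (design_at X w) (fun i => f (X i w) + Z i w)
      (lambda w) (fhat w)}
}.

Definition risk (X : 'I_n -> {RV P >-> R}) (f : R -> R) (fhat : Omega -> H) :
  \bar R := ('E_P[fun w => emp_loss f (design_at X w) (fhat w)])%E.

Definition expected_approx_error (X : 'I_n -> {RV P >-> R}) (f : R -> R)
  (r : R) : \bar R := ('E_P[fun w => best_emp_loss H f (design_at X w) r])%E.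

End Model.

(* Main.v *)
Require Import Defs.
From HB Require Import structures.
From mathcomp Require Import all_boot all_order all_algebra.
From mathcomp Require Import all_classical all_reals all_analysis.
From mathcomp Require Import measurable_realfun ring lra.

Set Implicit Arguments.
Unset Strict Implicit.
Unset Printing Implicit Defensive.

Import Order.TTheory GRing.Theory Num.Theory.
Import numFieldNormedType.Exports.

Local Open Scope classical_set_scope.
Local Open Scope ring_scope.

(** For a design x with features k_i = K(x_i, .) in H, the whole argument runs
    through the ridge energy

      Q_t(z) = max_u (2 <z, u>_n - |u|_n^2 - t |u|_H^2),

    a quadratic form in z, and through its trace D_t, the normalized effective
    dimension, which is also the mean of Q_t(z) over standard normal noise.

    The random radius is controlled by D. The supremum in the local complexity at
    delta is at least delta * sqrt Q_t(w) and at most 2 Q_t(w) + delta^2 / 4, where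
    t = delta^2 / 9; comparing the mean of sqrt Q_t with the root of the mean of
    Q_t, by the fourth moment of Gaussian forms, gives

      delta_n^2 <= delta^2 + 8 D_{delta^2/9}             (delta_radius_le),
      delta_n < delta  implies  D_{delta^2/9} <= delta^2 (delta_radius_lt).

    The effective dimension has a small mean. For any orthonormal e_1, ..., e_k in
    H, D_t is at most k / n plus the residual trace of the features off their span
    over n^2 t (eff_dim_rank). With the eigendirections of mu_j above t this
    averages to E D_t <= (1 / (n t)) sum_j min(mu_j, t), provided that K(x, x)
    integrates to the sum of the eigenvalues. The trace identity is where
    separability enters: an element orthogonal to all eigenfunctions must vanish
    almost everywhere, since otherwise the L^2 form would have a maximizer on the
    unit ball, by weak compactness, and that maximizer would be a further
    eigenfunction; hence almost all sections of the kernel lie in the closed span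
    of the eigenfunctions (trace_le, residual_trace). For a solution delta of
    2 Gbar(delta) <= delta^2 the mean of D_{delta^2/9} is therefore at most
    9 delta^2 / 8 (expected_eff_dim_le).

    The minimizing property gives, whenever t <= 4 lambda,

      |f - fhat|_n^2 <= 3 |f - g|_n^2 + 8 lambda |g|_H^2 + 8 Q_t(z)

    (oracle_pointwise). The regularization may depend on the noise and its random
    radius may be far below delta, so the scale t has to be random too. Put
    s_k = delta^2 / 4^k and let V_k be the event D_{s_k/9} <= s_k. Outside of V_k
    the radius is at least sqrt s_k, so some energy among Q_{s_0/9} and the
    1_{V_k} Q_{s_k/9} is always admissible, unless all V_k hold, in which case all
    features vanish and the loss is the best possible. As V_k depends on the design
    only, independence gives 1_{V_k} Q_{s_k/9} the mean E 1_{V_k} D_{s_k/9} <= s_k,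
    and the sum over k is a multiple of delta^2 (noise_mean_le). Taking the infimum
    over the solutions delta yields risk_le and the oracle inequality.

    Risk and approximation error are integrals of functions that are not known to
    be measurable. Integrals of nonnegative functions are monotone without
    measurability, so the loss needs only a measurable upper bound; the best loss
    is measurable almost surely as an infimum over a countable dense set. *)

(** * Hilbert space geometry *)

Section Hilbert.
Context {R : realType} {K : R -> R -> R} {H : rkhs K}.
Implicit Types (g h u : H) (a : R).
Local Notation ip := (@rkhs_ip R K H).

Lemma ipC g h : ip g h = ip h g.
Proof. exact: rkhs_ipC. Qed.

Lemma ipDl g1 g2 h : ip (g1 + g2) h = ip g1 h + ip g2 h.
Proof. by rewrite -{1}[g1]scale1r rkhs_ip_linear mul1r. Qed.

Lemma ip0l h : ip 0 h = 0.
Proof. by apply: (addrI (ip 0 h)); rewrite -ipDl !addr0. Qed.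

Lemma ipZl a g h : ip (a *: g) h = a * ip g h.
Proof. by rewrite -[a *: g]addr0 rkhs_ip_linear ip0l addr0. Qed.

Lemma ipNl g h : ip (- g) h = - ip g h.
Proof. by rewrite -scaleN1r ipZl mulN1r. Qed.

Lemma ipBl g1 g2 h : ip (g1 - g2) h = ip g1 h - ip g2 h.
Proof. by rewrite ipDl ipNl. Qed.

Lemma ipDr g1 g2 h : ip h (g1 + g2) = ip h g1 + ip h g2.
Proof. by rewrite !(ipC h) ipDl. Qed.

Lemma ip0r h : ip h 0 = 0.
Proof. by rewrite ipC ip0l. Qed.

Lemma ipZr a g h : ip h (a *: g) = a * ip h g.
Proof. by rewrite !(ipC h) ipZl. Qed.

Lemma ipBr g1 g2 h : ip h (g1 - g2) = ip h g1 - ip h g2.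
Proof. by rewrite !(ipC h) ipBl. Qed.

Lemma ip_suml (I : Type) (r : seq I) (P : pred I) (F : I -> H) h :
  ip (\sum_(i <- r | P i) F i) h = \sum_(i <- r | P i) ip (F i) h.
Proof. by elim/big_ind2 : _ => [|? ? ? ? <- <-|]; rewrite ?ip0l ?ipDl. Qed.

Lemma ip_sumr (I : Type) (r : seq I) (P : pred I) (F : I -> H) h :
  ip h (\sum_(i <- r | P i) F i) = \sum_(i <- r | P i) ip h (F i).
Proof. by rewrite ipC ip_suml; apply: eq_bigr => i _; rewrite ipC. Qed.

Lemma ip_ge0 g : 0 <= ip g g.
Proof. by rewrite rkhs_ip_norm sqr_ge0. Qed.

Lemma ip_eq0 g : ip g g = 0 -> g = 0.
Proof.
by rewrite rkhs_ip_norm => /eqP; rewrite sqrf_eq0 normr_eq0 => /eqP.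
Qed.

Lemma ip_amgm g h : 2 * ip g h <= `|g| ^+ 2 + `|h| ^+ 2.
Proof.
have := ip_ge0 (g - h); rewrite !(ipBl, ipBr) (ipC h g) !rkhs_ip_norm; lra.
Qed.

Lemma ip_sqr_le g h : ip g h ^+ 2 <= `|g| ^+ 2 * `|h| ^+ 2.
Proof.
have := ip_ge0 (ip g h *: h - (`|h| ^+ 2) *: g).
rewrite !(ipBl, ipBr, ipZl, ipZr) (ipC h g) !rkhs_ip_norm => le0.
have [->|h0] := eqVneq h 0; first by rewrite ip0r normr0 expr0n /= mulr0.
have hp : 0 < `|h| ^+ 2 by rewrite exprn_gt0 ?normr_gt0.
rewrite -(ler_pM2l hp); nra.
Qed.

Lemma CauchySchwarz_ip g h : `|ip g h| <= `|g| * `|h|.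
Proof.
rewrite -(@ler_pXn2r _ 2) ?nnegrE ?mulr_ge0//.
by rewrite real_normK ?num_real// exprMn ip_sqr_le.
Qed.

Lemma ip_cvgl (u : nat -> H) g h :
  u @ \oo --> g -> (fun m => ip (u m) h) @ \oo --> ip g h.
Proof.
move=> ug; apply/cvgrPdist_le => e e0.
have d0 : 0 < e / (`|h| + 1) by rewrite divr_gt0 ?ltr_wpDl.
move/cvgrPdist_le : ug => /(_ _ d0); apply: filterS => m le.
rewrite -ipBl (le_trans (CauchySchwarz_ip _ _))//.
apply: (@le_trans _ _ (e / (`|h| + 1) * `|h|)); first by rewrite ler_wpM2r.
rewrite mulrAC ler_pdivrMr ?ltr_wpDl// ler_wpM2l ?(ltW e0)//.
by rewrite lerDl.
Qed.

Definition lin_subspace (V : set H) : Prop :=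
  V 0 /\ forall a g h, V g -> V h -> V (a *: g + h).

Lemma subspaceZ V a g : lin_subspace V -> V g -> V (a *: g).
Proof. by move=> [V0 VD] Vg; rewrite -[a *: g]addr0; exact: VD. Qed.

Lemma subspaceB V g h : lin_subspace V -> V g -> V h -> V (g - h).
Proof.
by move=> [V0 VD] Vg Vh; rewrite addrC -scaleN1r; exact: VD.
Qed.

(** A polynomial of degree two without constant term that is nonpositive has
    no linear term; this is how first-order conditions are read off from
    extremality. *)
Lemma linear_coef_eq0 (b c : R) :
  (forall e : R, 2 * e * b + e ^+ 2 * c <= 0) -> b = 0.
Proof.
move=> bc; apply/eqP; apply: contraT => b0.
pose d : R := `|c| + 1.
have d0 : 0 < d by rewrite /d ltr_wpDl.
have cd : `|c| <= d by rewrite /d lerDl.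
have := bc (b / d); rewrite leNgt => /negP[].
have -> : 2 * (b / d) * b + (b / d) ^+ 2 * c = b ^+ 2 / d ^+ 2 * (2 * d + c).
  by field; rewrite gt_eqF.
apply: mulr_gt0; first by rewrite divr_gt0 ?exprn_even_gt0//= gt_eqF.
have := ler_norm (- c); have := normr_ge0 c; rewrite normrN /d; lra.
Qed.

(** Riesz representation on a subspace that need not be closed: minimizing
    sequences of |g|^2 - 2 l(g) are Cauchy by the parallelogram law, and the
    limit is a point of the closure. *)
Lemma riesz (V : set H) (l : H -> R) (C : R) : lin_subspace V ->
  (forall a g h, l (a *: g + h) = a * l g + l h) ->
  (forall g, `|l g| <= C * `|g|) ->
  exists h, (exists2 u : nat -> H, forall m, V (u m) & u @ \oo --> h) /\
    (forall g, V g -> ip h g = l g).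
Proof.
move=> VV llin lbd.
have l0 : l 0 = 0.
  by have := llin 1 0 0; rewrite scale1r addr0 mul1r => /eqP;
    rewrite -subr_eq subrr eq_sym => /eqP.
have lD g h : l (g + h) = l g + l h.
  by rewrite -{1}[g]scale1r llin mul1r.
have lZ a g : l (a *: g) = a * l g by rewrite -[a *: g]addr0 llin l0 addr0.
pose J g : R := `|g| ^+ 2 - 2 * l g.
pose S : set R := [set J g | g in V].
have S0 : S !=set0 by exists (J 0); exists 0 => //; exact: VV.1.
have Slb : has_lbound S.
  exists (- C ^+ 2) => _ [g Vg <-].
  have := lbd g; have := ler_norm (l g); rewrite /J.
  have := sqr_ge0 (`|g| - C); nra.
have hinf : has_inf S by split.
have Jmin g : V g -> inf S <= J g by move=> Vg; apply: ge_inf => //; exists g.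
have par g h : V g -> V h ->
    `|g - h| ^+ 2 <= 2 * J g + 2 * J h - 4 * inf S.
  move=> Vg Vh.
  have := Jmin _ (subspaceZ 2^-1 VV (VV.2 1 _ _ Vg Vh)).
  rewrite /J lZ llin scale1r -!rkhs_ip_norm.
  rewrite !(ipBl, ipBr, ipDl, ipDr, ipZl, ipZr) (ipC h g); lra.
have /choice[u uP] : forall m : nat, exists g, V g /\ J g < inf S + m.+1%:R^-1.
  move=> m; have [_ [g Vg <-] Jg] := @inf_adherent _ S m.+1%:R^-1 ltac:(by []) hinf.
  by exists g.
have cu : cvgn u.
  apply/cauchy_cvgP/(@cauchy_exP R) => e e0.
  have e2 : 0 < e ^+ 2 / 4 by rewrite divr_gt0 ?exprn_gt0.
  have [m _ /= mP] := near_infty_natSinv_lt (PosNum e2).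
  have {}mP p : (m <= p)%N -> p.+1%:R^-1 < e ^+ 2 / 4 by exact: mP.
  exists (u m); exists m => // p /= mp.
  rewrite -ball_normE /= -(@ltr_pXn2r _ 2) ?nnegrE ?(ltW e0)//.
  apply: le_lt_trans (par _ _ (uP m).1 (uP p).1) _.
  have := mP _ (leqnn m); have := mP _ mp; have := (uP m).2; have := (uP p).2.
  by move: p.+1%:R^-1 m.+1%:R^-1 => /= a b; lra.
exists (limn u); split; first by exists u => // m; exact: (uP m).1.
move=> g Vg; apply/eqP; rewrite -subr_eq0 -oppr_eq0; apply/eqP.
apply: (@linear_coef_eq0 _ (- `|g| ^+ 2)) => e.
pose v m : R := 2 * e * (l g - ip (u m) g) - e ^+ 2 * `|g| ^+ 2 - m.+1%:R^-1.
have vcvg : v @ \oo --> 2 * e * (l g - ip (limn u) g) - e ^+ 2 * `|g| ^+ 2 - 0.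
  apply: cvgB; last exact: cvg_harmonic.
  apply: cvgB; last exact: cvg_cst.
  apply: cvgM; first exact: cvg_cst.
  apply: cvgB; first exact: cvg_cst.
  exact: ip_cvgl.
have : 2 * e * (l g - ip (limn u) g) - e ^+ 2 * `|g| ^+ 2 - 0 <= 0.
  apply: (cvgr_to_le vcvg); near=> m.
  have := Jmin _ (VV.2 e _ _ Vg (uP m).1).
  have := (uP m).2; rewrite /J /v llin -!rkhs_ip_norm.
  rewrite !(ipBl, ipBr, ipDl, ipDr, ipZl, ipZr) (ipC g (u m)).
  by move: m.+1%:R^-1 => /= a; nra.
by rewrite subr0 opprB mulrN.
Unshelve. all: by end_near. Qed.
End Hilbert.

(** * Kernel ridge regression as a quadratic form in the data *)

Section EmpIp.
Context {R : realType} {n : nat}.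
Implicit Types a b c : 'I_n -> R.

Lemma emp_ipC a b : emp_ip a b = emp_ip b a.
Proof. by congr (_ * _); apply: eq_bigr => i _; rewrite mulrC. Qed.

Lemma emp_ipDl a b c : emp_ip (fun i => a i + b i) c = emp_ip a c + emp_ip b c.
Proof.
by rewrite /emp_ip -mulrDr -big_split; congr (_ * _); apply: eq_bigr => i _;
  rewrite mulrDl.
Qed.

Lemma emp_ipZl (k : R) a c : emp_ip (fun i => k * a i) c = k * emp_ip a c.
Proof.
rewrite /emp_ip [RHS]mulrCA; congr (_ * _); rewrite mulr_sumr.
by apply: eq_bigr => i _; rewrite mulrA.
Qed.

Lemma emp_ipDr a b c : emp_ip c (fun i => a i + b i) = emp_ip c a + emp_ip c b.
Proof. by rewrite !(emp_ipC c) emp_ipDl. Qed.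

Lemma emp_ipZr (k : R) a c : emp_ip c (fun i => k * a i) = k * emp_ip c a.
Proof. by rewrite !(emp_ipC c) emp_ipZl. Qed.

Lemma emp_ipBl a b c : emp_ip (fun i => a i - b i) c = emp_ip a c - emp_ip b c.
Proof.
rewrite -[- emp_ip b c]mulN1r -emp_ipZl -emp_ipDl; congr emp_ip.
by apply/funext => i; rewrite mulN1r.
Qed.

Lemma emp_ipBr a b c : emp_ip c (fun i => a i - b i) = emp_ip c a - emp_ip c b.
Proof. by rewrite !(emp_ipC c) emp_ipBl. Qed.

Lemma emp_ip_ge0 a : 0 <= emp_ip a a.
Proof. by rewrite mulr_ge0// sumr_ge0// => i _; rewrite -expr2 sqr_ge0. Qed.

Lemma emp_norm_sqr a : emp_norm a ^+ 2 = emp_ip a a.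
Proof. by rewrite sqr_sqrtr// emp_ip_ge0. Qed.

Lemma emp_ip_amgm a b : 2 * emp_ip a b <= emp_ip a a + emp_ip b b.
Proof.
have := emp_ip_ge0 (fun i => a i - b i); rewrite !(emp_ipBl, emp_ipBr) (emp_ipC b a).
lra.
Qed.

End EmpIp.

Section Ridge.
Context {R : realType} {K : R -> R -> R} {H : rkhs K} {n : nat}.
Variables (kv : 'I_n -> H).
Implicit Types (t : R) (z : 'I_n -> R) (u : H).
Local Notation ip := (@rkhs_ip R K H).

Definition vals u (i : 'I_n) : R := ip u (kv i).

Definition gram : 'M[R]_n := \matrix_(i, j) ip (kv i) (kv j).

Definition ridge_mx t : 'M[R]_n := gram + (n%:R * t)%:M.

Definition ridge_coef t z (i : 'I_n) : R := \sum_j invmx (ridge_mx t) i j * z j.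

Definition ridge_fit t z : H := \sum_i ridge_coef t z i *: kv i.

(** The smoother matrix, normalized so that its quadratic form is the empirical
    inner product of the data with the ridge fit. *)
Definition smoother t : 'M[R]_n := n%:R^-1 *: (gram *m invmx (ridge_mx t)).

Definition ridge_energy t z : R := \sum_i \sum_j smoother t i j * z i * z j.

(** n times this number is the usual effective dimension tr (G (G + n t I)^-1). *)
Definition eff_dim t : R := \sum_i smoother t i i.

Lemma gram_quad (a b : 'I_n -> R) :
  \sum_i \sum_j a i * gram i j * b j =
  ip (\sum_i a i *: kv i) (\sum_i b i *: kv i).
Proof.
rewrite ip_suml; apply: eq_bigr => i _; rewrite ip_sumr; apply: eq_bigr => j _.
by rewrite !mxE ipZl ipZr; ring.
Qed.

Section Positive.
Variable t : R.
Hypotheses (n0 : (0 < n)%N) (t0 : 0 < t).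

Let nt0 : 0 < n%:R * t. Proof. by rewrite mulr_gt0// ltr0n. Qed.

Lemma ridge_mx_unit : ridge_mx t \in unitmx.
Proof.
rewrite -row_free_unit; apply: inj_row_free => v vM.
have := congr1 (fun B : 'rV_n => (B *m v^T) 0 0) vM.
rewrite mulmxDr mulmxDl mul0mx !mxE mul_mx_scalar.
have -> : \sum_j (v *m gram) 0 j * v^T j 0 =
    ip (\sum_i v 0 i *: kv i) (\sum_i v 0 i *: kv i).
  rewrite -gram_quad exchange_big /=; apply: eq_bigr => j _.
  by rewrite mxE mulr_suml; apply: eq_bigr => i _; rewrite !mxE.
move=> vv0; apply/rowP => i; rewrite mxE.
have s0 : \sum_j v 0 j ^+ 2 <= 0.
  have E : \sum_j ((n%:R * t) *: v) 0 j * v^T j 0 = n%:R * t * \sum_j v 0 j ^+ 2.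
    by rewrite mulr_sumr; apply: eq_bigr => j _; rewrite !mxE expr2 mulrA.
  rewrite -(ler_pM2l nt0) mulr0 -E.
  have := ip_ge0 (\sum_i v 0 i *: kv i); lra.
apply/eqP; rewrite -sqrf_eq0 eq_le sqr_ge0 andbT (le_trans _ s0)//.
by rewrite (bigD1 i)//= lerDl sumr_ge0// => j _; rewrite sqr_ge0.
Qed.

Lemma trmx_gram : gram^T = gram.
Proof. by apply/matrixP => i j; rewrite !mxE ipC. Qed.

Lemma trmx_inv_ridge_mx : (invmx (ridge_mx t))^T = invmx (ridge_mx t).
Proof. by rewrite trmx_inv linearD /= tr_scalar_mx trmx_gram. Qed.

Lemma vals_ridge_fit z i : vals (ridge_fit t z) i = \sum_j gram i j * ridge_coef t z j.
Proof.
by rewrite /vals ip_suml; apply: eq_bigr => j _; rewrite ipZl mxE mulrC ipC.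
Qed.

(** The normal equations: the residual of the fit is n t times the coefficients. *)
Lemma ridge_normal z i :
  z i = vals (ridge_fit t z) i + n%:R * t * ridge_coef t z i.
Proof.
have : ((ridge_mx t *m invmx (ridge_mx t)) *m \col_j z j) i 0 = z i.
  by rewrite mulmxV ?ridge_mx_unit// mul1mx mxE.
move=> <-; rewrite -mulmxA mulmxDl mxE mul_scalar_mx [in X in _ + X]mxE.
congr (_ + _ * _).
  rewrite mxE vals_ridge_fit; apply: eq_bigr => j _; congr (_ * _).
  by rewrite mxE; apply: eq_bigr => l _; rewrite mxE.
by rewrite mxE; apply: eq_bigr => l _; rewrite mxE.
Qed.

(** The normal equations in weak form, tested against an arbitrary u. *)
Lemma emp_ip_ridge z u : emp_ip z (vals u) =
  emp_ip (vals (ridge_fit t z)) (vals u) + t * ip (ridge_fit t z) u.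
Proof.
have {1}-> : z = (fun i => vals (ridge_fit t z) i + n%:R * t * ridge_coef t z i).
  by apply/funext => i; exact: ridge_normal.
rewrite emp_ipDl emp_ipZl; congr (_ + _).
rewrite /emp_ip ip_suml [n%:R * t]mulrC -!mulrA; congr (_ * _).
rewrite mulrA mulfV ?pnatr_eq0 -?lt0n// mul1r; apply: eq_bigr => i _.
by rewrite ipZl /vals ipC.
Qed.

Lemma ridge_energyE z :
  ridge_energy t z = emp_ip z (vals (ridge_fit t z)).
Proof.
rewrite /ridge_energy /emp_ip mulr_sumr; apply: eq_bigr => i _.
rewrite vals_ridge_fit mulrCA mulr_sumr mulr_sumr.
under eq_bigr => j _ do rewrite !mxE.
transitivity (\sum_j \sum_l n%:R^-1 * gram i l * invmx (ridge_mx t) l j * z i * z j).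
  apply: eq_bigr => j _; rewrite mulr_sumr !mulr_suml.
  by apply: eq_bigr => l _; rewrite !mulrA.
rewrite exchange_big /=; apply: eq_bigr => l _.
rewrite /ridge_coef !mulr_sumr; apply: eq_bigr => j _; ring.
Qed.

Lemma ridge_energy_fit z : ridge_energy t z =
  emp_ip (vals (ridge_fit t z)) (vals (ridge_fit t z)) + t * `|ridge_fit t z| ^+ 2.
Proof. by rewrite ridge_energyE emp_ip_ridge rkhs_ip_norm. Qed.

Lemma ridge_energy_ge0 z : 0 <= ridge_energy t z.
Proof. by rewrite ridge_energy_fit addr_ge0 ?emp_ip_ge0// mulr_ge0 ?(ltW t0). Qed.

(** The energy is the maximum of a concave functional, attained at the ridge
    fit; all comparisons between noise, penalty and design go through it. *)
Lemma ridge_energy_max z u :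
  2 * emp_ip z (vals u) - emp_ip (vals u) (vals u) - t * `|u| ^+ 2 <=
  ridge_energy t z.
Proof.
rewrite emp_ip_ridge ridge_energy_fit.
have := emp_ip_amgm (vals (ridge_fit t z)) (vals u).
have : t * (2 * ip (ridge_fit t z) u) <= t * (`|ridge_fit t z| ^+ 2 + `|u| ^+ 2).
  by rewrite ler_pM2l// ip_amgm.
lra.
Qed.

Lemma smootherC i j : smoother t i j = smoother t j i.
Proof.
rewrite /smoother -[in LHS](trmxK (gram *m _)) trmx_mul trmx_inv_ridge_mx trmx_gram.
rewrite [LHS]mxE [RHS]mxE mxE; congr (_ * _).
have MG : ridge_mx t *m gram = gram *m ridge_mx t.
  by rewrite mulmxDl mulmxDr scalar_mxC.
suff -> : gram *m invmx (ridge_mx t) = invmx (ridge_mx t) *m gram by [].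
rewrite -[LHS]mul1mx -(mulVmx ridge_mx_unit) -!mulmxA; congr (_ *m _).
by rewrite mulmxA MG -mulmxA mulmxV ?ridge_mx_unit// mulmx1.
Qed.

Definition unit_vec (i j : 'I_n) : R := (j == i)%:R.

Lemma quad_two (A : 'M[R]_n) i j (a b : R) :
  \sum_k \sum_l A k l * (a * unit_vec i k + b * unit_vec j k) *
    (a * unit_vec i l + b * unit_vec j l) =
  a ^+ 2 * A i i + a * b * (A i j + A j i) + b ^+ 2 * A j j.
Proof.
have pick (F : 'I_n -> R) l : \sum_k F k * unit_vec l k = F l.
  rewrite (bigD1 l)//= /unit_vec eqxx mulr1 big1 ?addr0// => k /negbTE ->.
  by rewrite mulr0.
have pick2 k : \sum_l A k l * (a * unit_vec i k + b * unit_vec j k) *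
    (a * unit_vec i l + b * unit_vec j l) =
    (a * A k i + b * A k j) * a * unit_vec i k + (a * A k i + b * A k j) * b * unit_vec j k.
  set c := a * unit_vec i k + _.
  rewrite (eq_bigr (fun l => A k l * c * a * unit_vec i l + A k l * c * b * unit_vec j l)).
    by rewrite big_split /= (pick (fun l => A k l * c * a)) (pick (fun l => A k l * c * b)) /c; ring.
  by move=> l _; ring.
under eq_bigr => k _ do rewrite pick2.
rewrite big_split /= (pick (fun k => (a * A k i + b * A k j) * a)).
by rewrite (pick (fun k => (a * A k i + b * A k j) * b)); ring.
Qed.

Lemma ridge_energy_unit i : ridge_energy t (unit_vec i) = smoother t i i.
Proof.
have := quad_two (smoother t) i i 1 0.
rewrite expr0n /= expr1n !(mul0r, mulr0, mul1r, addr0) => <-.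
by apply: eq_bigr => k _; apply: eq_bigr => l _; rewrite !(mul1r, mul0r, addr0).
Qed.

Lemma smoother_ge0 i : 0 <= smoother t i i.
Proof. by rewrite -ridge_energy_unit ridge_energy_ge0. Qed.

Lemma eff_dim_ge0 : 0 <= eff_dim t.
Proof. by apply: sumr_ge0 => i _; exact: smoother_ge0. Qed.

(** The form is nonnegative on the span of the i-th and j-th unit vectors. *)
Lemma smoother_minor i j : smoother t i j ^+ 2 <= smoother t i i * smoother t j j.
Proof.
have Q0 a b : 0 <= a ^+ 2 * smoother t i i + a * b * (2 * smoother t i j)
    + b ^+ 2 * smoother t j j.
  have <- : smoother t i j + smoother t j i = 2 * smoother t i j.
    by rewrite (smootherC j i); ring.
  rewrite -quad_two; exact: ridge_energy_ge0.
have := smoother_ge0 i; have := smoother_ge0 j.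
move: (smoother t i i) (smoother t j j) (smoother t i j) Q0 => p q s Q0 q0 p0.
have [qe|qn0] := eqVneq q 0; last first.
  have qp : 0 < q by rewrite lt_neqAle eq_sym qn0.
  by rewrite -(ler_pM2r qp); have := Q0 q (- s); nra.
have := Q0 s (- (p + 1)); rewrite qe !mulr0 addr0.
have := sqr_ge0 s; nra.
Qed.

End Positive.

(** By maximality: the fit for the larger penalty is a competitor for the
    smaller one. *)
Lemma ridge_energy_anti (n0 : (0 < n)%N) t t' z : 0 < t -> t <= t' ->
  ridge_energy t' z <= ridge_energy t z.
Proof.
move=> t0 tt'; have t'0 : 0 < t' by exact: lt_le_trans tt'.
have := ridge_energy_max n0 t0 z (ridge_fit t' z).
have := ridge_energyE t' z; have := ridge_energy_fit n0 t'0 z.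
have : t * `|ridge_fit t' z| ^+ 2 <= t' * `|ridge_fit t' z| ^+ 2.
  by rewrite ler_wpM2r.
lra.
Qed.

Lemma eff_dim_anti (n0 : (0 < n)%N) t t' : 0 < t -> t <= t' ->
  eff_dim t' <= eff_dim t.
Proof.
move=> t0 tt'; apply: ler_sum => i _.
by rewrite -!ridge_energy_unit ridge_energy_anti.
Qed.

(** The energy of the i-th unit vector dominates what any multiple e of the i-th
    feature achieves, namely 2 e |k_i|^2 / n up to a term of order e^2 that is
    bounded for t <= 1; small energies therefore leave no linear term in e. *)
Lemma eff_dim_small (n0 : (0 < n)%N) :
  (forall e, 0 < e -> exists t, [/\ 0 < t, t <= 1 & eff_dim t <= e]) ->
  forall i, kv i = 0.
Proof.
move=> small i; apply: ip_eq0.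
have nV0 : n%:R^-1 != 0 :> R by rewrite invr_neq0// pnatr_eq0 -lt0n.
apply: (mulfI nV0); rewrite mulr0.
(* t <= 1 makes the coefficient of e ^ 2 independent of t *)
pose c := - (emp_ip (vals (kv i)) (vals (kv i)) + `|kv i| ^+ 2).
apply: (@linear_coef_eq0 _ _ c) => e; apply/ler_addgt0Pr => d d0.
have [t [t0 t1 Dt]] := small d d0; rewrite add0r; apply: le_trans Dt.
have -> : eff_dim t = smoother t i i + \sum_(j | j != i) smoother t j j.
  by rewrite /eff_dim (bigD1 i).
apply: (@le_trans _ _ (smoother t i i)); last first.
  by rewrite lerDl sumr_ge0// => j _; exact: smoother_ge0.
rewrite -ridge_energy_unit; apply: le_trans (ridge_energy_max n0 t0 _ (e *: kv i)).
have -> : vals (e *: kv i) = (fun j => e * vals (kv i) j).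
  by apply/funext => j; rewrite /vals ipZl.
rewrite !(emp_ipZl, emp_ipZr) normrZ exprMn real_normK ?num_real//.
have -> : emp_ip (unit_vec i) (vals (kv i)) = n%:R^-1 * ip (kv i) (kv i).
  rewrite /emp_ip (bigD1 i)//= /unit_vec eqxx mul1r big1 ?addr0// => j /negbTE ->.
  by rewrite mul0r.
have : t * (e ^+ 2 * `|kv i| ^+ 2) <= 1 * (e ^+ 2 * `|kv i| ^+ 2).
  by rewrite ler_wpM2r// mulr_ge0// sqr_ge0.
rewrite /c; lra.
Qed.

(** Schur's product theorem for Gram matrices: splitting off the components of
    the second family along one of its vectors at a time leaves a sum of
    quadratic forms of the first Gram matrix. *)
Lemma schur_gram (d : 'I_n -> H) :
  0 <= \sum_i \sum_j gram i j * ip (d i) (d j).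
Proof.
suff main r : forall d : 'I_n -> H, (forall i : 'I_n, (r <= i)%N -> d i = 0) ->
    0 <= \sum_i \sum_j gram i j * ip (d i) (d j).
  by apply: (main n) => i; rewrite leqNgt ltn_ord.
elim: r => [|r IH] {}d d0.
  by rewrite big1// => i _; rewrite big1// => j _; rewrite d0// ip0l mulr0.
have [nr|rn] := leqP n r.
  by apply: IH => i ri; have := ltn_ord i; rewrite ltnNge (leq_trans nr ri).
pose p := Ordinal rn.
have [dp0|dp0] := eqVneq (d p) 0.
  apply: IH => i; rewrite leq_eqVlt => /orP[/eqP ri|/d0//].
  by rewrite (_ : i = p)//; exact/val_inj.
have np0 : `|d p| ^+ 2 != 0 by rewrite sqrf_eq0 normr_eq0.
pose b i := ip (d i) (d p) / `|d p| ^+ 2.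
pose d' i := d i - b i *: d p.
have dE i j : ip (d i) (d j) = ip (d' i) (d' j) + `|d p| ^+ 2 * (b i * b j).
  rewrite /d' !(ipBl, ipBr, ipZl, ipZr) (ipC (d p) (d j)) rkhs_ip_norm /b.
  by field; rewrite normr_eq0.
have -> : \sum_i \sum_j gram i j * ip (d i) (d j) =
    \sum_i \sum_j gram i j * ip (d' i) (d' j) +
    `|d p| ^+ 2 * \sum_i \sum_j b i * gram i j * b j.
  rewrite mulr_sumr -big_split; apply: eq_bigr => i _.
  rewrite mulr_sumr -big_split; apply: eq_bigr => j _.
  by rewrite dE /=; ring.
rewrite addr_ge0 ?mulr_ge0 ?sqr_ge0 ?gram_quad ?ip_ge0//.
apply: IH => i; rewrite leq_eqVlt => /orP[/eqP ri|ri].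
  rewrite (_ : i = p); last exact/val_inj.
  by rewrite /d' /b rkhs_ip_norm divff// scale1r subrr.
by rewrite /d' /b d0// ip0l mul0r scale0r subr0.
Qed.

Section RankBound.
Variable t : R.
Hypotheses (n0 : (0 < n)%N) (t0 : 0 < t).
Local Notation N := (invmx (ridge_mx t)).

Let nt0 : 0 < n%:R * t. Proof. by rewrite mulr_gt0// ltr0n. Qed.

(** The sum is <u, g> for the ridge fit g to the values of u, and a ridge fit
    satisfies |g|^2 <= <u, g>. *)
Lemma inv_ridge_rank1 u : `|u| ^+ 2 = 1 ->
  \sum_i \sum_l N i l * (vals u i * vals u l) <= 1.
Proof.
move=> u1; pose c := ridge_coef t (vals u); pose g := ridge_fit t (vals u).
have -> : \sum_i \sum_l N i l * (vals u i * vals u l) = ip u g.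
  rewrite /g /ridge_fit ip_sumr; apply: eq_bigr => i _; rewrite ipZr.
  rewrite /ridge_coef mulr_suml; apply: eq_bigr => l _.
  by rewrite /vals; ring.
have gE : ip u g = `|g| ^+ 2 + n%:R * t * \sum_i c i ^+ 2.
  rewrite -rkhs_ip_norm {1}/g {2}/g /ridge_fit !ip_sumr mulr_sumr -big_split.
  apply: eq_bigr => i _; rewrite !ipZr /= -/(vals u i) -/(vals g i).
  by rewrite (ridge_normal n0 t0 (vals u) i) /c /g; ring.
have : 0 <= n%:R * t * \sum_i c i ^+ 2.
  by rewrite mulr_ge0 ?(ltW nt0)// sumr_ge0// => i _; exact: sqr_ge0.
have := ip_amgm u g; lra.
Qed.

(** Writing v = (G + n t I) d, the difference of the two sides is a sum of
    squares plus a Schur product of the Gram matrices of the features and of d. *)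
Lemma inv_ridge_trace (v : 'I_n -> H) :
  \sum_i \sum_l N i l * ip (v i) (v l) <= (n%:R * t)^-1 * \sum_i `|v i| ^+ 2.
Proof.
pose d i := \sum_l N i l *: v l.
pose w i := \sum_j gram i j *: d j.
have vE i : v i = w i + (n%:R * t) *: d i.
  have -> : v i = \sum_l (ridge_mx t *m N) i l *: v l.
    rewrite mulmxV ?ridge_mx_unit// (bigD1 i)//= mxE eqxx scale1r big1 ?addr0//.
    by move=> l li; rewrite mxE eq_sym (negbTE li) scale0r.
  rewrite mulmxDl mul_scalar_mx /w /d scaler_sumr.
  rewrite (eq_bigr (fun l => (gram *m N) i l *: v l + (n%:R * t) *: (N i l *: v l))).
    rewrite big_split /=; congr (_ + _).
    under eq_bigr => l _ do rewrite mxE scaler_suml.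
    rewrite exchange_big /=; apply: eq_bigr => j _; rewrite scaler_sumr.
    by apply: eq_bigr => l _; rewrite scalerA.
  by move=> l _; rewrite scalerA -scalerDl; congr (_ *: _); rewrite !mxE.
have -> : \sum_i \sum_l N i l * ip (v i) (v l) = \sum_i ip (v i) (d i).
  by apply: eq_bigr => i _; rewrite ip_sumr; apply: eq_bigr => l _; rewrite ipZr.
rewrite -(ler_pM2l nt0) mulrA mulfV ?gt_eqF// mul1r -subr_ge0.
have -> : \sum_i `|v i| ^+ 2 - n%:R * t * \sum_i ip (v i) (d i) =
    \sum_i `|w i| ^+ 2 + n%:R * t * \sum_i \sum_j gram i j * ip (d i) (d j).
  rewrite !mulr_sumr -sumrB -big_split; apply: eq_bigr => i _ /=.
  have -> : \sum_j gram i j * ip (d i) (d j) = ip (d i) (w i).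
    by rewrite ip_sumr; apply: eq_bigr => j _; rewrite ipZr.
  rewrite -!rkhs_ip_norm vE !(ipDl, ipDr, ipZl, ipZr) (ipC (w i) (d i)); ring.
apply: addr_ge0; last by rewrite mulr_ge0 ?(ltW nt0) ?schur_gram.
by apply: sumr_ge0 => i _; exact: sqr_ge0.
Qed.

(** The kernel matrix is split into its part on the span of an orthonormal
    system, where each direction contributes at most one to the trace, and the
    Gram matrix of the residuals, where the inverse penalty bounds the inverse
    ridge matrix. The system may be chosen independently of the design. *)
Lemma eff_dim_rank k (e : 'I_k -> H) :
  (forall i j, ip (e i) (e j) = (i == j)%:R) ->
  n%:R * eff_dim t <= k%:R + (n%:R * t)^-1 *
    \sum_i (`|kv i| ^+ 2 - \sum_j ip (kv i) (e j) ^+ 2).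
Proof.
move=> ee; pose v i := kv i - \sum_j ip (kv i) (e j) *: e j.
have ve i j : ip (v i) (e j) = 0.
  rewrite /v ipBl ip_suml (bigD1 j)//= ipZl ee eqxx mulr1 big1 ?addr0 ?subrr//.
  by move=> l /negbTE lj; rewrite ipZl ee lj mulr0.
have vv i l : ip (kv i) (kv l) =
    ip (v i) (v l) + \sum_j vals (e j) i * vals (e j) l.
  have -> : ip (v i) (v l) = ip (v i) (kv l).
    rewrite {2}/v ipBr ip_sumr big1 ?subr0// => j _; by rewrite ipZr ve mulr0.
  rewrite /v ipBl ip_suml [X in _ - X + _](_ : _ = \sum_j vals (e j) i * vals (e j) l).
    by rewrite subrK.
  by apply: eq_bigr => j _; rewrite ipZl /vals (ipC (kv i)).
have -> : n%:R * eff_dim t = \sum_i \sum_l N i l * ip (kv i) (kv l).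
  rewrite mulr_sumr; apply: eq_bigr => i _; rewrite mxE mulrA mulfV; last first.
    by rewrite pnatr_eq0 -lt0n.
  rewrite mul1r mxE; apply: eq_bigr => l _; rewrite mxE mulrC; congr (_ * _).
  by rewrite -[in LHS](trmx_inv_ridge_mx t) mxE.
have -> : \sum_i \sum_l N i l * ip (kv i) (kv l) =
    \sum_j \sum_i \sum_l N i l * (vals (e j) i * vals (e j) l) +
    \sum_i \sum_l N i l * ip (v i) (v l).
  rewrite [X in _ = X + _]exchange_big -big_split; apply: eq_bigr => i _ /=.
  rewrite [X in _ = X + _]exchange_big -big_split; apply: eq_bigr => l _ /=.
  by rewrite vv mulrDr -mulr_sumr addrC.
apply: lerD.
  have -> : k%:R = \sum_(j < k) (1 : R) by rewrite sumr_const card_ord.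
  apply: ler_sum => j _; apply: inv_ridge_rank1.
  by rewrite -rkhs_ip_norm ee eqxx.
apply: le_trans (inv_ridge_trace v) _.
rewrite le_eqVlt; apply/orP; left; apply/eqP; congr (_ * _).
apply: eq_bigr => i _; rewrite -!rkhs_ip_norm (vv i i).
rewrite (eq_bigr (fun j => ip (kv i) (e j) ^+ 2)) ?addrK// => j _.
by rewrite /vals ipC expr2.
Qed.

End RankBound.
End Ridge.

(** * Integration of possibly nonmeasurable functions *)

Section LowerIntegral.
Context d (T : measurableType d) (R : realType).
Variable mu : {measure set T -> \bar R}.
Local Open Scope ereal_scope.

(** The integral of a nonnegative function is a supremum over simple functions
    below it, so it is monotone without any measurability. *)
Lemma ge0_le_integral_nonmeas (f g : T -> \bar R) :
  (forall x, 0 <= f x) -> (forall x, f x <= g x) ->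
  \int[mu]_x f x <= \int[mu]_x g x.
Proof.
move=> f0 fg; have g0 x : 0 <= g x by exact: le_trans (fg x).
rewrite !ge0_integralTE//; apply: le_ereal_sup => _ [h hf <-].
by exists h => // x; exact: le_trans (fg x).
Qed.

(** The negative part of f only lowers the integral. *)
Lemma le_integral_nonmeas (f g : T -> \bar R) :
  (forall x, 0 <= g x) -> (forall x, f x <= g x) ->
  \int[mu]_x f x <= \int[mu]_x g x.
Proof.
move=> g0 fg; rewrite [leLHS]integralE.
apply: (@le_trans _ _ (\int[mu]_x f^\+ x)).
  by rewrite -[leRHS]adde0 leeD2l// leeNl oppe0 integral_ge0.
apply: ge0_le_integral_nonmeas => x; first exact: funepos_ge0.
by rewrite funeposE ge_max fg g0.
Qed.

Import HBNNSimple.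

(** Simple functions below f are measurable, so each of them can be compared
    with g almost everywhere. *)
Lemma ae_le_integral_nonmeas (f g : T -> \bar R) :
  measurable_fun [set: T] g -> (forall x, 0 <= f x) -> (forall x, 0 <= g x) ->
  {ae mu, forall x, f x <= g x} -> \int[mu]_x f x <= \int[mu]_x g x.
Proof.
move=> mg f0 g0 fg.
rewrite [leLHS]ge0_integralTE//; apply: ge_ereal_sup => _ [h hf <-].
rewrite -integralT_nnsfun; apply: ae_ge0_le_integral => //.
- by move=> x _; rewrite lee_fin.
- exact/measurable_EFinP.
- by apply: filterS fg => x fgx _; exact: le_trans (hf x) fgx.
Qed.

End LowerIntegral.

(** * Moments of the standard normal law *)

Section Density.
Context d (T : measurableType d) (R : realType).
Variables (mu nu : {measure set T -> \bar R}) (p : T -> R).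
Hypotheses (mp : measurable_fun [set: T] p) (p0 : forall x, 0 <= p x).
Hypothesis nuE : forall A, measurable A -> nu A = (\int[mu]_(x in A) (p x)%:E)%E.
Local Open Scope ereal_scope.
Import HBNNSimple.

Let integral_density_nnsfun (f : {nnsfun T >-> R}) :
  \int[nu]_x (f x)%:E = \int[mu]_x ((f x)%:E * (p x)%:E).
Proof.
under [LHS]eq_integral do rewrite fimfunE -fsumEFin//.
rewrite [LHS]ge0_integral_fsum//; last 2 first.
  - by move=> r; exact/measurable_EFinP/measurableT_comp.
  - by move=> n x _; rewrite EFinM nnfun_muleindic_ge0.
under [RHS]eq_integral.
  move=> x xD; rewrite muleC fimfunE -fsumEFin// ge0_mule_fsumr; last first.
    by move=> r; rewrite EFinM nnfun_muleindic_ge0.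
  over.
rewrite [RHS]ge0_integral_fsum//; last 2 first.
  - move=> r; apply: emeasurable_funM; first exact/measurable_EFinP.
    exact/measurable_EFinP/measurableT_comp.
  - by move=> r x _; rewrite mule_ge0 ?lee_fin// -lee_fin EFinM nnfun_muleindic_ge0.
apply: eq_fsbigr => r _.
have mr : measurable (f @^-1` [set r]) by [].
rewrite integralZl_indic_nnsfun//= integral_indic// setIT nuE//.
have [r0|r0] := leP 0%R r; last first.
  rewrite (_ : f @^-1` [set r] = set0) ?integral_set0 ?mule0.
    by rewrite integral0_eq// => x _; rewrite indicE in_set0 mulr0 mule0.
  by apply/seteqP; split => x //= fx; move: r0; rewrite -fx ltNge fun_ge0.
under [RHS]eq_integral => x _ do rewrite EFinM muleCA.
rewrite ge0_integralZl//; last 2 first.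
  - by apply: emeasurable_funM; exact/measurable_EFinP.
  - by move=> x _; rewrite mule_ge0 ?lee_fin.
congr (_ * _); rewrite [LHS]integral_mkcond; apply: eq_integral => x _.
by rewrite epatch_indic.
Qed.

Lemma integral_density (f : T -> \bar R) :
  measurable_fun [set: T] f -> (forall x, 0 <= f x) ->
  \int[nu]_x f x = \int[mu]_x (f x * (p x)%:E).
Proof.
move=> mf f0; pose f_ := nnsfun_approx measurableT mf.
transitivity (limn (fun n => \int[nu]_x (f_ n x)%:E)).
  rewrite -monotone_convergence//=.
  - apply: eq_integral => ? /[!inE] xD; apply/esym/cvg_lim => //=.
    exact: cvg_nnsfun_approx.
  - by move=> n; exact/measurable_EFinP.
  - by move=> n ? _; rewrite lee_fin.
  - by move=> ? _ ? ? mn; rewrite lee_fin; exact/lefP/nd_nnsfun_approx.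
transitivity (limn (fun n => \int[mu]_x ((f_ n x)%:E * (p x)%:E))).
  by congr (limn _); apply/funext => n; exact: integral_density_nnsfun.
rewrite -monotone_convergence//=.
- apply: eq_integral => x _; apply/cvg_lim => //=.
  apply: cvgeZr => //; exact: cvg_nnsfun_approx.
- by move=> n; apply: emeasurable_funM; exact/measurable_EFinP.
- by move=> n ? _; rewrite mule_ge0 ?lee_fin.
- move=> x _ m n mn; rewrite lee_wpmul2r ?lee_fin//; exact/lefP/nd_nnsfun_approx.
Qed.

End Density.

Section NormalMoments.
Context {R : realType}.
Notation mu := (@lebesgue_measure R).
Notation N01 := (@normal_prob R 0 1).
Notation phi := (@normal_pdf R 0 1).

Lemma integral_normal (f : R -> \bar R) :
  measurable_fun [set: R] f -> (forall x, 0 <= f x)%E ->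
  (\int[N01]_x f x = \int[mu]_x (f x * (phi x)%:E))%E.
Proof.
move=> mf f0; apply: integral_density => //.
- exact: measurable_normal_pdf.
- exact: normal_pdf_ge0.
Qed.

Let c : R := normal_peak 1.

Lemma std_normal_pdfE : phi = (fun x => c * expR (- (x ^+ 2 / 2))).
Proof.
rewrite normal_pdfE ?oner_neq0//; apply/funext => x.
by rewrite /normal_fun subr0 expr1n mulNr.
Qed.

Let c0 : 0 <= c. Proof. exact: normal_peak_ge0. Qed.

Let phi_le x : phi x <= 2 * c * expR (- x).
Proof.
rewrite std_normal_pdfE (_ : 2 * c * expR (- x) = c * (expR (- x) * 2)); last by ring.
rewrite ler_wpM2l//.
have -> : - (x ^+ 2 / 2) = - x + (2^-1 - (x - 1) ^+ 2 / 2) by field.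
rewrite expRD ler_wpM2l ?expR_ge0//.
apply: (@le_trans _ _ (expR 2^-1)).
  by rewrite ler_expR lerBlDr lerDl divr_ge0 ?sqr_ge0.
have : expR (- 2^-1) >= 2^-1 :> R by have := expR_ge1Dx (- 2^-1 : R); lra.
by rewrite expRN lef_pV2 ?posrE ?expR_gt0.
Qed.

Let cvg_pow_phi m : (fun x => x ^+ m * phi x) @ +oo%R --> 0.
Proof.
apply: (@squeeze_cvgr _ _ _ _ (cst 0) (fun x => 2 * c * m.+1`!%:R * x^-1)).
- near=> x; have x0 : 0 < x by near: x; exact: nbhs_pinfty_gt.
  rewrite mulr_ge0 ?exprn_ge0 ?(ltW x0) ?normal_pdf_ge0//=.
  apply: le_trans (ler_wpM2l (exprn_ge0 m (ltW x0)) (phi_le x)) _.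
  rewrite (_ : _ * (_ * expR _) = 2 * c * (x ^+ m * expR (- x))); last by ring.
  rewrite -[leRHS]mulrA ler_wpM2l ?mulr_ge0// ler_pdivlMr// expRN mulrAC -exprSr.
  rewrite ler_pdivrMr ?expR_gt0// mulrC -ler_pdivrMr ?ltr0n ?fact_gt0//.
  by apply: le_trans (expR_ge1Dxn m (ltW x0)); rewrite lerDr.
- exact: cvg_cst.
- set C := 2 * c * _; have C0 : 0 <= C by rewrite !mulr_ge0.
  apply/cvgrPdist_le => e e0; near=> x.
  have x0 : 0 < x by near: x; exact: nbhs_pinfty_gt.
  rewrite sub0r normrN ger0_norm ?divr_ge0 ?(ltW x0)// ler_pdivrMr// mulrC.
  by rewrite -ler_pdivrMr//; near: x; exact: nbhs_pinfty_ge.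
Unshelve. all: by end_near. Qed.

Let is_derive_phi (x : R) : is_derive x 1 phi (- x * phi x).
Proof.
rewrite std_normal_pdfE.
have h : is_derive x (1 : R) (fun y : R => - (y ^+ 2 / 2)) (- x).
  by apply: is_derive_eq => //=; rewrite /GRing.scale /=; field.
apply: is_derive_eq => //=; rewrite /GRing.scale /=; ring.
Qed.

Let is_derive_pow_phi m (x : R) : is_derive x 1 (fun y : R => y ^+ m * phi y)
  (m%:R * x ^+ m.-1 * phi x - x ^+ m.+1 * phi x).
Proof.
have h1 : is_derive x (1 : R) (fun y : R => y ^+ m) (m%:R * x ^+ m.-1).
  have := @is_deriveX R R^o id m x 1 1 (is_derive_id x 1).
  by rewrite /GRing.scale /= mulr1 exprfctE.
have h := @is_deriveM R R^o (fun y => y ^+ m) phi x 1 _ _ h1 (is_derive_phi x).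
by apply: is_derive_eq; rewrite /GRing.scale /= exprS; ring.
Qed.

Let continuous_pow_phi m : continuous (fun y : R => y ^+ m * phi y).
Proof.
move=> x; apply/differentiable_continuous/derivable1_diffP.
by have [] := is_derive_pow_phi m x.
Qed.

Let is_derive_expN (x : R) : is_derive x 1 (fun y : R => expR (- y)) (- expR (- x)).
Proof. by apply: is_derive_eq => //=; rewrite /GRing.scale /=; ring. Qed.

(** Integration by parts against -x phi(x); the exponential makes the integrand
    nonnegative, as the fundamental theorem on a half-line requires. *)
Lemma half_normal_moment (m : nat) (b : R) : (0 < m)%N -> 0 <= b ->
  (forall x : R, 0 <= x -> - b <= x ^+ m.+1 - m%:R * x ^+ m.-1) ->
  (\int[mu]_(x in `[0%R, +oo[) (x ^+ m.+1 * phi x)%:E =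
   m%:R%:E * \int[mu]_(x in `[0%R, +oo[) (x ^+ m.-1 * phi x)%:E)%E.
Proof.
move=> m0 b0 bP; pose B : R := b * (2 * c).
have B0 : 0 <= B by rewrite !mulr_ge0.
have mpow k : measurable_fun (`[0%R, +oo[ : set R) (fun x => (x ^+ k * phi x)%:E).
  apply/measurable_EFinP/measurable_funTS.
  by apply: continuous_measurable_fun; exact: continuous_pow_phi.
have cexp : continuous (fun x : R => expR (- x)).
  move=> x; apply/differentiable_continuous/derivable1_diffP.
  by have [] := is_derive_expN x.
have mexp : measurable_fun (`[0%R, +oo[ : set R) (fun x => (B * expR (- x))%:E).
  apply/measurable_EFinP/measurable_funTS/measurable_funM => //.
  exact: continuous_measurable_fun.
have pow0 k x : `[0%R, +oo[%classic x -> (0 <= (x ^+ k * phi x)%:E)%E.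
  by rewrite /= in_itv /= andbT => x0; rewrite lee_fin mulr_ge0 ?exprn_ge0 ?normal_pdf_ge0.
have exp0 x : (0 <= (B * expR (- x))%:E)%E by rewrite lee_fin mulr_ge0 ?expR_ge0.
have Iexp : (\int[mu]_(x in `[0%R, +oo[) (B * expR (- x))%:E = B%:E)%E.
  rewrite (@ge0_continuous_FTC2y _ _ (fun x => - (B * expR (- x))) 0 0).
  - by rewrite oppr0 expR0 mulr1 -EFinB sub0r opprK.
  - by move=> x x0; rewrite mulr_ge0 ?expR_ge0.
  - by apply: continuous_subspaceT => x; apply: cvgM; [exact: cvg_cst|exact: cexp].
  - rewrite -oppr0; apply: cvgN; rewrite -[X in _ --> X](mulr0 B).
    by apply: cvgM; [exact: cvg_cst|exact: cvgr_expR].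
  - move=> x x0; apply: ex_derive.
  - apply: cvg_at_right_filter; apply: cvgN; apply: cvgM; first exact: cvg_cst.
    exact: cexp.
  - move=> x _; rewrite derive1E.
    have h := is_derive_expN x.
    have h2 : is_derive x (1 : R) (fun y : R => - (B * expR (- y))) (B * expR (- x)).
      by apply: is_derive_eq => //=; rewrite /GRing.scale /=; ring.
    by have [] := h2.
pose F x : R := - (x ^+ m * phi x) - B * expR (- x).
pose f x : R := x ^+ m.+1 * phi x - m%:R * (x ^+ m.-1 * phi x) + B * expR (- x).
have dF x : is_derive x (1 : R) F (f x).
  have h1 := is_derive_pow_phi m x; have h2 := is_derive_expN x.
  by apply: is_derive_eq => //=; rewrite /f /GRing.scale /=; ring.
have f0 x : 0 <= x -> 0 <= f x.
  move=> x0; rewrite /f.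
  rewrite (_ : _ + _ = (x ^+ m.+1 - m%:R * x ^+ m.-1 + b) * phi x +
     b * (2 * c * expR (- x) - phi x)); last by rewrite /B; ring.
  rewrite addr_ge0// mulr_ge0 ?normal_pdf_ge0 ?subr_ge0 ?phi_le//.
  by rewrite -lerBlDr sub0r bP.
have cf : continuous f.
  move=> x; apply: cvgD; last by apply: cvgM; [exact: cvg_cst|exact: cexp].
  apply: cvgB; first exact: continuous_pow_phi.
  by apply: cvgM; [exact: cvg_cst|exact: continuous_pow_phi].
have If : (\int[mu]_(x in `[0%R, +oo[) (f x)%:E = B%:E)%E.
  rewrite (@ge0_continuous_FTC2y _ f F 0 0)//.
  - by rewrite /F expr0n (gtn_eqF m0) /= mul0r oppr0 expR0 mulr1 sub0r -EFinB sub0r opprK.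
  - exact: continuous_subspaceT.
  - rewrite -[X in _ --> X](subr0 0) -{1}oppr0 -{2}(mulr0 B).
    apply: cvgB; first by apply: cvgN; exact: cvg_pow_phi.
    by apply: cvgM; [exact: cvg_cst|exact: cvgr_expR].
  - apply: cvg_at_right_filter; apply: differentiable_continuous.
    by apply/derivable1_diffP; have [] := dF 0.
  - by move=> x _; rewrite derive1E; have [] := dF x.
have E : (\int[mu]_(x in `[0%R, +oo[) (x ^+ m.+1 * phi x)%:E + B%:E =
    B%:E + m%:R%:E * \int[mu]_(x in `[0%R, +oo[) (x ^+ m.-1 * phi x)%:E)%E.
  rewrite -{1}Iexp -If -ge0_integralZl ?lee_fin//; last exact: pow0.
  rewrite -!ge0_integralD//=.
  - by apply: eq_integral => x _; rewrite -!EFinM -!EFinD; congr (_%:E); rewrite /f; ring.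
  - by move=> x x0; rewrite lee_fin f0//; move: x0; rewrite in_itv /= andbT.
  - by apply/measurable_EFinP/measurable_funTS; exact: continuous_measurable_fun cf.
  - by move=> x x0; rewrite mule_ge0 ?lee_fin//; exact: (pow0 m.-1 x).
  - by apply: emeasurable_funM => //; exact: mpow.
  - by move=> x x0; exact: (pow0 m.+1 x).
  - exact: mpow.
  - exact: mpow.
move/(congr1 (fun z => z - B%:E)%E): E.
by rewrite addeK// [X in (X - _)%E]addeC addeK.
Qed.

Let even_moment k (Ik : R) :
  (\int[mu]_(x in `[0%R, +oo[) (x ^+ k.*2 * phi x)%:E = Ik%:E)%E ->
  (\int[N01]_x (x ^+ k.*2)%:E = (2 * Ik)%:E)%E.
Proof.
move=> IkE; have e0 x : 0 <= x ^+ k.*2 :> R by rewrite exprn_even_ge0// odd_double.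
rewrite integral_normal//; last by apply/measurable_EFinP; exact: measurable_funX.
under eq_integral do rewrite -EFinM.
rewrite ge0_symfun_integralT.
- by rewrite -set_itvcy IkE.
- by move=> x; rewrite mulr_ge0 ?normal_pdf_ge0.
- exact: continuous_pow_phi.
- move=> x /=; rewrite !std_normal_pdfE /= sqrrN; congr (_ * _).
  by rewrite exprNn -signr_odd odd_double expr0 mul1r.
Qed.

Let half_moment0 : (\int[mu]_(x in `[0%R, +oo[) (x ^+ 0 * phi x)%:E = (2^-1)%:E)%E.
Proof.
have : (2%:E * \int[mu]_(x in `[0%R, +oo[) (x ^+ 0 * phi x)%:E = 1)%E.
  rewrite -(integral_normal_pdf 0 1) ge0_symfun_integralT.
  - rewrite -set_itvcy; congr (_ * _)%E; apply: eq_integral => x _.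
    by rewrite expr0 mul1r.
  - exact: normal_pdf_ge0.
  - by apply: continuous_normal_pdf; exact: oner_neq0.
  - by move=> x /=; rewrite !std_normal_pdfE sqrrN.
move/(congr1 (fun z => (2^-1)%:E * z)%E).
by rewrite mule1 muleA -EFinM mulVf ?pnatr_eq0// mul1e.
Qed.

Let half_moment2 : (\int[mu]_(x in `[0%R, +oo[) (x ^+ 2 * phi x)%:E = (2^-1)%:E)%E.
Proof.
rewrite (@half_normal_moment 1 1)// => [|x x0].
  by rewrite mul1e; exact: half_moment0.
by rewrite expr0 mulr1 lerDr sqr_ge0.
Qed.

Lemma normal_moment2 : (\int[N01]_x (x ^+ 2)%:E = 1)%E.
Proof.
have := even_moment (k := 1) half_moment2.
by rewrite mulfV ?pnatr_eq0.
Qed.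

Lemma normal_moment4 : (\int[N01]_x (x ^+ 4)%:E = 3%:E)%E.
Proof.
have h : (\int[mu]_(x in `[0%R, +oo[) (x ^+ 2.*2 * phi x)%:E = (3 / 2)%:E)%E.
  rewrite (@half_normal_moment 3 3)// => [|x x0].
    by rewrite half_moment2 EFinM.
  by have := sqr_ge0 (x ^+ 2 - 3 / 2); rewrite /= !exprS expr0; nra.
by have := even_moment h; rewrite (_ : 2 * (3 / 2) = 3) //; field.
Qed.

Lemma normal_integrable_pow k : (k <= 4)%N ->
  N01.-integrable [set: R] (fun x => (x ^+ k)%:E).
Proof.
move=> k4; apply/integrableP; split.
  by apply/measurable_EFinP; exact: measurable_funX.
apply: (@le_lt_trans _ _ (\int[N01]_x (1 + x ^+ 4)%:E)%E).
  apply: ge0_le_integral_nonmeas => x //; rewrite lee_fin normrX.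
  have [x1|x1] := leP `|x| 1.
    apply: (@le_trans _ _ 1); first by rewrite exprn_ile1.
    by rewrite lerDl exprn_even_ge0.
  apply: (@le_trans _ _ (`|x| ^+ 4)); first by rewrite ler_eXn2l// ltW.
  by rewrite -normrX ger0_norm ?exprn_even_ge0// lerDr.
under eq_integral do rewrite EFinD.
rewrite ge0_integralD//=.
- by rewrite integral_cst//= probability_setT normal_moment4 mule1 -EFinD ltry.
- by move=> x _; rewrite lee_fin exprn_even_ge0.
- by apply/measurable_EFinP; exact: measurable_funX.
Qed.

Let integral_reflect (g : R -> \bar R) :
  measurable_fun [set: R] g -> (forall x, 0 <= g x)%E ->
  (\int[mu]_x g (- x)%R = \int[mu]_x g x)%E.
Proof.
move=> mg g0.
have mN : measurable_fun [set: measurableTypeR R] (-%R : R -> measurableTypeR R).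
  exact: oppr_measurable.
have := @ge0_integral_pushforward _ _ (measurableTypeR R) (measurableTypeR R) R
  (-%R) mN mu setT g measurableT mg (fun y _ => g0 y).
rewrite preimage_setT => <-; apply: eq_measure_integral => A mA _.
exact: lebesgue_measureN.
Qed.

Lemma normal_moment_odd k : odd k -> (k <= 4)%N -> (\int[N01]_x (x ^+ k)%:E = 0)%E.
Proof.
move=> ok k4; have ik := normal_integrable_pow k4.
have mk : measurable_fun [set: R] (fun x : R => (x ^+ k)%:E) := measurable_int _ ik.
rewrite integralE.
have -> : (\int[N01]_x ((fun x : R => (x ^+ k)%:E)^\- x) =
    \int[N01]_x ((fun x : R => (x ^+ k)%:E)^\+ x))%E.
  rewrite !integral_normal//; try exact: measurable_funepos; try exact: measurable_funeneg.
  rewrite -[RHS]integral_reflect.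
  - apply: eq_integral => x _; rewrite funeposE funenegE -EFinN exprNn -signr_odd ok.
    by rewrite expr1 mulN1r; congr (_ * _%:E)%E; rewrite !std_normal_pdfE sqrrN.
  - apply: emeasurable_funM; first exact: measurable_funepos.
    by apply/measurable_EFinP; exact: measurable_normal_pdf.
  - by move=> x; rewrite mule_ge0 ?lee_fin ?normal_pdf_ge0.
rewrite subee//.
by have := integrable_pos_fin_num measurableT ik.
Qed.

Lemma normal_quartic (a0 a1 a2 a3 a4 : R) :
  let p z := a0 + z * a1 + z ^+ 2 * a2 + z ^+ 3 * a3 + z ^+ 4 * a4 in
  N01.-integrable [set: R] (fun z => (p z)%:E) /\
  (\int[N01]_z (p z)%:E = (a0 + a2 + 3 * a4)%:E)%E.
Proof.
move=> p.
pose m i b (z : R) : \bar R := (z ^+ i * b)%:E.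
have im i b : (i <= 4)%N -> N01.-integrable [set: R] (m i b).
  move=> i4; rewrite (_ : m i b = (fun z => b%:E * (z ^+ i)%:E)%E).
    by apply: integrableZl => //; exact: normal_integrable_pow.
  by apply/funext => z; rewrite /m mulrC EFinM.
have Im i b : (i <= 4)%N ->
    (\int[N01]_z m i b z = b%:E * \int[N01]_z (z ^+ i)%:E)%E.
  move=> i4; under eq_integral do rewrite /m mulrC EFinM.
  by rewrite integralZl//; exact: normal_integrable_pow.
have i0 := im 0%N a0 isT; have i1 := im 1%N a1 isT; have i2 := im 2%N a2 isT.
have i3 := im 3%N a3 isT; have i4 := im 4%N a4 isT.
have pE : (fun z => (p z)%:E) = (m 0%N a0 \+ m 1%N a1 \+ m 2%N a2 \+ m 3%N a3 \+ m 4%N a4)%E.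
  by apply/funext => z; rewrite /m /p -!EFinD expr0 mul1r expr1.
rewrite pE; split; first by do 4 (apply: integrableD => //).
have j1 := integrableD measurableT i0 i1.
have j2 := integrableD measurableT j1 i2.
have j3 := integrableD measurableT j2 i3.
rewrite (integralD measurableT j3 i4) (integralD measurableT j2 i3).
rewrite (integralD measurableT j1 i2) (integralD measurableT i0 i1).
rewrite !Im// (normal_moment_odd (k := 1))// (normal_moment_odd (k := 3))//.
rewrite normal_moment2 normal_moment4 !mule0 !adde0 mule1.
under eq_integral do rewrite expr0.
by rewrite integral_cst//= probability_setT !mule1 -EFinM -!EFinD [a4 * 3]mulrC.
Qed.

End NormalMoments.

(** * Gaussian quadratic forms *)

Section GaussExpectation.
Context {R : realType}.
Local Notation N01 := (@normal_prob R 0 1).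

Lemma gauss_expectation_ge0 n (F : n.-tuple R -> \bar R) :
  (forall w, 0 <= F w)%E -> (0 <= gauss_expectation F)%E.
Proof.
elim: n F => [|n IH] F F0 /=; first exact: F0.
by apply: integral_ge0 => z _; exact: IH.
Qed.

Lemma le_gauss_expectation n (F G : n.-tuple R -> \bar R) :
  (forall w, 0 <= G w)%E -> (forall w, F w <= G w)%E ->
  (gauss_expectation F <= gauss_expectation G)%E.
Proof.
elim: n F G => [|n IH] F G G0 FG /=; first exact: FG.
apply: le_integral_nonmeas => z; first exact: gauss_expectation_ge0.
exact: IH.
Qed.

(** An iterated integral is linear only where every stage is integrable; this
    predicate carries the integrability along with the value. *)
Fixpoint has_gauss_mean (n : nat) : (n.-tuple R -> R) -> R -> Prop :=
  match n with
  | 0 => fun F v => F [tuple] = v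
  | m.+1 => fun F v => exists g : R -> R,
      [/\ forall z, has_gauss_mean (fun t : m.-tuple R => F [tuple of z :: t]) (g z),
          N01.-integrable [set: R] (fun z => (g z)%:E)
        & (\int[N01]_z (g z)%:E = v%:E)%E]
  end.

Lemma has_gauss_meanE n (F : n.-tuple R -> R) v :
  has_gauss_mean F v -> gauss_expectation (fun w => (F w)%:E) = v%:E.
Proof.
elim: n F v => [|n IH] F v /=; first by move=> ->.
move=> [g [Fg ig <-]]; apply: eq_integral => z _; exact: IH (Fg z).
Qed.

Lemma has_gauss_mean_lin n (F G : n.-tuple R -> R) a b u v :
  has_gauss_mean F u -> has_gauss_mean G v ->
  has_gauss_mean (fun w => a * F w + b * G w) (a * u + b * v).
Proof.
elim: n F G u v => [|n IH] F G u v /=; first by move=> -> ->.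
move=> [f [Ff If uE]] [g [Gg Ig vE]].
exists (fun z => a * f z + b * g z); split.
- by move=> z; exact: IH.
- under eq_fun do rewrite EFinD !EFinM.
  by apply: integrableD => //; exact: integrableZl.
- under eq_integral do rewrite EFinD !EFinM.
  rewrite integralD//; [|exact: integrableZl|exact: integrableZl].
  by rewrite !integralZl// uE vE -!EFinM -EFinD.
Qed.

Lemma has_gauss_mean_ext n (F G : n.-tuple R -> R) v :
  (forall w, F w = G w) -> has_gauss_mean F v -> has_gauss_mean G v.
Proof. by move=> FG; rewrite (_ : F = G)//; apply/funext. Qed.

Lemma has_gauss_meanD n (F G : n.-tuple R -> R) u v :
  has_gauss_mean F u -> has_gauss_mean G v ->
  has_gauss_mean (fun w => F w + G w) (u + v).
Proof.
move=> Fu Gv; rewrite -[u]mul1r -[v]mul1r.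
apply: has_gauss_mean_ext (has_gauss_mean_lin 1 1 Fu Gv) => w.
by rewrite !mul1r.
Qed.

Lemma has_gauss_meanZ n (F : n.-tuple R -> R) a u :
  has_gauss_mean F u -> has_gauss_mean (fun w => a * F w) (a * u).
Proof.
move=> Fu; have -> : a * u = a * u + 0 * u by rewrite mul0r addr0.
apply: has_gauss_mean_ext (has_gauss_mean_lin a 0 Fu Fu) => w.
by rewrite mul0r addr0.
Qed.

(** Integrating out the first coordinate of a polynomial of degree four in it
    keeps only the even moments 1, 1 and 3. *)
Lemma has_gauss_mean_poly n (F0 F1 F2 F3 F4 : n.-tuple R -> R) v0 v1 v2 v3 v4
    (F : n.+1.-tuple R -> R) :
  (forall z (t : n.-tuple R), F [tuple of z :: t] =
    F0 t + z * F1 t + z ^+ 2 * F2 t + z ^+ 3 * F3 t + z ^+ 4 * F4 t) ->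
  has_gauss_mean F0 v0 -> has_gauss_mean F1 v1 -> has_gauss_mean F2 v2 ->
  has_gauss_mean F3 v3 -> has_gauss_mean F4 v4 ->
  has_gauss_mean F (v0 + v2 + 3 * v4).
Proof.
move=> FE h0 h1 h2 h3 h4 /=.
have [iq qE] := normal_quartic v0 v1 v2 v3 v4.
exists (fun z => v0 + z * v1 + z ^+ 2 * v2 + z ^+ 3 * v3 + z ^+ 4 * v4).
split=> // z; apply: (@has_gauss_mean_ext _ _ _ _ (fun w => esym (FE z w))).
by do ! [apply: has_gauss_meanD => // | apply: has_gauss_meanZ => //].
Qed.

Lemma has_gauss_mean_cst n (c : R) : has_gauss_mean (fun _ : n.-tuple R => c) c.
Proof.
elim: n => [//|n IH].
have Z : has_gauss_mean (fun _ : n.-tuple R => 0) 0.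
  have := has_gauss_meanZ 0 IH; rewrite mul0r; apply: has_gauss_mean_ext => w.
  by [].
have := @has_gauss_mean_poly n (fun=> c) (fun=> 0) (fun=> 0) (fun=> 0) (fun=> 0)
  c 0 0 0 0 (fun=> c).
by rewrite mulr0 !addr0; apply => // z t; rewrite !mulr0 !addr0.
Qed.

Definition linform n (b : 'I_n -> R) (w : n.-tuple R) : R := \sum_i b i * tnth w i.

Definition quadform n (A : 'I_n -> 'I_n -> R) (w : n.-tuple R) : R :=
  \sum_i \sum_j A i j * tnth w i * tnth w j.

Lemma linform_cons n (b : 'I_n.+1 -> R) z (t : n.-tuple R) :
  linform b [tuple of z :: t] = linform (fun i => b (lift ord0 i)) t + z * b ord0.
Proof.
rewrite /linform big_ord_recl /= tnth0 addrC mulrC; congr (_ + _).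
by apply: eq_bigr => i _; rewrite tnthS.
Qed.

Lemma quadform_cons n (A : 'I_n.+1 -> 'I_n.+1 -> R) z (t : n.-tuple R) :
  (forall i j, A i j = A j i) ->
  quadform A [tuple of z :: t] =
  quadform (fun i j => A (lift ord0 i) (lift ord0 j)) t
  + z * linform (fun i => 2 * A ord0 (lift ord0 i)) t + z ^+ 2 * A ord0 ord0.
Proof.
move=> Asym; pose S := \sum_i A ord0 (lift ord0 i) * tnth t i.
have -> : linform (fun i => 2 * A ord0 (lift ord0 i)) t = 2 * S.
  by rewrite /S mulr_sumr; apply: eq_bigr => i _; rewrite mulrA.
have E1 : \sum_(i < n) A ord0 (lift ord0 i) * z * tnth t i = z * S.
  by rewrite /S mulr_sumr; apply: eq_bigr => i _; ring.
have E2 : \sum_(i < n) A (lift ord0 i) ord0 * tnth t i * z = z * S.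
  by rewrite /S mulr_sumr; apply: eq_bigr => i _; rewrite mulrC Asym.
rewrite /quadform big_ord_recl big_ord_recl /= !tnth0.
under [X in _ + X = _]eq_bigr => i _ do rewrite big_ord_recl /= tnth0 tnthS.
under eq_bigr => i _ do rewrite tnthS.
under [X in _ + X = _]eq_bigr => i _ do under eq_bigr => j _ do rewrite tnthS.
by rewrite big_split /= E1 E2; ring.
Qed.

Lemma linform_mean n (b : 'I_n -> R) : has_gauss_mean (linform b) 0.
Proof.
elim: n b => [|n IH] b; first by rewrite /= /linform big_ord0.
have := @has_gauss_mean_poly n (linform (fun i => b (lift ord0 i))) (fun=> b ord0)
  (fun=> 0) (fun=> 0) (fun=> 0) 0 (b ord0) 0 0 0 (linform b).
rewrite mulr0 !addr0; apply; try exact: has_gauss_mean_cst; last exact: IH.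
by move=> z t; rewrite linform_cons; ring.
Qed.

Lemma linform2_mean n (b c : 'I_n -> R) :
  has_gauss_mean (fun w => linform b w * linform c w) (\sum_i b i * c i).
Proof.
elim: n b c => [|n IH] b c; first by rewrite /= /linform !big_ord0 mul0r.
pose b' i := b (lift ord0 i); pose c' i := c (lift ord0 i).
rewrite (_ : \sum_i b i * c i = \sum_i b' i * c' i + b ord0 * c ord0 + 3 * 0).
  2: by rewrite big_ord_recl mulr0 addr0 addrC.
apply: (@has_gauss_mean_poly n (fun t => linform b' t * linform c' t)
  (fun t => b ord0 * linform c' t + c ord0 * linform b' t)
  (fun=> b ord0 * c ord0) (fun=> 0) (fun=> 0) (\sum_i b' i * c' i) (b ord0 * 0 + c ord0 * 0)
  (b ord0 * c ord0) 0 0); try exact: has_gauss_mean_cst.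
- by move=> z t; rewrite !linform_cons; ring.
- exact: IH.
- by apply: has_gauss_mean_lin; exact: linform_mean.
Qed.

Lemma quadform_mean n (A : 'I_n -> 'I_n -> R) : (forall i j, A i j = A j i) ->
  has_gauss_mean (quadform A) (\sum_i A i i).
Proof.
elim: n A => [|n IH] A Asym; first by rewrite /= /quadform !big_ord0.
have := @has_gauss_mean_poly n (quadform (fun i j => A (lift ord0 i) (lift ord0 j)))
  (linform (fun i => 2 * A ord0 (lift ord0 i))) (fun=> A ord0 ord0) (fun=> 0) (fun=> 0)
  (\sum_i A (lift ord0 i) (lift ord0 i)) 0 (A ord0 ord0) 0 0 (quadform A).
rewrite mulr0 addr0 big_ord_recl addrC; apply; try exact: has_gauss_mean_cst.
- by move=> z t; rewrite quadform_cons//; ring.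
- exact: IH.
- exact: linform_mean.
Qed.

Lemma lin_quadform_mean n (b : 'I_n -> R) (A : 'I_n -> 'I_n -> R) :
  (forall i j, A i j = A j i) ->
  has_gauss_mean (fun w => linform b w * quadform A w) 0.
Proof.
elim: n b A => [|n IH] b A Asym; first by rewrite /= /linform !big_ord0 mul0r.
pose b' i := b (lift ord0 i); pose A' i j := A (lift ord0 i) (lift ord0 j).
pose c i := 2 * A ord0 (lift ord0 i).
have := @has_gauss_mean_poly n (fun t => linform b' t * quadform A' t)
  (fun t => b ord0 * quadform A' t + 1 * (linform b' t * linform c t))
  (fun t => A ord0 ord0 * linform b' t + b ord0 * linform c t)
  (fun=> b ord0 * A ord0 ord0) (fun=> 0)
  0 (b ord0 * (\sum_i A' i i) + 1 * \sum_i b' i * c i)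
  (A ord0 ord0 * 0 + b ord0 * 0) (b ord0 * A ord0 ord0) 0
  (fun w => linform b w * quadform A w).
rewrite !mulr0 !addr0; apply; try exact: has_gauss_mean_cst.
- by move=> z t; rewrite linform_cons quadform_cons//; ring.
- by apply: IH => i j; exact: Asym.
- apply: has_gauss_mean_lin; last exact: linform2_mean.
  by apply: quadform_mean => i j; exact: Asym.
- have := has_gauss_mean_lin (A ord0 ord0) (b ord0) (linform_mean b') (linform_mean c).
  by rewrite !mulr0 addr0.
Qed.

(** Integrating out one coordinate at a time; the 2x2 minors bound the squares of
    the cross terms by products of diagonal entries. *)
Lemma quadform_sqr_mean n (A : 'I_n -> 'I_n -> R) :
  (forall i j, A i j = A j i) -> (forall i, 0 <= A i i) ->
  (forall i j, A i j ^+ 2 <= A i i * A j j) ->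
  exists2 v, has_gauss_mean (fun w => quadform A w ^+ 2) v
    & v <= 3 * (\sum_i A i i) ^+ 2.
Proof.
elim: n A => [|n IH] A Asym A0 Amin.
  by exists 0; [rewrite /= /quadform big_ord0 expr0n|rewrite big_ord0 expr0n mulr0].
pose A' i j := A (lift ord0 i) (lift ord0 j); pose c i := 2 * A ord0 (lift ord0 i).
have [|||v' hv' v'le] := IH A'; [by move=> ? ?; exact: Asym|by move=> ?; exact: A0
  |by move=> ? ?; exact: Amin|].
set a := A ord0 ord0; set T := \sum_i A' i i in v'le.
exists (v' + (1 * (\sum_i c i * c i) + (2 * a) * T) + 3 * a ^+ 2).
  have Lm := linform_mean c.
  apply: (@has_gauss_mean_poly n (fun t => quadform A' t ^+ 2)
    (fun t => 2 * (linform c t * quadform A' t))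
    (fun t => 1 * (linform c t * linform c t) + (2 * a) * quadform A' t)
    (fun t => 2 * a * linform c t) (fun=> a ^+ 2) _ (2 * 0) _ (2 * a * 0)) => //.
  - by move=> z t; rewrite quadform_cons// -/A' -/a; ring.
  - by apply: has_gauss_meanZ; apply: lin_quadform_mean => i j; exact: Asym.
  - apply: has_gauss_mean_lin; first exact: linform2_mean.
    by apply: quadform_mean => i j; exact: Asym.
  - exact: has_gauss_meanZ.
  - exact: has_gauss_mean_cst.
have cT : \sum_i c i * c i <= 4 * (a * T).
  rewrite /T !mulr_sumr; apply: ler_sum => i _.
  by have := Amin ord0 (lift ord0 i); rewrite /c /A' /a; lra.
rewrite big_ord_recl -/a -/T; lra.
Qed.

(** The inequality 2 t >= 3 t^2 - t^4 at t = sqrt q / s; with q a Gaussian form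
    it turns the first two moments of q into a lower bound for the mean of its
    square root. *)
Lemma sqrt_tangent (q s : R) : 0 <= q -> 0 < s ->
  s * (3 * (q / s ^+ 2) - (q / s ^+ 2) ^+ 2) / 2 <= Num.sqrt q.
Proof.
move=> q0 s0; pose t : R := Num.sqrt q / s.
have t0 : 0 <= t by rewrite divr_ge0 ?sqrtr_ge0 ?(ltW s0).
have -> : q / s ^+ 2 = t ^+ 2 by rewrite /t expr_div_n sqr_sqrtr.
have -> : Num.sqrt q = s * t by rewrite /t mulrCA divff ?mulr1// gt_eqF.
rewrite -mulrA ler_pM2l//; clearbody t.
have t2 : 0 <= t + 2 by rewrite addr_ge0.
have : 0 <= (t - 1) ^+ 2 * (t + 2) * t by do 2 (apply: mulr_ge0 => //); exact: sqr_ge0.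
rewrite !exprS expr0; lra.
Qed.

End GaussExpectation.

(** * Local complexities and the critical radius *)

Section Radius.
Context {R : realType} {K : R -> R -> R} {H : rkhs K} {n : nat}.
Variable x : 'I_n -> R.
Hypotheses (n0 : (0 < n)%N) (xI : forall i, I01 (x i)).
Implicit Types (g u : H) (d : R).

Let kv i : H := rkhs_section H (x i).
Local Notation D d := (eff_dim kv (d ^+ 2 / 9)).
Local Notation Q d := (ridge_energy kv (d ^+ 2 / 9)).

Lemma at_designE g : at_design g x = vals kv g.
Proof. by apply/funext => i; rewrite /vals rkhs_reproducing. Qed.

Lemma in_local_diff_class g d :
  `|g| <= 3 -> emp_ip (vals kv g) (vals kv g) <= d ^+ 2 -> 0 <= d ->
  local_diff_class x d g.
Proof.
move=> g3 gd d0; split => //.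
- by exists g, 0; rewrite subr0.
- by rewrite -(@ler_pXn2r _ 2) ?nnegrE ?sqrtr_ge0// emp_norm_sqr at_designE.
Qed.

Let W d (w : n.-tuple R) : \bar R := ereal_sup
  [set (`|emp_ip (tnth w) (at_design g x)|)%:E | g in @local_diff_class R K H n x d].

Let W_ge d w g : local_diff_class x d g -> ((emp_ip (tnth w) (vals kv g))%:E <= W d w)%E.
Proof.
move=> gd; apply: le_trans (ereal_sup_ubound _); last by exists g.
by rewrite lee_fin at_designE ler_norm.
Qed.

Let W_ge0 d w : 0 <= d -> (0 <= W d w)%E.
Proof.
move=> d0; apply: le_trans (W_ge w (g := 0) _).
  by rewrite /emp_ip big1 ?mulr0// => i _; rewrite /vals ip0l mulr0.
apply: in_local_diff_class => //; first by rewrite normr0.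
by rewrite /emp_ip big1 ?mulr0 ?sqr_ge0// => i _; rewrite /vals ip0l mulr0.
Qed.

Lemma ridge_energy_quadform t (w : n.-tuple R) :
  ridge_energy kv t (tnth w) = quadform (smoother kv t) w.
Proof. by []. Qed.

(** Competitor: the ridge fit to w, scaled so that its penalized square norm is
    d ^ 2; both constraints of the local class then hold. *)
Let sqrt_le_W d w : 0 < d -> ((d * Num.sqrt (Q d (tnth w)))%:E <= W d w)%E.
Proof.
move=> d0; have t0 : 0 < d ^+ 2 / 9 by rewrite divr_gt0 ?exprn_gt0.
have [q0|q0] := eqVneq (Q d (tnth w)) 0.
  by rewrite q0 sqrtr0 mulr0 W_ge0// ltW.
have qp : 0 < Q d (tnth w) by rewrite lt_neqAle eq_sym q0 ridge_energy_ge0.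
set q := Q d (tnth w) in q0 qp *.
pose g := ridge_fit kv (d ^+ 2 / 9) (tnth w); pose s := d / Num.sqrt q.
have sq0 : 0 < Num.sqrt q by rewrite sqrtr_gt0.
have s0 : 0 < s by rewrite divr_gt0.
have s2 : s ^+ 2 * q = d ^+ 2.
  by rewrite /s expr_div_n sqr_sqrtr ?(ltW qp)// divfK// gt_eqF.
have qE := ridge_energy_fit kv n0 t0 (tnth w); rewrite -/q -/g in qE.
have vs : vals kv (s *: g) = (fun i => s * vals kv g i).
  by apply/funext => i; rewrite /vals ipZl.
have -> : d * Num.sqrt q = emp_ip (tnth w) (vals kv (s *: g)).
  rewrite vs emp_ipZr -ridge_energyE -/q /s mulrAC -mulrA; congr (_ * _).
  by rewrite -{2}(sqr_sqrtr (ltW qp)) expr2 mulfK// gt_eqF.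
apply: W_ge; apply: in_local_diff_class; last exact: ltW.
- rewrite -(@ler_pXn2r _ 2) ?nnegrE// normrZ exprMn gtr0_norm//.
  rewrite -(ler_pM2l t0).
  have := emp_ip_ge0 (vals kv g); have := sqr_ge0 s; nra.
- rewrite vs emp_ipZl emp_ipZr mulrA -expr2 -s2 ler_wpM2l ?sqr_ge0//.
  by rewrite qE lerDl mulr_ge0 ?(ltW t0).
Qed.

(** Every member g of the local class satisfies |g|_n^2 + t |g|^2 <= 2 d ^ 2 for
    t = d ^ 2 / 9, so testing the energy with g / 4 and - g / 4 bounds the
    noise correlation in both directions. *)
Let W_le d w : 0 < d -> (W d w <= (2 * Q d (tnth w) + 1 * (d ^+ 2 / 4))%:E)%E.
Proof.
move=> d0; have t0 : 0 < d ^+ 2 / 9 by rewrite divr_gt0 ?exprn_gt0.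
apply: ge_ereal_sup => _ [g [_ g3 gd] <-]; rewrite lee_fin at_designE.
have g2 : `|g| ^+ 2 <= 3 ^+ 2 by rewrite ler_pXn2r ?nnegrE.
have gd2 : emp_ip (vals kv g) (vals kv g) <= d ^+ 2.
  by rewrite -emp_norm_sqr -at_designE ler_pXn2r ?nnegrE ?sqrtr_ge0// ltW.
have main s : s ^+ 2 = (1 / 4) ^+ 2 ->
    2 * s * emp_ip (tnth w) (vals kv g) <= Q d (tnth w) + 2 * (1 / 4) ^+ 2 * d ^+ 2.
  move=> sE; have := ridge_energy_max kv n0 t0 (tnth w) (s *: g).
  have -> : vals kv (s *: g) = (fun i => s * vals kv g i).
    by apply/funext => i; rewrite /vals ipZl.
  rewrite emp_ipZl !emp_ipZr normrZ exprMn real_normK ?num_real// [s * (s * _)]mulrA -expr2 sE.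
  have : d ^+ 2 / 9 * `|g| ^+ 2 <= d ^+ 2 by have := sqr_ge0 d; nra.
  lra.
rewrite ler_norml; apply/andP; split.
  have := main (- (1 / 4)); rewrite sqrrN => /(_ erefl); lra.
have := main (1 / 4) erefl; lra.
Qed.

Let sm_sym d : 0 < d -> forall i j, smoother kv (d ^+ 2 / 9) i j = smoother kv (d ^+ 2 / 9) j i.
Proof. by move=> d0 i j; rewrite smootherC// divr_gt0 ?exprn_gt0. Qed.

(** The local complexity is at least d times the mean of the square root of the
    energy, which is at least of the order of the square root of its mean. *)
Lemma solution_eff_dim d : positive_solutions (local_complexity H x) d -> D d <= d ^+ 2.
Proof.
move=> [d0 Gd]; have t0 : 0 < d ^+ 2 / 9 by rewrite divr_gt0 ?exprn_gt0.
have [D0|D0] := leP (D d) 0; first by rewrite (le_trans D0)// sqr_ge0.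
pose s : R := Num.sqrt (2 * D d).
have s0 : 0 < s by rewrite sqrtr_gt0 mulr_gt0.
have s2 : s ^+ 2 = 2 * D d by rewrite sqr_sqrtr// mulr_ge0// ltW.
have [|||v hv vle] := @quadform_sqr_mean _ n (smoother kv (d ^+ 2 / 9)).
- exact: sm_sym.
- by move=> i; exact: smoother_ge0.
- by move=> i j; exact: smoother_minor.
(* coefficients of the tangent inequality at s = sqrt (2 * D d) *)
pose a := d * (3 / (2 * s)); pose b : R := - d / (2 * s ^+ 3).
have hG := has_gauss_mean_lin a b (quadform_mean (sm_sym d0)) hv.
have le : ((a * D d + b * v)%:E <= local_complexity H x d)%E.
  rewrite -(has_gauss_meanE hG); apply: le_gauss_expectation => w.
    by apply: W_ge0; exact: ltW.
  apply: le_trans (sqrt_le_W w d0); rewrite lee_fin ridge_energy_quadform.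
  have q0 : 0 <= quadform (smoother kv (d ^+ 2 / 9)) w.
    by rewrite -ridge_energy_quadform ridge_energy_ge0.
  apply: le_trans (ler_wpM2l (ltW d0) (sqrt_tangent q0 s0)).
  rewrite le_eqVlt; apply/orP; left; apply/eqP; rewrite /a /b; field.
  by rewrite gt_eqF.
have : 2 * (a * D d + b * v) <= d ^+ 2.
  by rewrite -lee_fin EFinM (le_trans _ Gd)// lee_pmul2l// ltry.
have bv : b * (3 * D d ^+ 2) <= b * v.
  by rewrite ler_wnM2l// /b mulNr oppr_le0 divr_ge0 ?(ltW d0)// mulr_ge0 ?exprn_ge0 ?(ltW s0).
have DE : D d = s ^+ 2 / 2 by rewrite s2; field.
have -> : a * D d = d * (3 / 4) * s by rewrite DE /a; field; rewrite gt_eqF.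
have bE : b * (3 * D d ^+ 2) = - (3 / 8) * d * s by rewrite DE /b; field; rewrite gt_eqF.
move=> h.
have sd : 3 / 4 * s <= d.
  by rewrite -(ler_pM2l d0); move: bv; rewrite bE; lra.
rewrite DE; have := ltW s0; nra.
Qed.

(** The local complexity is at most twice the mean energy plus d ^ 2 / 4. *)
Lemma eff_dim_solution d : 0 < d -> 8 * D d <= d ^+ 2 ->
  positive_solutions (local_complexity H x) d.
Proof.
move=> d0 Dd; split => //.
have hG := has_gauss_mean_lin 2 1 (quadform_mean (sm_sym d0))
  (has_gauss_mean_cst n (d ^+ 2 / 4)).
have le : (local_complexity H x d <= (2 * D d + 1 * (d ^+ 2 / 4))%:E)%E.
  rewrite -(has_gauss_meanE hG); apply: le_gauss_expectation => w.
    by apply: le_trans (W_ge0 w (ltW d0)) (W_le w d0).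
  exact: W_le.
apply: (@le_trans _ _ (2%:E * (2 * D d + 1 * (d ^+ 2 / 4))%:E)%E).
  by rewrite lee_pmul2l// ltry.
rewrite -EFinM lee_fin; lra.
Qed.

Lemma delta_radius_ge0 : 0 <= delta_radius H x.
Proof.
rewrite /delta_radius /smallest_positive_solution.
have [->|/set0P S0] := eqVneq (positive_solutions (local_complexity H x)) set0.
  by rewrite inf0.
by apply: lb_le_inf => // d [d0 _]; exact: ltW.
Qed.

Let solutions_lb : has_lbound (positive_solutions (local_complexity H x)).
Proof. by exists 0 => d [d0 _]; exact: ltW. Qed.

(** The effective dimension decreases in the radius, so enlarging d ^ 2 by
    8 * D d produces a solution. *)
Let enlarged d : 0 < d -> positive_solutions (local_complexity H x)
  (Num.sqrt (d ^+ 2 + 8 * D d)).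
Proof.
move=> d0; have t0 : 0 < d ^+ 2 / 9 by rewrite divr_gt0 ?exprn_gt0.
have D0 := eff_dim_ge0 kv n0 t0; have d2 : 0 < d ^+ 2 by rewrite exprn_gt0.
have s2 : Num.sqrt (d ^+ 2 + 8 * D d) ^+ 2 = d ^+ 2 + 8 * D d.
  by rewrite sqr_sqrtr// addr_ge0 ?mulr_ge0// ltW.
apply: eff_dim_solution; first by rewrite sqrtr_gt0 ltr_pwDl// mulr_ge0.
have : D (Num.sqrt (d ^+ 2 + 8 * D d)) <= D d.
  by apply: eff_dim_anti => //; rewrite s2; lra.
rewrite s2; lra.
Qed.

Lemma delta_radius_le d : 0 < d -> delta_radius H x ^+ 2 <= d ^+ 2 + 8 * D d.
Proof.
move=> d0; have t0 : 0 < d ^+ 2 / 9 by rewrite divr_gt0 ?exprn_gt0.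
have D0 := eff_dim_ge0 kv n0 t0; have d2 : 0 < d ^+ 2 by rewrite exprn_gt0.
have s2 : Num.sqrt (d ^+ 2 + 8 * D d) ^+ 2 = d ^+ 2 + 8 * D d.
  by rewrite sqr_sqrtr// addr_ge0 ?mulr_ge0// ltW.
rewrite -s2 ler_pXn2r ?nnegrE ?sqrtr_ge0 ?delta_radius_ge0//.
by apply: ge_inf => //; exact: enlarged.
Qed.

(** Solutions exist arbitrarily close to the infimum, and each of them caps the
    effective dimension; a failure of the cap is thus a lower bound for the
    random radius. *)
Lemma delta_radius_lt d : 0 < d -> delta_radius H x < d -> D d <= d ^+ 2.
Proof.
move=> d0 dd.
have hinf : has_inf (positive_solutions (local_complexity H x)).
  by split => //; exists (Num.sqrt (1 ^+ 2 + 8 * D 1)); exact: enlarged.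
have e0 : 0 < d - delta_radius H x by rewrite subr_gt0.
have [e ep] := inf_adherent e0 hinf; rewrite addrC subrK => ed.
have e1 := solution_eff_dim ep; have [ep0 _] := ep.
have ed2 : e ^+ 2 <= d ^+ 2 by rewrite ler_pXn2r ?nnegrE ?(ltW ep0) ?(ltW d0) ?(ltW ed).
apply: (le_trans _ ed2); apply: (le_trans _ e1).
by apply: eff_dim_anti; rewrite ?divr_gt0 ?exprn_gt0// ler_pM2r.
Qed.

End Radius.

(** * Weak sequential compactness in separable Hilbert spaces *)

Section WeakCompactness.
Context {R : realType} {K : R -> R -> R} {H : rkhs K}.
Implicit Types (g h u : H) (a : R).
Local Notation ip := (@rkhs_ip R K H).

Lemma dense_sequence : separable H ->
  exists D : nat -> H, forall g e, 0 < e -> exists i, `|g - D i| < e.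
Proof.
move=> [D [cD dD]].
have D0 : D !=set0.
  by have [||g [_ Dg]] := dD setT; [exists 0|exact: openT|exists g].
have /pfcard_geP[D00|[f]] : (D #<= [set: nat])%card by exact: cD.
  by move: D0; rewrite D00 => -[].
exists f => g e e0.
have [||h [gh Dh]] := dD (ball g e).
- by exists g; exact: ballxx.
- exact: ball_open.
have [i _ fi] := 'surj_f Dh.
by exists i; move: gh; rewrite -fi -ball_normE.
Qed.

Lemma ultra_fmap (T U : Type) (f : T -> U) (F : set_system T) :
  UltraFilter F -> UltraFilter (f @ F).
Proof.
move=> FU; split; first exact: fmap_proper_filter.
move=> G PG fFG; apply/seteqP; split => // A GA.
have [//|FnA] := in_ultra_setVsetC (f @^-1` A) FU.
have GnA : G (~` A) by exact: fFG.
by have [x [Ax nAx]] := filter_ex (filterI GA GnA).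
Qed.

(** Limits along an ultrafilter exist for all bounded sequences at once and
    define the weak limit; density then extracts an honest subsequence. *)
Lemma weak_compact (u : nat -> H) : separable H -> (forall m, `|u m| <= 1) ->
  exists (s : nat -> nat) (h : H), [/\ forall m, (m <= s m)%N, `|h| <= 1
    & forall g, (fun m => ip (u (s m)) g) @ \oo --> ip h g].
Proof.
move=> sep u1; have [D Ddense] := dense_sequence sep.
have [F [FU FP]] := ultraFilterLemma (@eventually_filter).
have PF : ProperFilter F by exact: ultra_proper.
have ub g m : `|ip (u m) g| <= `|g|.
  by apply: le_trans (CauchySchwarz_ip _ _) _; rewrite ler_piMl.
have /choice[l lP] : forall g, exists p : R, (fun m => ip (u m) g) @ F --> p.
  move=> g; have := @segment_compact R (- `|g|) (`|g|); rewrite compact_ultra.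
  move=> /(_ ((fun m => ip (u m) g) @ F) _) [].
  - exact: ultra_fmap.
  - rewrite /fmap /=; apply: filterS (filterT : F setT) => m _ /=.
    by rewrite in_itv /= -ler_norml.
  - by move=> p [_ Fp]; exists p.
have lbd g : `|l g| <= 1 * `|g|.
  rewrite mul1r; apply: (cvgr_to_le (cvg_norm (lP g))).
  by apply: filterS (filterT : F setT) => m _ /=; exact: ub.
have llin a g h : l (a *: g + h) = a * l g + l h.
  apply: (@cvg_unique _ _ ((fun m => ip (u m) (a *: g + h)) @ F)); first exact: Rhausdorff.
    exact: lP.
  rewrite /=; under eq_cvg do rewrite ipDr ipZr.
  by apply: cvgD => //; apply: cvgM => //; exact: cvg_cst.
have subT : @lin_subspace R K H setT by [].
have [h [_ hP]] := riesz subT llin lbd.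
have h1 : `|h| <= 1.
  have [->|h0] := eqVneq h 0; first by rewrite normr0.
  have := lbd h; rewrite -hP// mul1r rkhs_ip_norm ger0_norm ?sqr_ge0//.
  by rewrite expr2 -ler_pdivlMr ?normr_gt0// divff ?normr_eq0.
have /choice[s sP] : forall m, exists k, (m <= k)%N /\
    forall i, (i < m)%N -> `|ip (u k) (D i) - ip h (D i)| < m.+1%:R^-1.
  move=> m; have Fm : F [set k | (m <= k)%N] by apply: FP; exists m.
  have Fi i : F [set k | `|ip (u k) (D i) - ip h (D i)| < m.+1%:R^-1].
    rewrite hP//; have /cvgrPdist_lt/(_ m.+1%:R^-1) := lP (D i).
    rewrite invr_gt0 ltr0Sn => /(_ isT).
    by apply: filterS => k /=; rewrite distrC.
  have FI : F [set k | forall i, (i < m)%N -> `|ip (u k) (D i) - ip h (D i)| < m.+1%:R^-1].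
    elim: {1}m => [|p IH]; first by apply: filterS (filterT : F setT) => k _ i.
    apply: filterS (filterI IH (Fi p)) => k [kp ki] i.
    by rewrite ltnS leq_eqVlt => /orP[/eqP ->|/kp].
  by have [k [mk kP]] := filter_ex (filterI Fm FI); exists k.
exists s, h; split => // [m|g]; first exact: (sP m).1.
apply/cvgrPdist_lt => e e0.
have e3 : 0 < e / 3 by rewrite divr_gt0.
have [i gi] := Ddense g _ e3.
near=> m.
have im : (i < m)%N by near: m; exact: nbhs_infty_gt.
have me : m.+1%:R^-1 < e / 3 by near: m; exact: (near_infty_natSinv_lt (PosNum e3)).
have := (sP m).2 i im.
have -> : ip h g - ip (u (s m)) g = ip h (g - D i) - ip (u (s m)) (g - D i)
    - (ip (u (s m)) (D i) - ip h (D i)) by rewrite !ipBr; ring.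
have b1 : `|ip h (g - D i)| <= `|g - D i|.
  by apply: le_trans (CauchySchwarz_ip _ _) _; rewrite ler_piMl.
have b2 := ub (g - D i) (s m) => b3.
apply: le_lt_trans (ler_normB _ _) _.
apply: le_lt_trans (lerD (ler_normB _ _) (lexx _)) _.
by move: m.+1%:R^-1 me b3 => /= r me b3; lra.
Unshelve. all: by end_near. Qed.

End WeakCompactness.

(** * The feature map *)

Section Feature.
Context {R : realType} {K : R -> R -> R} (H : rkhs K).
Local Notation ip := (@rkhs_ip R K H).
Implicit Types (g h : H) (x y : R).

(** Kernel sections extended by zero outside of the unit interval, so that
    measurability and boundedness hold on the whole line. *)
Definition feature x : H := if 0 <= x <= 1 then rkhs_section H x else 0.

Lemma I01E x : I01 x <-> (0 <= x <= 1).
Proof. by rewrite /I01 /= in_itv. Qed.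

Lemma feature_section x : I01 x -> feature x = rkhs_section H x.
Proof. by move/I01E => h; rewrite /feature h. Qed.

Lemma ip_feature g x : I01 x -> ip g (feature x) = rkhs_eval g x.
Proof. by move=> Ix; rewrite feature_section// rkhs_reproducing. Qed.

Lemma ip_featureE x y :
  ip (feature x) (feature y) = if (0 <= x <= 1) && (0 <= y <= 1) then K x y else 0.
Proof.
have [/I01E Ix|nx] := boolP (0 <= x <= 1); last by rewrite /feature (negbTE nx) ip0l.
have [/I01E Iy|ny] := boolP (0 <= y <= 1); last by rewrite /feature (negbTE ny) ip0r.
by rewrite ip_feature// feature_section// rkhs_sectionE.
Qed.

Lemma feature_bounded : bounded_kernel K ->
  exists2 B : R, 0 < B & forall x, `|feature x| ^+ 2 <= B.
Proof.
move=> [B BP]; exists (`|B| + 1) => [|x]; first by rewrite ltr_wpDl.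
rewrite -rkhs_ip_norm ip_featureE andbb.
case: ifP => [/I01E Ix|_]; last by rewrite addr_ge0.
have := BP _ _ Ix Ix; have := ler_norm (K x x); have := ler_norm B; lra.
Qed.

Lemma measurable_I01 : measurable (@I01 R).
Proof. exact: measurable_itv. Qed.

Lemma measurable_feature2 : jointly_measurable K ->
  measurable_fun [set: R * R] (fun p => ip (feature p.1) (feature p.2)).
Proof.
move=> mK; have mI := measurable_I01.
have := (measurable_restrictT _ (measurableX mI mI)).1 mK.
congr measurable_fun; apply/funext => -[x y] /=; rewrite ip_featureE patchE.
case: ifPn => [|].
  by rewrite inE /= => -[/= /I01E -> /I01E ->].
by rewrite notin_setE /=; case: ifP => // /andP[/I01E Ix /I01E Iy] [].
Qed.

Lemma measurable_feature1 y : jointly_measurable K ->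
  measurable_fun [set: R] (fun x => ip (feature y) (feature x)).
Proof.
move=> /measurable_feature2 m2.
have mp : measurable_fun [set: R] (fun x : R => (y, x)).
  by apply/measurable_fun_pair.
exact: measurableT_comp m2 mp.
Qed.

Lemma measurable_feature_diag : jointly_measurable K ->
  measurable_fun [set: R] (fun x => ip (feature x) (feature x)).
Proof.
move=> /measurable_feature2 m2.
have mp : measurable_fun [set: R] (fun x : R => (x, x)).
  by apply/measurable_fun_pair.
exact: measurableT_comp m2 mp.
Qed.

(** The elements with measurable evaluation form a closed subspace containing
    all kernel sections. *)
Lemma measurable_eval g : jointly_measurable K ->
  measurable_fun [set: R] (fun x => ip g (feature x)).
Proof.
move=> mK; pose V := [set h : H | measurable_fun [set: R] (fun x => ip h (feature x))].
have V0 : V 0 by rewrite /V /=; under eq_fun do rewrite ip0l; exact: measurable_cst.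
have VD a g1 g2 : V g1 -> V g2 -> V (a *: g1 + g2).
  move=> m1 m2; rewrite /V /=; under eq_fun do rewrite ipDl ipZl.
  by apply: measurable_funD => //; exact: measurable_funM.
have VV : lin_subspace V := conj V0 VD.
have [h [[u uV uh] hV]] := @riesz _ _ _ V (ip g) (`|g|) VV
  (fun a g1 g2 => ltac:(by rewrite ipDr ipZr)) (fun h => CauchySchwarz_ip g h).
have -> : g = h.
  apply: rkhs_eval_inj => x Ix; rewrite -!ip_feature// (hV (feature x))//.
  exact: measurable_feature1.
apply: (@measurable_fun_cvg _ _ _ setT (fun m x => ip (u m) (feature x))) => //.
by move=> x _; exact: ip_cvgl.
Qed.

End Feature.

(** * The spectrum of the integral operator and the trace of the kernel *)

Section L2.
Context {R : realType}.
Notation mu := (@lebesgue_measure R).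
Implicit Types f g : R -> R.

Definition integrable01 f := mu.-integrable (@I01 R) (EFin \o f).

Lemma lebesgue_I01 : mu (@I01 R) = 1%E.
Proof. by rewrite /I01 lebesgue_measure_itv /= lte01 oppr0 adde0. Qed.

Lemma integrable01_bounded f (C : R) : measurable_fun [set: R] f ->
  (forall x, `|f x| <= C) -> integrable01 f.
Proof.
move=> mf fC; apply: measurable_bounded_integrable.
- exact: measurable_I01.
- by rewrite [X in (X < _)%E]lebesgue_I01 ltry.
- exact: measurable_funTS.
- exists C; split; first exact: num_real.
  by move=> M CM x _; apply: le_trans (fC x) (ltW CM).
Qed.

Lemma integrable01_le f g : measurable_fun (@I01 R) f -> integrable01 g ->
  (forall x, I01 x -> `|f x| <= g x) -> integrable01 f.
Proof.
move=> mf ig fg; apply: (@le_integrable _ _ _ mu _ measurable_I01 _ (EFin \o g)) => //.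
- exact/measurable_EFinP.
- by move=> x Ix; rewrite /= lee_fin; exact: le_trans (fg x Ix) (ler_norm _).
Qed.

Lemma L2_measurable f : L2_01 f -> measurable_fun (@I01 R) f.
Proof. by case. Qed.

Lemma L2_sqr f : L2_01 f -> integrable01 (fun x => f x ^+ 2).
Proof.
move=> [mf foo]; apply/integrableP; split.
  by apply/measurable_EFinP; exact: measurable_funX.
apply: le_lt_trans foo; rewrite le_eqVlt; apply/orP; left; apply/eqP.
by apply: eq_integral => x _ /=; rewrite ger0_norm// sqr_ge0.
Qed.

Lemma integrable01D f g : integrable01 f -> integrable01 g ->
  integrable01 (fun x => f x + g x).
Proof.
move=> i1 i2; rewrite /integrable01.
rewrite (_ : EFin \o _ = (EFin \o f) \+ (EFin \o g))%E; last exact/funext.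
by apply: integrableD => //; exact: measurable_I01.
Qed.

Lemma integrable01Z (a : R) f : integrable01 f -> integrable01 (fun x => a * f x).
Proof.
move=> i1; rewrite /integrable01.
rewrite (_ : EFin \o _ = (fun x => a%:E * (EFin \o f) x))%E; last exact/funext.
by apply: integrableZl => //; exact: measurable_I01.
Qed.

Lemma L2_prod f g : L2_01 f -> L2_01 g -> integrable01 (fun x => f x * g x).
Proof.
move=> f2 g2; apply: (@integrable01_le _ (fun x => f x ^+ 2 + g x ^+ 2)).
- by apply: measurable_funM; exact: L2_measurable.
- by apply: integrable01D; exact: L2_sqr.
- move=> x _; rewrite normrM -(real_normK (num_real (f x))) -(real_normK (num_real (g x))).
  have := sqr_ge0 (`|f x| - `|g x|).
  have : 0 <= `|f x| * `|g x| by rewrite mulr_ge0.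
  nra.
Qed.

Lemma L2_integrable f : L2_01 f -> integrable01 f.
Proof.
move=> f2; apply: (@integrable01_le _ (fun x => 1 + f x ^+ 2)).
- exact: L2_measurable.
- apply: integrable01D; last exact: L2_sqr.
  exact: (@integrable01_bounded (fun=> 1) 1 (measurable_cst _) (fun x => ltac:(by rewrite normr1))).
- move=> x _; rewrite -(real_normK (num_real (f x))).
  by have := sqr_ge0 (`|f x| - 1); have := normr_ge0 (f x); nra.
Qed.

Lemma L2_ipC f g : L2_01_ip f g = L2_01_ip g f.
Proof. by apply: eq_Rintegral => x _; rewrite mulrC. Qed.

Lemma L2_ip_linear (a : R) f g h : L2_01 f -> L2_01 g -> L2_01 h ->
  L2_01_ip (fun x => a * f x + g x) h = a * L2_01_ip f h + L2_01_ip g h.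
Proof.
move=> f2 g2 h2; rewrite /L2_01_ip -RintegralZl//; last 2 first.
- exact: measurable_I01.
- exact: L2_prod.
rewrite -RintegralD//; last 3 first.
- exact: measurable_I01.
- by apply: integrable01Z; exact: L2_prod.
- exact: L2_prod.
by apply: eq_Rintegral => x _; rewrite mulrDl mulrA.
Qed.

Lemma L2_ip_ae f g h : L2_01_eq f g -> measurable_fun (@I01 R) f ->
  measurable_fun (@I01 R) g -> measurable_fun (@I01 R) h ->
  L2_01_ip f h = L2_01_ip g h.
Proof.
move=> fg mf mg mh; congr fine; apply: ae_eq_integral.
- exact: measurable_I01.
- by apply/measurable_EFinP; exact: measurable_funM.
- by apply/measurable_EFinP; exact: measurable_funM.
- have [N [mN N0 sub]] := fg; exists N; split=> // x /= nx; apply: sub => /= fgx.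
  by apply: nx => Ix; rewrite fgx.
Qed.

Lemma L2_ip_sqr f : L2_01 f ->
  ((L2_01_ip f f)%:E = \int[mu]_(x in I01) (f x ^+ 2)%:E)%E.
Proof.
move=> f2; rewrite /L2_01_ip fineK.
  by apply: eq_integral => x _; rewrite expr2.
apply: integrable_fin_num; [exact: measurable_I01|exact: L2_prod].
Qed.

Lemma L2_ip_ge0 f : 0 <= L2_01_ip f f.
Proof. by apply: Rintegral_ge0 => x _; rewrite -expr2 sqr_ge0. Qed.

Lemma L2_ip_eq0 f : L2_01 f -> L2_01_ip f f = 0 -> L2_01_eq f (fun=> 0).
Proof.
move=> f2 f0; have := L2_ip_sqr f2; rewrite f0 => /esym I0.
have mf : measurable_fun (@I01 R) (fun x => (f x ^+ 2)%:E).
  by apply/measurable_EFinP; apply: measurable_funX; exact: L2_measurable.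
have [+ _] := ae_eq_integral_abs mu measurable_I01 mf.
have -> : (\int[mu]_(x in I01) `|(f x ^+ 2)%:E| = 0)%E.
  apply: etrans I0; apply: eq_integral => x _.
  by rewrite /= ger0_norm ?sqr_ge0.
move=> /(_ erefl) [N [mN N0 sub]]; exists N; split=> // x /= nx; apply: sub => /= fx.
by apply: nx => /fx [] /eqP; rewrite sqrf_eq0 => /eqP.
Qed.

End L2.

Section OrthogonalComplement.
Context {R : realType} {K : R -> R -> R} {H : rkhs K}.
Local Notation ip := (@rkhs_ip R K H).
Implicit Types (g h u : H) (a : R).

Lemma riesz_setT (l : H -> R) (C : R) :
  (forall a g h, l (a *: g + h) = a * l g + l h) ->
  (forall g, `|l g| <= C * `|g|) -> exists h, forall g, ip h g = l g.
Proof.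
move=> llin lbd; have VT : lin_subspace [set: H] by [].
by have [h [_ hP]] := riesz VT llin lbd; exists h => g; exact: hP.
Qed.

Variable (hh : nat -> H).

Definition orth_compl : set H := [set g | forall j, ip (hh j) g = 0].

Lemma orth_compl_subspace : lin_subspace orth_compl.
Proof.
split=> [j|a g h g0 h0 j]; first by rewrite ip0r.
by rewrite ipDr ipZr g0 h0 mulr0 addr0.
Qed.

Lemma orth_compl_closed (u : nat -> H) g : (forall m, orth_compl (u m)) ->
  u @ \oo --> g -> orth_compl g.
Proof.
move=> uV ug j; rewrite ipC; apply: (@cvg_unique _ _ ((fun m => ip (u m) (hh j)) @ \oo)).
- exact: Rhausdorff.
- exact: ip_cvgl.
- rewrite (_ : (fun m => _) = fun=> 0); first exact: cvg_cst.
  by apply/funext => m; rewrite ipC uV.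
Qed.

Lemma orth_proj g : exists2 p, orth_compl p & forall v, orth_compl v -> ip p v = ip g v.
Proof.
have [p [[u uV up] pP]] := @riesz _ _ _ orth_compl (ip g) (`|g|) orth_compl_subspace
  (fun a g1 g2 => ltac:(by rewrite ipDr ipZr)) (fun h => CauchySchwarz_ip g h).
by exists p => //; exact: orth_compl_closed up.
Qed.

(** Double orthogonality: Riesz representation on the span of the family gives
    the projection of g to its closure, and g minus the projection is orthogonal
    to itself. *)
Lemma orth_compl2 g e : (forall v, orth_compl v -> ip g v = 0) -> 0 < e ->
  exists k (c : nat -> R), `|g - \sum_(j < k) c j *: hh j| < e.
Proof.
move=> gV e0.
pose S := [set s : H | exists k0 (c : nat -> R),
  forall k, (k0 <= k)%N -> s = \sum_(j < k) c j *: hh j].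
have S0 : S 0.
  by exists 0%N, (fun=> 0) => k _; rewrite big1// => j _; rewrite scale0r.
have SD a s1 s2 : S s1 -> S s2 -> S (a *: s1 + s2).
  move=> [k1 [c1 s1P]] [k2 [c2 s2P]]; exists (maxn k1 k2), (fun j => a * c1 j + c2 j) => k.
  rewrite geq_max => /andP[/s1P -> /s2P ->]; rewrite scaler_sumr -big_split.
  by apply: eq_bigr => j _ /=; rewrite scalerA scalerDl.
have SS : lin_subspace S := conj S0 SD.
have Sh j : S (hh j).
  exists j.+1, (fun i => (i == j)%:R) => k jk.
  rewrite (bigD1 (Ordinal jk))//= eqxx scale1r big1 ?addr0// => i.
  by rewrite -val_eqE /= => /negbTE ->; rewrite scale0r.
have [q [[u uS uq] qP]] := @riesz _ _ _ S (ip g) (`|g|) SS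
  (fun a g1 g2 => ltac:(by rewrite ipDr ipZr)) (fun h => CauchySchwarz_ip g h).
have gqV : orth_compl (g - q).
  by move=> j; rewrite ipBr !(ipC (hh j)) qP// subrr.
have gq : g = q.
  apply/eqP; rewrite -subr_eq0; apply/eqP/ip_eq0.
  rewrite ipBl gV// sub0r; apply/eqP; rewrite oppr_eq0; apply/eqP.
  apply: (@cvg_unique _ _ ((fun m => ip (u m) (g - q)) @ \oo)).
  - exact: Rhausdorff.
  - exact: ip_cvgl.
  - rewrite (_ : (fun m => _) = fun=> 0); first exact: cvg_cst.
    apply/funext => m; have [k0 [c /(_ k0 (leqnn _)) ->]] := uS m.
    by rewrite ip_suml big1// => j _; rewrite ipZl gqV mulr0.
move/cvgrPdist_lt : uq => /(_ e e0) [m _ /(_ m (leqnn m))].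
have [k0 [c /(_ k0 (leqnn _)) ->]] := uS m.
by move=> mP; exists k0, c; rewrite gq.
Qed.

End OrthogonalComplement.

Section Spectrum.
Context {R : realType} {K : R -> R -> R} {H : rkhs K}.
Local Notation ip := (@rkhs_ip R K H).
Local Notation feature := (@feature R K H).
Notation mu := (@lebesgue_measure R).
Variables (ev : nat -> R) (phi : nat -> R -> R).
Hypotheses (Kmeas : jointly_measurable K) (Kbd : bounded_kernel K)
  (sep : separable H).
Hypothesis phi2 : forall j, L2_01 (phi j).
Hypothesis phi_orth : forall i j, L2_01_ip (phi i) (phi j) = (i == j)%:R.
Hypothesis phi_eigen : forall j,
  L2_01_eq (integral_op K (phi j)) (fun x => ev j * phi j x).
Hypothesis phi_complete : forall (a : R) (psi : R -> R), a != 0 -> L2_01 psi ->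
  L2_01_eq (integral_op K psi) (fun x => a * psi x) ->
  (forall j, L2_01_ip psi (phi j) = 0) -> L2_01_eq psi (fun=> 0).
Implicit Types (g h u : H).

Let e g : R -> R := fun x => ip g (feature x).

Let B : R := xget 1 [set B | 0 < B /\ forall x, `|feature x| ^+ 2 <= B].

Let BP : 0 < B /\ forall x, `|feature x| ^+ 2 <= B.
Proof.
have [b b0 bP] := @feature_bounded R K H Kbd.
have /(xgetPex 1) : exists b, [set B | 0 < B /\ forall x, `|feature x| ^+ 2 <= B] b.
  by exists b.
by [].
Qed.

Let e_sqr g x : e g x ^+ 2 <= `|g| ^+ 2 * B.
Proof.
apply: le_trans (ip_sqr_le _ _) _.
by rewrite ler_wpM2l ?sqr_ge0//; exact: BP.2.
Qed.

Let e_bound g x : `|e g x| <= `|g| * (B + 1).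
Proof.
apply: le_trans (CauchySchwarz_ip _ _) _; rewrite ler_wpM2l//.
have := BP.2 x; have := sqr_ge0 (`|feature x| - 1); nra.
Qed.

Let me g : measurable_fun [set: R] (e g). Proof. exact: measurable_eval. Qed.

Let meI g : measurable_fun (@I01 R) (e g). Proof. exact: measurable_funTS. Qed.

Let e2 g : L2_01 (e g).
Proof.
split=> //.
have : integrable01 (fun x => e g x ^+ 2).
  apply: (@integrable01_bounded _ _ (`|g| ^+ 2 * B)); first exact: measurable_funX.
  by move=> x; rewrite ger0_norm ?sqr_ge0.
move=> /integrableP[_]; apply: le_lt_trans; rewrite le_eqVlt; apply/orP; left; apply/eqP.
by apply: eq_integral => x _; rewrite /= ger0_norm ?sqr_ge0.
Qed.

Let e_lin a g h x : e (a *: g + h) x = a * e g x + e h x.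
Proof. by rewrite /e ipDl ipZl. Qed.

Let q g h := L2_01_ip (e g) (e h).

Let qC g h : q g h = q h g. Proof. exact: L2_ipC. Qed.

Let q_lin a g1 g2 h : q (a *: g1 + g2) h = a * q g1 h + q g2 h.
Proof.
rewrite /q -L2_ip_linear//; congr L2_01_ip.
by apply/funext => x; rewrite e_lin.
Qed.

Let q_bound f g : L2_01 f ->
  `|L2_01_ip (e g) f| <= (B + 1) * (\int[mu]_(x in I01) (`|f x|)) * `|g|.
Proof.
move=> f2; rewrite /L2_01_ip.
have iabs : integrable01 (fun x => `|f x|).
  by have := integrable_abse (L2_integrable f2).
apply: le_trans (le_normr_Rintegral _ _) _.
- exact: measurable_I01.
- exact: L2_prod.
rewrite mulrAC -RintegralZl//; last exact: measurable_I01.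
apply: le_Rintegral.
- exact: measurable_I01.
- by have := integrable_abse (L2_prod (e2 g) f2).
- exact: integrable01Z.
- by move=> x _; rewrite normrM ler_wpM2r// [leRHS]mulrC e_bound.
Qed.

(** Riesz representatives of integration against the eigenfunctions. *)
Let hh : nat -> H := fun j => xget 0 [set h : H | forall g, ip h g = L2_01_ip (e g) (phi j)].

Let hhP j g : ip (hh j) g = L2_01_ip (e g) (phi j).
Proof.
have /(xgetPex 0) : exists h, [set h : H | forall g, ip h g = L2_01_ip (e g) (phi j)] h.
  apply: (riesz_setT _ (fun g => q_bound g (phi2 j))) => a g1 g2.
  by rewrite -L2_ip_linear//; congr L2_01_ip; apply/funext => x; rewrite e_lin.
by move=> /(_ g).
Qed.

Let e_feature x : I01 x -> forall f, integral_op K f x = L2_01_ip (e (feature x)) f.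
Proof.
move=> Ix f; apply: eq_Rintegral => y; rewrite inE => Iy.
by rewrite /e ip_featureE !(I01E _).1.
Qed.

Let e_hh j : L2_01_eq (e (hh j)) (fun x => ev j * phi j x).
Proof.
have [N [mN N0 sub]] := phi_eigen j; exists N; split=> // x /= nx; apply: sub => /= fx.
by apply: nx => Ix; rewrite -fx// e_feature// /e hhP.
Qed.

Let mphi j : measurable_fun (@I01 R) (fun x => ev j * phi j x).
Proof. by apply: measurable_funM => //; exact: L2_measurable. Qed.

Let q_hh j f : L2_01 f -> L2_01_ip (e (hh j)) f = ev j * L2_01_ip (phi j) f.
Proof.
move=> f2; rewrite (L2_ip_ae (e_hh j))//; last exact: L2_measurable.
rewrite /L2_01_ip -RintegralZl//.
- by apply: eq_Rintegral => x _; rewrite mulrA.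
- exact: measurable_I01.
- exact: L2_prod.
Qed.

Let ip_hh i j : ip (hh i) (hh j) = (i == j)%:R * ev j.
Proof. by rewrite hhP q_hh// phi_orth eq_sym mulrC. Qed.

Let V : set H := orth_compl hh.

Let q_bounded g : q g g <= B * `|g| ^+ 2.
Proof.
have iB : integrable01 (fun _ : R => B * `|g| ^+ 2).
  apply: (@integrable01_bounded _ _ (B * `|g| ^+ 2)); first exact: measurable_cst.
  by move=> x; rewrite ger0_norm// mulr_ge0 ?sqr_ge0// ltW// BP.1.
apply: (@le_trans _ _ (\int[mu]_(x in I01) (B * `|g| ^+ 2))).
  apply: le_Rintegral => //.
  - exact: measurable_I01.
  - exact: L2_prod.
  - by move=> x _; rewrite -expr2 mulrC e_sqr.
have := @Rintegral_cst _ _ _ mu (@I01 R) measurable_I01 (B * `|g| ^+ 2); rewrite /cst => ->.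
by rewrite [X in fine X]lebesgue_I01 mulr1.
Qed.

(** Evaluations converge pointwise under weak convergence and are uniformly
    bounded, so dominated convergence applies. *)
Let q_weak (u : nat -> H) h : (forall m, `|u m| <= 1) ->
  (forall g, (fun m => ip (u m) g) @ \oo --> ip h g) ->
  (fun m => q (u m) (u m)) @ \oo --> q h h.
Proof.
move=> u1 uh; have mI := @measurable_I01 R.
have iB : integrable01 (fun _ : R => B).
  apply: (@integrable01_bounded _ _ B); first exact: measurable_cst.
  by move=> x; rewrite ger0_norm// ltW// BP.1.
have [|||||_ _] := @dominated_convergence _ _ _ mu _ mI
  (fun m x => (e (u m) x * e (u m) x)%:E) (fun x => (e h x * e h x)%:E) (EFin \o fun=> B).
- by move=> m; apply/measurable_EFinP; exact: (measurable_funM (meI _) (meI _)).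
- by apply/measurable_EFinP; exact: (measurable_funM (meI _) (meI _)).
- apply: aeW => x Ix; apply: cvg_EFin; first exact: nearW.
  by apply: cvgM; exact: uh.
- exact: iB.
- apply: aeW => x m Ix; rewrite /= lee_fin -expr2 ger0_norm ?sqr_ge0//.
  apply: le_trans (e_sqr _ _) _; rewrite ler_piMl ?(ltW BP.1)//.
  by rewrite exprn_ile1.
have qE g : (\int[mu]_(x in I01) (e g x * e g x)%:E = (q g g)%:E)%E.
  by rewrite fineK//; apply: integrable_fin_num => //; exact: L2_prod.
rewrite qE => /fine_cvgP[_]; apply: cvg_trans; apply: near_eq_cvg; apply: nearW => m.
by rewrite /= qE.
Qed.

(** Otherwise the form would have, by weak compactness, a maximizer on the unit
    ball of V, and the first-order condition would make it an eigenfunction with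
    a nonzero eigenvalue that is orthogonal to all the listed ones. *)
Let q_V g : V g -> q g g = 0.
Proof.
move=> Vg; apply: contrapT => /eqP qg0.
pose S : set R := [set q v v | v in [set v | V v /\ `|v| <= 1]].
have Slb : has_ubound S.
  exists B => _ [v [_ v1] <-]; apply: le_trans (q_bounded v) _.
  by rewrite ler_piMr ?(ltW BP.1)// exprn_ile1.
have VV := orth_compl_subspace hh; rewrite -/V in VV.
have qZ c v : q (c *: v) (c *: v) = c ^+ 2 * q v v.
  have q0 w : q 0 w = 0 by have := q_lin 1 0 0 w; rewrite scaler0 addr0; lra.
  have l0 w : q (c *: v) w = c * q v w.
    by have := q_lin c v 0 w; rewrite addr0 q0 addr0.
  by rewrite l0 qC l0 mulrA expr2.
have S0 : S !=set0.
  by exists (q 0 0); exists 0 => //; split; [exact: VV.1|rewrite normr0].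
have hsup : has_sup S by split.
pose a := sup S.
have qa v : V v -> q v v <= a * `|v| ^+ 2.
  move=> Vv; have [->|v0] := eqVneq v 0.
    by have := qZ 0 0; rewrite scale0r normr0 !expr0n /= mulr0 mul0r => ->.
  have nv : 0 < `|v| by rewrite normr_gt0.
  have : q (`|v|^-1 *: v) (`|v|^-1 *: v) <= a.
    apply: ub_le_sup => //; exists (`|v|^-1 *: v) => //; split.
      exact: (subspaceZ _ VV Vv).
    by rewrite normrZ normfV normr_id mulVf ?gt_eqF.
  by rewrite qZ exprVn mulrC ler_pdivrMr ?exprn_gt0.
have g0 : 0 < `|g|.
  rewrite normr_gt0; apply: contra qg0 => /eqP ->.
  by have := qZ 0 0; rewrite scale0r expr0n /= mul0r => ->.
have a0 : 0 < a.
  have : 0 < q g g by rewrite lt_neqAle eq_sym qg0 L2_ip_ge0.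
  move=> /lt_le_trans/(_ (qa _ Vg)).
  by rewrite pmulr_lgt0// exprn_gt0.
have /choice[u uP] : forall m : nat, exists v, [/\ V v, `|v| <= 1 & a - m.+1%:R^-1 < q v v].
  move=> m; have m0 : 0 < m.+1%:R^-1 :> R by [].
  by have [_ [v [Vv v1] <-] qv] := sup_adherent m0 hsup; exists v.
have [s [h [sm h1 sh]]] := weak_compact sep (fun m => let: And3 _ p _ := uP m in p).
have Vh : V h.
  move=> j; rewrite ipC; apply: (@cvg_unique _ _ ((fun m => ip (u (s m)) (hh j)) @ \oo)).
  - exact: Rhausdorff.
  - exact: sh.
  - rewrite (_ : (fun m => _) = fun=> 0); first exact: cvg_cst.
    by apply/funext => m; rewrite ipC; have [+ _ _] := uP (s m); apply.
have qha : a <= q h h.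
  have cv : (fun m => q (u (s m)) (u (s m)) + m.+1%:R^-1) @ \oo --> q h h + 0.
    apply: cvgD; last exact: cvg_harmonic.
    by apply: q_weak => // m; have [] := uP (s m).
  rewrite -[q h h]addr0; apply: (cvgr_to_ge cv); near=> m.
  have [_ _ lt] := uP (s m).
  have : (s m).+1%:R^-1 <= m.+1%:R^-1 :> R by rewrite lef_pV2 ?posrE// ler_nat ltnS.
  by move: lt; move: (s m).+1%:R^-1 m.+1%:R^-1 => /= r1 r2; lra.
have bd f : `|L2_01_ip (e f) (e h) - a * ip h f| <=
    ((B + 1) * (\int[mu]_(x in I01) (`|e h x|)) + a * `|h|) * `|f|.
  apply: le_trans (ler_normB _ _) _; rewrite mulrDl lerD//; first exact: q_bound.
  by rewrite normrM (gtr0_norm a0) -mulrA ler_wpM2l ?(ltW a0)// CauchySchwarz_ip.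
have [|w wP] := riesz_setT _ bd.
  by move=> c f1 f2; rewrite -/(q _ h) q_lin ipDr ipZr /q; ring.
have ww0 : w = 0.
  have wV v : V v -> ip w v = 0.
    move=> Vv; rewrite wP -/(q v h).
    apply: (@linear_coef_eq0 _ _ (q v v - a * `|v| ^+ 2)) => c.
    have := qa (c *: v + h) (VV.2 c _ _ Vv Vh).
    rewrite q_lin (qC v (_ + _)) (qC h (_ + _)) !q_lin (qC h v) -!rkhs_ip_norm.
    rewrite !(ipDl, ipDr, ipZl, ipZr) (ipC v h).
    have : a * ip h h <= q h h.
      by apply: le_trans qha; rewrite ler_piMr ?(ltW a0)// rkhs_ip_norm exprn_ile1.
    move: (ip h h) (ip h v) (ip v v) (q v v) (q v h) (q h h) => r1 r2 r3 r4 r5 r6.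
    lra.
  apply: ip_eq0; apply: wV => j.
  rewrite ipC wP q_hh// L2_ipC -hhP Vh ipC Vh; ring.
have eigen : L2_01_eq (integral_op K (e h)) (fun x => a * e h x).
  apply: aeW => x Ix; rewrite e_feature//; apply/eqP; rewrite -subr_eq0.
  by rewrite /e -wP ww0 ip0l.
have h0 : L2_01_eq (e h) (fun=> 0).
  have an0 : a != 0 by rewrite gt_eqF.
  by apply: (phi_complete an0 (e2 h) eigen) => j; rewrite -hhP.
have : q h h = 0.
  rewrite /q (L2_ip_ae h0)//.
  rewrite /L2_01_ip; under eq_Rintegral do rewrite mul0r.
  by have := @Rintegral_cst _ _ _ mu (@I01 R) measurable_I01 0; rewrite /cst => ->; rewrite mul0r.
by move: qha => /[swap] ->; rewrite leNgt a0.
Unshelve. all: by end_near. Qed.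

(** Each element of V vanishes outside of a null set; by separability countably
    many of them, the projections of a dense sequence, decide for all of V. *)
Let feature_orth : {ae mu, forall x, I01 x -> forall v, V v -> ip (feature x) v = 0}.
Proof.
have [D Ddense] := dense_sequence sep.
have /choice[p pP] : forall i, exists p, V p /\ forall v, V v -> ip p v = ip (D i) v.
  by move=> i; have [p Vp pD] := orth_proj hh (D i); exists p.
have null i : mu.-negligible [set x | ~ (I01 x -> e (p i) x = 0)].
  exact: (L2_ip_eq0 (e2 (p i)) (q_V (pP i).1)).
have [N [mN N0 sub]] := negligible_bigcup null.
exists N; split => // x /= nx; apply: sub => /=; apply: contrapT => nex.
apply: nx => Ix v Vv.
have px i : e (p i) x = 0 by apply: contrapT => n; apply: nex; exists i => // /(_ Ix).
apply/eqP; rewrite -normr_eq0; apply/eqP/le_anti; rewrite normr_ge0 andbT.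
apply/ler_addgt0Pr => d d0; rewrite add0r.
pose C := `|feature x| + 1.
have C0 : 0 < C by rewrite /C ltr_wpDl.
have [i vi] := Ddense v (d / C) (divr_gt0 d0 C0).
have VV := orth_compl_subspace hh; rewrite -/V in VV.
have Vd : V (v - p i) by exact: (subspaceB VV Vv (pP i).1).
have le : `|v - p i| <= `|v - D i|.
  have [->|n0] := eqVneq `|v - p i| 0; first by [].
  have np : 0 < `|v - p i| by rewrite lt_neqAle eq_sym n0 normr_ge0.
  rewrite -(ler_pM2r np) -expr2 -rkhs_ip_norm.
  have -> : ip (v - p i) (v - p i) = ip (v - D i) (v - p i).
    by rewrite !(ipBl v) (pP i).2.
  by apply: le_trans (ler_norm _) _; exact: CauchySchwarz_ip.
have -> : ip (feature x) v = ip (v - p i) (feature x).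
  by rewrite ipBl -/(e (p i) x) px subr0 ipC.
apply: le_trans (CauchySchwarz_ip _ _) _.
apply: (@le_trans _ _ (d / C * C)); last by rewrite divfK// gt_eqF.
by apply: ler_pM => //; [exact: le_trans le (ltW vi)|rewrite /C lerDl].
Qed.

Hypothesis ev0 : forall j, 0 <= ev j.

(** Mass of a vector along the j-th eigendirection; when the eigenvalue vanishes
    so does the representative, and the quotient is zero. *)
Let mass x j : R := ip (feature x) (hh j) ^+ 2 / ev j.

Let mass_ge0 x j : 0 <= mass x j.
Proof. by rewrite divr_ge0 ?sqr_ge0. Qed.

Let hh0 j : ev j = 0 -> hh j = 0.
Proof. by move=> j0; apply: ip_eq0; rewrite ip_hh j0 mulr0. Qed.

Let dist_span (c : nat -> R) k x :
  `|feature x - \sum_(j < k) c j *: hh j| ^+ 2 =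
  `|feature x| ^+ 2 - 2 * \sum_(j < k) c j * ip (feature x) (hh j) +
  \sum_(j < k) c j ^+ 2 * ev j.
Proof.
rewrite -!rkhs_ip_norm !(ipBl, ipBr) (ipC (\sum_(j < k) _) (feature x)).
have -> : ip (feature x) (\sum_(j < k) c j *: hh j) =
    \sum_(j < k) c j * ip (feature x) (hh j).
  by rewrite ip_sumr; apply: eq_bigr => j _; rewrite ipZr.
have -> : ip (\sum_(j < k) c j *: hh j) (\sum_(j < k) c j *: hh j) =
    \sum_(j < k) c j ^+ 2 * ev j.
  rewrite ip_suml; apply: eq_bigr => j _; rewrite ipZl ip_sumr (bigD1 j)//= big1.
    by rewrite addr0 ipZr ip_hh eqxx mul1r mulrA expr2.
  move=> i ij; rewrite ipZr ip_hh (_ : (_ == _) = false) ?mul0r ?mulr0//.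
  by apply/negbTE; move: ij; rewrite -val_eqE /= eq_sym.
ring.
Qed.

(** Expanding the square of the distance to a point of the span and completing
    it in each coordinate shows that the masses are what is removed at best. *)
Let mass_le (c : nat -> R) k x :
  `|feature x| ^+ 2 - \sum_(j < k) mass x j <=
  `|feature x - \sum_(j < k) c j *: hh j| ^+ 2.
Proof.
rewrite dist_span.
suff : - \sum_(j < k) mass x j <= - (2 * \sum_(j < k) c j * ip (feature x) (hh j)) +
    \sum_(j < k) c j ^+ 2 * ev j by lra.
rewrite mulr_sumr -!sumrN -big_split; apply: ler_sum => j _ /=.
rewrite /mass; have [j0|j0] := eqVneq (ev j) 0.
  by rewrite j0 (hh0 j0) ip0r invr0; lra.
have jp : 0 < ev j by rewrite lt_neqAle eq_sym j0 ev0.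
rewrite -subr_ge0; set r := ip _ _.
rewrite (_ : _ - _ = ev j * (c j - r / ev j) ^+ 2); last by field.
by rewrite mulr_ge0 ?sqr_ge0.
Qed.

Let bessel_feature k x : \sum_(j < k) mass x j <= `|feature x| ^+ 2.
Proof.
have := dist_span (fun j => ip (feature x) (hh j) / ev j) k x.
have -> : \sum_(j < k) ip (feature x) (hh j) / ev j * ip (feature x) (hh j) =
    \sum_(j < k) mass x j.
  by apply: eq_bigr => j _; rewrite /mass mulrAC expr2.
have -> : \sum_(j < k) (ip (feature x) (hh j) / ev j) ^+ 2 * ev j = \sum_(j < k) mass x j.
  apply: eq_bigr => j _; rewrite /mass; have [->|j0] := eqVneq (ev j) 0.
    by rewrite invr0 !mulr0.
  by field.
set n2 := `|feature x - _| ^+ 2; have : 0 <= n2 by exact: sqr_ge0.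
move=> h1 h2; lra.
Qed.

Let mmass j : measurable_fun (@I01 R) (fun x => (mass x j)%:E).
Proof.
apply/measurable_EFinP; rewrite /mass; apply: measurable_funM; last exact: measurable_cst.
apply: measurable_funX; under eq_fun do rewrite ipC; exact: meI.
Qed.

Let integral_mass j : (\int[mu]_(x in I01) (mass x j)%:E = (ev j)%:E)%E.
Proof.
have -> : (\int[mu]_(x in I01) (mass x j)%:E =
    (ev j)^-1%:E * \int[mu]_(x in I01) (e (hh j) x ^+ 2)%:E)%E.
  rewrite -ge0_integralZl//.
  - by apply: eq_integral => x _; rewrite -EFinM mulrC /mass ipC.
  - exact: measurable_I01.
  - by apply/measurable_EFinP; exact: (measurable_funX _ (meI _)).
  - by move=> x _; rewrite lee_fin sqr_ge0.
  - by rewrite lee_fin invr_ge0.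
rewrite -L2_ip_sqr// q_hh// L2_ipC -hhP ip_hh eqxx mul1r -EFinM.
have [->|j0] := eqVneq (ev j) 0; first by rewrite mul0r mulr0.
by rewrite mulKf.
Qed.

Let diag x := (`|feature x| ^+ 2)%:E.

Let mdiag : measurable_fun [set: R] diag.
Proof.
apply/measurable_EFinP; have := measurable_feature_diag H Kmeas.
by under eq_fun do rewrite rkhs_ip_norm.
Qed.

Let diag_le_mass : {ae mu, forall x, I01 x -> (diag x <= \sum_(0 <= j <oo) (mass x j)%:E)%E}.
Proof.
have [N [mN N0 sub]] := feature_orth; exists N; split => // x /= nx; apply: sub => /= fx.
apply: nx => Ix; apply/lee_addgt0Pr => d d0.
pose d' := Num.min d 1; have d'0 : 0 < d' by rewrite lt_min d0 ltr01.
have [k [c ck]] := orth_compl2 (fx Ix) d'0.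
have le : `|feature x| ^+ 2 <= \sum_(j < k) mass x j + d.
  have := mass_le c k x.
  have : `|feature x - \sum_(j < k) c j *: hh j| ^+ 2 <= d.
    have dd : d' <= d by rewrite ge_min lexx.
    have d1 : d' <= 1 by rewrite ge_min lexx orbT.
    by move: ck; set r := `| _ |; have := normr_ge0 (feature x - \sum_(j < k) c j *: hh j); rewrite -/r; nra.
  lra.
apply: (@le_trans _ _ ((\sum_(j < k) mass x j)%:E + d%:E)%E); first by rewrite -EFinD lee_fin.
rewrite leeD2r// -sumEFin -(big_mkord xpredT (fun j => (mass x j)%:E)).
by apply: nneseries_lim_ge => j _ _; rewrite lee_fin.
Qed.

(** Almost every feature vector lies in the closed span of the eigenfunctions, so
    its square norm is exhausted by the masses, which integrate to the
    eigenvalues. *)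
Lemma trace_le : (\int[mu]_(x in I01) diag x <= \sum_(0 <= j <oo) (ev j)%:E)%E.
Proof.
have -> : (\sum_(0 <= j <oo) (ev j)%:E = \int[mu]_(x in I01) \sum_(0 <= j <oo) (mass x j)%:E)%E.
  rewrite integral_nneseries//.
  - by apply: eq_eseriesr => j _; rewrite integral_mass.
  - exact: measurable_I01.
  - by move=> j x _; rewrite lee_fin.
apply: ae_ge0_le_integral.
- exact: measurable_I01.
- by move=> x _; rewrite lee_fin sqr_ge0.
- exact: measurable_funTS.
- by move=> x _; apply: nneseries_ge0 => j _ _; rewrite lee_fin.
- by apply: ge0_emeasurable_sum => [j x _ _|j _]; [rewrite lee_fin|exact: mmass].
- exact: diag_le_mass.
Qed.

Let trace_fin : (\int[mu]_(x in I01) diag x <= B%:E)%E.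
Proof.
apply: (@le_trans _ _ (\int[mu]_(x in @I01 R) (cst B%:E) x)%E).
  apply: ge0_le_integral => //.
  - exact: measurable_I01.
  - by move=> x _; rewrite lee_fin sqr_ge0.
  - exact: measurable_funTS.
  - by move=> x _; rewrite lee_fin; exact: BP.2.
by rewrite integral_cst ?[X in (_ * X)%E]lebesgue_I01 ?mule1//; exact: measurable_I01.
Qed.

Let trace_split k : (\int[mu]_(x in I01) diag x =
  \int[mu]_(x in I01) (`|feature x| ^+ 2 - \sum_(j < k) mass x j)%:E + (\sum_(j < k) ev j)%:E)%E.
Proof.
have -> : ((\sum_(j < k) ev j)%:E = \int[mu]_(x in I01) (\sum_(j < k) mass x j)%:E)%E.
  under [RHS]eq_integral do rewrite -sumEFin.
  rewrite ge0_integral_sum//.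
  - by rewrite -sumEFin; apply: eq_bigr => j _; rewrite integral_mass.
  - exact: measurable_I01.
  - by move=> j; exact: mmass.
  - by move=> j x _; rewrite lee_fin.
have msum : measurable_fun (@I01 R) (fun x => \sum_(j < k) mass x j).
  by apply: measurable_sum => j; apply/measurable_EFinP; exact: mmass.
rewrite -ge0_integralD//.
- by apply: eq_integral => x _; rewrite -EFinD subrK.
- exact: measurable_I01.
- by move=> x _; rewrite lee_fin subr_ge0 bessel_feature.
- apply/measurable_EFinP; apply: measurable_funB => //.
  by apply/measurable_EFinP; exact: measurable_funTS.
- by move=> x _; rewrite lee_fin sumr_ge0.
- exact/measurable_EFinP.
Qed.

Let eigenvalues_sum_le : (\sum_(0 <= j <oo) (ev j)%:E <= B%:E)%E.
Proof.
apply: lime_le; first by apply: is_cvg_nneseries => j _ _; rewrite lee_fin.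
apply: nearW => k; rewrite big_mkord sumEFin.
apply: le_trans trace_fin; rewrite (trace_split k) leeDr//.
by apply: integral_ge0 => x _; rewrite lee_fin subr_ge0 bessel_feature.
Qed.

Lemma eigenvalues_summable : (\sum_(0 <= j <oo) (ev j)%:E < +oo)%E.
Proof. by apply: le_lt_trans eigenvalues_sum_le _; rewrite ltry. Qed.

Hypothesis ev_anti : forall i j, (i <= j)%N -> ev j <= ev i.

(** Splitting off the eigendirections above the level t costs min(ev j, t) per
    eigenvalue, on average over the interval. *)
Lemma residual_trace t : 0 < t -> exists k (f : 'I_k -> H),
  (forall i j, ip (f i) (f j) = (i == j)%:R) /\
  ((k%:R * t)%:E + \int[mu]_(x in I01)
     (`|feature x| ^+ 2 - \sum_j ip (feature x) (f j) ^+ 2)%:E <=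
   \sum_(0 <= j <oo) (Num.min (ev j) t)%:E)%E.
Proof.
move=> t0.
have exk : exists k, ev k < t.
  apply: contrapT => /forallNP nk.
  have : forall m : nat, m%:R * t <= B.
    move=> m; rewrite -lee_fin; apply: le_trans eigenvalues_sum_le.
    apply: (@le_trans _ _ (\sum_(0 <= j < m) (ev j)%:E)%E).
      rewrite big_mkord sumEFin lee_fin mulr_natl -[m in leLHS]card_ord -sumr_const.
      by apply: ler_sum => j _; rewrite leNgt; apply/negP/nk.
    by apply: nneseries_lim_ge => j _ _; rewrite lee_fin.
  move=> /(_ (Num.bound (B / t))).
  rewrite -ler_pdivlMr// leNgt; apply/negP; rewrite negbK.
  by apply: archi_boundP; rewrite divr_ge0// ?(ltW BP.1)// ltW.
pose k := ex_minn exk.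
have [kt kmin] : ev k < t /\ forall j, (j < k)%N -> t <= ev j.
  rewrite /k; case: ex_minnP => m mt mmin; split => // j jm.
  by rewrite leNgt; apply: contraL jm => /mmin; rewrite -leqNgt.
pose f (i : 'I_k) := (Num.sqrt (ev i))^-1 *: hh i.
have evp (i : 'I_k) : 0 < ev i by apply: lt_le_trans (kmin i (ltn_ord i)).
have sqn (i : 'I_k) : Num.sqrt (ev i) != 0 by rewrite gt_eqF// sqrtr_gt0.
exists k, f; split.
  move=> i j; rewrite /f ipZl ipZr ip_hh.
  have [->|ij] := eqVneq i j; last by rewrite (_ : (_ == _) = false) ?mul0r ?mulr0//; exact/negbTE.
  rewrite eqxx mul1r -{3}(sqr_sqrtr (ltW (evp j))) expr2.
  by rewrite mulKf// mulVf.
have -> : (\int[mu]_(x in I01) (`|feature x| ^+ 2 - \sum_j ip (feature x) (f j) ^+ 2)%:E =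
   \int[mu]_(x in I01) (`|feature x| ^+ 2 - \sum_(j < k) mass x j)%:E)%E.
  apply: eq_integral => x _; congr (_ - _)%:E; apply: eq_bigr => j _.
  by rewrite /f ipZr exprMn exprVn sqr_sqrtr ?(ltW (evp j))// mulrC.
have fin : (\int[mu]_(x in I01) diag x)%E \is a fin_num.
  rewrite ge0_fin_numE; first by apply: le_lt_trans trace_fin _; rewrite ltry.
  by apply: integral_ge0 => x _; rewrite lee_fin sqr_ge0.
have tle := trace_le; move: fin tle; rewrite (trace_split k) (nneseries_split (0%N) k); last first.
  by move=> j _; rewrite lee_fin.
rewrite add0n big_mkord sumEFin => fin.
rewrite addeC leeD2lE// => resle.
rewrite (nneseries_split 0%N k); last first.
  by move=> j _; rewrite lee_fin le_min ev0 ltW.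
rewrite add0n; apply: leeD.
  rewrite big_mkord sumEFin lee_fin mulr_natl -[k in leLHS]card_ord -sumr_const.
  by apply: ler_sum => j _; rewrite le_min lexx kmin.
apply: le_trans resle _; apply: lee_lim.
- by apply: is_cvg_nneseries => j _ _; rewrite lee_fin.
- by apply: is_cvg_nneseries => j _ _; rewrite lee_fin le_min ev0 ltW.
- apply: nearW => m; rewrite big_nat [leRHS]big_nat.
  apply: lee_sum => j /andP[kj _]; rewrite lee_fin le_min lexx /=.
  by apply: ltW; apply: le_lt_trans kt; exact: ev_anti.
Qed.

End Spectrum.


(** * Independence of random vectors *)

Section Boxes.
Context {R : realType} {n : nat}.

Definition box (A : 'I_n -> set R) : set (n.-tuple R) := [set t | forall i, A i (tnth t i)].

Lemma measurable_box A : (forall i, measurable (A i)) -> measurable (box A).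
Proof.
move=> mA; have -> : box A = \bigcap_(i in [set: 'I_n]) ((@tnth n R)^~ i @^-1` A i).
  by apply/seteqP; split => t /= tA i => [_|]; exact: tA.
apply: fin_bigcap_measurable; first exact: finite_finset.
by move=> i _; rewrite -[X in measurable X]setTI; apply: measurable_tnth.
Qed.

(** Boxes generate the product sigma-algebra and are stable under intersection. *)
Lemma tuple_measure_unique (m1 m2 : {measure set (n.-tuple R) -> \bar R}) :
  (m1 setT < +oo)%E ->
  (forall A, (forall i, measurable (A i)) -> m1 (box A) = m2 (box A)) ->
  forall B, measurable B -> m1 B = m2 B.
Proof.
move=> m1oo m12 B mB.
pose G : set (set (n.-tuple R)) := [set C | exists2 A, (forall i, measurable (A i)) & C = box A].
have GT : G setT.
  by exists (fun=> setT); [move=> i; exact: measurableT|apply/seteqP; split].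
apply: (measure_unique G (fun=> setT)) => //.
- apply/seteqP; split.
    apply: smallest_sub; first exact: smallest_sigma_algebra.
    move=> C; rewrite -bigcup_seq /= => -[i _ [D mD <-]]; rewrite setTI.
    apply: sub_sigma_algebra; exists (fun j => if j == i then D else setT).
      by move=> j; case: ifP => _ //; exact: measurableT.
    apply/seteqP; split => t /=; first by move=> Dt j; case: eqP => // ->.
    by move=> /(_ i); rewrite eqxx.
  apply: smallest_sub; first exact: sigma_algebra_measurable.
  by move=> _ [A mA ->]; exact: measurable_box.
- move=> _ _ [A mA ->] [A' mA' ->]; exists (fun i => A i `&` A' i).
    by move=> i; exact: measurableI.
  apply/seteqP; split => t /=; first by move=> [tA tA'] i; split.
  by move=> tAA'; split => i; have [] := tAA' i.
- by rewrite bigcup_const.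
- by move=> _ [A mA ->]; exact: m12.
Qed.

End Boxes.

Section Independence.
Context {R : realType} {d : measure_display} {Omega : measurableType d}
  (P : probability Omega R).

Definition indep_maps d1 d2 (T1 : measurableType d1) (T2 : measurableType d2)
    (U : Omega -> T1) (V : Omega -> T2) : Prop :=
  forall A B, measurable A -> measurable B ->
    P (U @^-1` A `&` V @^-1` B) = (P (U @^-1` A) * P (V @^-1` B))%E.

(** The joint law is the product of the marginal laws, so this is Tonelli's
    theorem carried back to the probability space. *)
Lemma indep_expectation d1 d2 (T1 : measurableType d1) (T2 : measurableType d2)
    (U : {mfun Omega >-> T1}) (V : {mfun Omega >-> T2}) (F : T1 * T2 -> \bar R) :
  indep_maps U V -> measurable_fun [set: T1 * T2] F -> (forall p, 0 <= F p)%E ->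
  (\int[P]_w F (U w, V w) = \int[P]_w \int[P]_w' F (U w, V w'))%E.
Proof.
move=> UV mF F0.
have mUV : measurable_fun [set: Omega] (fun w => (U w, V w)).
  by apply/measurable_fun_pair; exact: measurable_funP.
pose W : {mfun Omega >-> (T1 * T2)%type} := HB.pack (fun w => (U w, V w))
  (isMeasurableFun.Build _ _ _ _ _ mUV).
transitivity (\int[distribution P W]_p F p)%E; first by rewrite ge0_integral_distribution.
transitivity (\int[distribution P U \x distribution P V]_p F p)%E.
  apply: eq_measure_integral => C mC _ /=; apply/esym.
  exact: (@product_measure_unique _ _ _ _ _ (distribution P U) (distribution P V) (distribution P W)).
rewrite fubini_tonelli1// ge0_integral_distribution//.
- apply: eq_integral => w _ /=.
  by rewrite /fubini_F ge0_integral_distribution//; exact: measurableT_comp.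
- by apply: measurable_fun_fubini_tonelli_F.
- by move=> x; apply: integral_ge0.
Qed.

(** Both sides are finite measures in B that agree on boxes. *)
Lemma indep_event_vector n (U : {mfun Omega >-> n.-tuple R}) (D : set Omega) :
  measurable D ->
  (forall A : 'I_n -> set R, (forall i, measurable (A i)) ->
     P (U @^-1` box A `&` D) = (P (U @^-1` box A) * P D)%E) ->
  forall B, measurable B -> P (U @^-1` B `&` D) = (P (U @^-1` B) * P D)%E.
Proof.
move=> mD boxD B mB.
have PDfin : P D \is a fin_num by exact: fin_num_measure.
pose r := NngNum (fine_ge0 (measure_ge0 P D)).
have -> : (P (U @^-1` B) * P D)%E = mscale r (distribution P U) B.
  by rewrite /mscale /= muleC fineK.
have mU : measurable_fun [set: Omega] U by exact: measurable_funP.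
have [Q QE] : exists Q : {measure set (n.-tuple R) -> \bar R},
    Q = pushforward (mrestr P mD) U :> (set _ -> \bar R).
  by unshelve eexists (pushforward (mrestr P mD) U : {measure set (n.-tuple R) -> \bar R}).
transitivity (Q B); first by rewrite QE.
apply: tuple_measure_unique => //.
  rewrite QE /pushforward /mrestr preimage_setT setTI.
  by apply: le_lt_trans (probability_le1 _ _) _; rewrite ?ltry.
move=> A mA; rewrite QE; transitivity (P (U @^-1` box A) * P D)%E; first exact: boxD.
by rewrite /= /mscale /= muleC fineK.
Qed.

Definition random_vector n (X : 'I_n -> {RV P >-> R}) (w : Omega) : n.-tuple R :=
  [tuple X i w | i < n].

Lemma measurable_random_vector n (X : 'I_n -> {RV P >-> R}) :
  measurable_fun [set: Omega] (random_vector X).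
Proof.
apply/measurable_fun_tnthP => i.
by apply: (eq_measurable_fun (X i)) => [w _|//]; rewrite /= tnth_mktuple.
Qed.

HB.instance Definition _ n (X : 'I_n -> {RV P >-> R}) :=
  isMeasurableFun.Build _ _ _ _ (random_vector X) (measurable_random_vector X).

Lemma random_vector_box n (X : 'I_n -> {RV P >-> R}) (A : 'I_n -> set R) :
  random_vector X @^-1` box A = \bigcap_(i in [set: 'I_n]) (X i @^-1` A i).
Proof.
by apply/seteqP; split => w /= wA i => [_|]; have := wA i; rewrite ?tnth_mktuple//; apply.
Qed.

Section TwoVectors.
Context {n : nat} (X Z : 'I_n -> {RV P >-> R}).
Hypothesis indep : mutually_independent (fun s : 'I_n + 'I_n =>
  match s with inl i => X i | inr i => Z i end).

Let box_rule (A B : 'I_n -> set R) : (forall i, measurable (A i)) ->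
  (forall i, measurable (B i)) ->
  P (random_vector X @^-1` box A `&` random_vector Z @^-1` box B) =
  (\prod_i P (X i @^-1` A i) * \prod_i P (Z i @^-1` B i))%E.
Proof.
move=> mA mB.
have := indep (A := fun s => match s with inl i => A i | inr i => B i end).
rewrite big_sumType /= => <-; last by case.
congr (P _); rewrite !random_vector_box; apply/seteqP; split => w /=.
  by move=> [wA wB] [i|i] _; [exact: wA|exact: wB].
by move=> wAB; split => i _; [exact: (wAB (inl i))|exact: (wAB (inr i))].
Qed.

Let boxT : box (fun _ : 'I_n => [set: R]) = setT.
Proof. by apply/seteqP; split. Qed.

Let prodT (Y : 'I_n -> {RV P >-> R}) : (\prod_i P (Y i @^-1` [set: R]) = 1)%E.
Proof. by rewrite big1// => i _; rewrite preimage_setT probability_setT. Qed.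

Let design_rule A : (forall i, measurable (A i)) ->
  P (random_vector X @^-1` box A) = (\prod_i P (X i @^-1` A i))%E.
Proof.
move=> mA; have := box_rule mA (fun=> measurableT).
by rewrite boxT preimage_setT setIT prodT mule1.
Qed.

Let noise_rule B : (forall i, measurable (B i)) ->
  P (random_vector Z @^-1` box B) = (\prod_i P (Z i @^-1` B i))%E.
Proof.
move=> mB; have := box_rule (fun=> measurableT) mB.
by rewrite boxT preimage_setT setTI prodT mul1e.
Qed.

(** The product rule extends from boxes to events in one vector at a time, first
    in the design and then in the noise. *)
Lemma indep_design_noise : indep_maps (random_vector X) (random_vector Z).
Proof.
move=> A B mA mB; rewrite setIC muleC; have mX := @measurable_funPTI _ _ _ _ (random_vector X).
apply: indep_event_vector => //; first by apply: mX.
move=> C mC; rewrite setIC muleC.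
apply: indep_event_vector => //.
  by rewrite -[X in measurable X]setTI; apply: measurable_random_vector => //; exact: measurable_box.
by move=> D mD; rewrite box_rule// design_rule// noise_rule.
Qed.

Lemma indep_noise_pair i j : i != j -> indep_maps (Z i) (Z j).
Proof.
move=> ij A B mA mB.
pose C k := if k == i then A else if k == j then B else setT.
have mC k : measurable (C k) by rewrite /C; case: ifP => // _; case: ifP.
have := noise_rule mC; rewrite random_vector_box (bigD1 i)//= (bigD1 j) 1?eq_sym//=.
rewrite big1 ?mule1; last first.
  move=> k /andP[/negbTE ki /negbTE kj].
  by rewrite /C ki kj preimage_setT probability_setT.
rewrite /C eqxx eq_sym (negbTE ij) eqxx => <-; congr (P _).
apply/seteqP; split => w /=.
  by move=> [wA wB] k _; rewrite /C; case: eqP => [->//|_]; case: eqP => [->//|].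
move=> wC; split; first by have := wC i I; rewrite eqxx.
by have := wC j I; rewrite eq_sym (negbTE ij) eqxx.
Qed.

End TwoVectors.

Section Laws.
Variable Y : {RV P >-> R}.
Local Notation N01 := (normal_prob (0 : R) 1).

Lemma integral_law (nu : {measure set (measurableTypeR R) -> \bar R}) (f : R -> \bar R) :
  (forall A, measurable A -> distribution P Y A = nu A) ->
  measurable_fun [set: R] f -> (forall x, 0 <= f x)%E ->
  (\int[P]_w f (Y w) = \int[nu]_x f x)%E.
Proof.
move=> law mf f0.
have mY : measurable_fun [set: Omega] (Y : Omega -> measurableTypeR R).
  have YP : measurable_fun [set: Omega] Y by exact: measurable_funP.
  by move=> _ A mA; exact: (YP measurableT A mA).
pose Y' : {mfun Omega >-> measurableTypeR R} := HB.pack (Y : Omega -> measurableTypeR R)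
  (isMeasurableFun.Build _ _ _ (measurableTypeR R) _ mY).
transitivity (\int[distribution P Y']_x f x)%E.
  by rewrite ge0_integral_distribution.
by apply: eq_measure_integral => A mA _; exact: law.
Qed.

Hypothesis normal : forall A, measurable A -> distribution P Y A = N01 A.

(** An arbitrary shift allows one variable of an independent pair to be
    integrated out with the other held fixed. *)
Lemma normal_sqr_shift (c : R) : (\int[P]_w ((c + Y w) ^+ 2)%:E = (c ^+ 2 + 1)%:E)%E.
Proof.
rewrite (@integral_law (normal_prob 0 1) (fun x => ((c + x) ^+ 2)%:E) normal)//.
- have [_] := normal_quartic (c ^+ 2) (2 * c) 1 0 0.
  rewrite mulr0 addr0 => <-; apply: eq_integral => z _; congr EFin; ring.
- by apply/measurable_EFinP; apply: measurable_funX; exact: measurable_funD.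
- by move=> x; rewrite lee_fin sqr_ge0.
Qed.

Lemma normal_sqr_integrable : P.-integrable [set: Omega] (fun w => (Y w ^+ 2)%:E).
Proof.
apply/integrableP; split; first by apply/measurable_EFinP; exact: measurable_funX.
have := normal_sqr_shift 0.
under eq_integral do rewrite add0r.
rewrite expr0n /= add0r => Y2.
under eq_integral do rewrite /= ger0_norm ?sqr_ge0//.
by rewrite Y2 ltry.
Qed.

End Laws.

Section NoiseForms.
Context {n : nat} (X Z : 'I_n -> {RV P >-> R}).
Hypothesis indep : mutually_independent (fun s : 'I_n + 'I_n =>
  match s with inl i => X i | inr i => Z i end).
Hypothesis normal : forall i (A : set R), measurable A ->
  distribution P (Z i) A = normal_prob 0 1 A.

Let noise_prod_integrable i j : P.-integrable [set: Omega] (fun w => (Z i w * Z j w)%:E).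
Proof.
apply: (@le_integrable _ _ _ P setT _ _ (fun w => (Z i w ^+ 2 + Z j w ^+ 2)%:E)) => //.
- by apply/measurable_EFinP; exact: measurable_funM.
- move=> w _; rewrite /= lee_fin normrM [leRHS]ger0_norm ?addr_ge0 ?sqr_ge0//.
  have := sqr_ge0 (`|Z i w| - `|Z j w|).
  rewrite -(real_normK (num_real (Z i w))) -(real_normK (num_real (Z j w))).
  have := sqr_ge0 `|Z i w|; have := sqr_ge0 `|Z j w|.
  move: `|Z i w| `|Z j w| => a b; nra.
- under eq_fun do rewrite EFinD.
  by apply: integrableD => //; exact: (normal_sqr_integrable (normal _)).
Qed.

Let noise_prod_mean i j : (\int[P]_w (Z i w * Z j w)%:E = (i == j)%:R%:E)%E.
Proof.
have sqr1 k : (\int[P]_w (Z k w ^+ 2)%:E = 1)%E.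
  have := normal_sqr_shift (normal k) 0; rewrite expr0n /= add0r => <-.
  by apply: eq_integral => w _; rewrite add0r.
have [->|ij] := eqVneq i j.
  by rewrite /= -(sqr1 j); apply: eq_integral => w _; rewrite expr2.
have sum2 : (\int[P]_w ((Z i w + Z j w) ^+ 2)%:E = 2%:E)%E.
  rewrite (@indep_expectation _ _ _ _ (Z i) (Z j) (fun p => ((p.1 + p.2) ^+ 2)%:E)).
  - under eq_integral do rewrite /= (normal_sqr_shift (normal j)).
    under eq_integral do rewrite EFinD.
    rewrite ge0_integralD//.
    + by rewrite sqr1 integral_cst//= probability_setT mule1.
    + by move=> w _; rewrite lee_fin sqr_ge0.
    + by apply/measurable_EFinP; exact: measurable_funX.
  - exact: (indep_noise_pair indep ij).
  - by apply/measurable_EFinP; apply: measurable_funX; exact: measurable_funD.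
  - by move=> p; rewrite lee_fin sqr_ge0.
have iP := noise_prod_integrable i j.
have : (\int[P]_w ((Z i w + Z j w) ^+ 2)%:E =
    \int[P]_w (Z i w ^+ 2)%:E + \int[P]_w (Z j w ^+ 2)%:E +
    2%:E * \int[P]_w (Z i w * Z j w)%:E)%E.
  rewrite -integralZl//.
  rewrite -integralD//; try exact: (normal_sqr_integrable (normal _)).
  rewrite -integralD//.
  - by apply: eq_integral => w _; rewrite -EFinM -!EFinD; congr EFin; ring.
  - by apply: integrableD => //; exact: (normal_sqr_integrable (normal _)).
  - exact: integrableZl.
rewrite sum2 !sqr1; have : (\int[P]_w (Z i w * Z j w)%:E \is a fin_num)%E.
  exact: integrable_fin_num.
case: (\int[P]_w (Z i w * Z j w)%:E)%E => //= v _ [h].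
by congr EFin; lra.
Qed.

(** The noise is uncorrelated, so only the diagonal of the form survives. *)
Lemma noise_quadform_mean (A : 'I_n -> 'I_n -> R) :
  (\int[P]_w (\sum_i \sum_j A i j * Z i w * Z j w)%:E = (\sum_i A i i)%:E)%E.
Proof.
have iA i j : P.-integrable [set: Omega] (fun w => (A i j * Z i w * Z j w)%:E).
  under eq_fun do rewrite -mulrA EFinM.
  by apply: integrableZl => //; exact: noise_prod_integrable.
under eq_integral do rewrite -sumEFin.
rewrite integral_sum//; last first.
  by move=> i; under eq_fun do rewrite -sumEFin; exact: integrable_sum.
rewrite -sumEFin; apply: eq_bigr => i _.
under eq_integral do rewrite -sumEFin.
rewrite integral_sum// (bigD1 i)//= big1 ?adde0 => [|j ji].
  under eq_integral do rewrite -mulrA EFinM.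
  by rewrite integralZl ?noise_prod_mean ?eqxx ?mule1//; exact: noise_prod_integrable.
under eq_integral do rewrite -mulrA EFinM.
by rewrite integralZl// noise_prod_mean eq_sym (negbTE ji) mule0.
Qed.

End NoiseForms.
End Independence.

(** * Expected energies over a random design *)

Section MeasurableMatrix.
Context {R : realType} {d : measure_display} {T : measurableType d}.

Lemma measurable_det m (M : T -> 'M[R]_m) :
  (forall i j, measurable_fun [set: T] (fun x => M x i j)) ->
  measurable_fun [set: T] (fun x => \det (M x)).
Proof.
move=> mM; rewrite /determinant; apply: measurable_sum => s.
apply: measurable_funM; first exact: measurable_cst.
by apply: measurable_prod => i _; exact: mM.
Qed.

(** Cramer's rule makes the entries of the inverse rational in those of the
    matrix. *)
Lemma measurable_invmx m (M : T -> 'M[R]_m) :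
  (forall x, M x \in unitmx) ->
  (forall i j, measurable_fun [set: T] (fun x => M x i j)) ->
  forall i j, measurable_fun [set: T] (fun x => invmx (M x) i j).
Proof.
move=> uM mM i j.
have -> : (fun x => invmx (M x) i j) = (fun x => (\det (M x))^-1 * cofactor (M x) j i).
  by apply/funext => x; rewrite /invmx uM !mxE.
have mdet := measurable_det mM.
apply: measurable_funM.
  have -> : (fun x => (\det (M x))^-1) =
      (fun x => \det (M x) * (\det (M x) ^+ 2) `^ (-1)).
    apply/funext => x; rewrite powR_inv1 ?sqr_ge0// expr2 invfM.
    by have [->|d0] := eqVneq (\det (M x)) 0; rewrite ?mul0r ?invr0// mulVKf.
  apply: measurable_funM => //.
  have m2 : measurable_fun [set: T] (fun x => \det (M x) ^+ 2) by exact: measurable_funX.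
  exact: (measurableT_comp (@measurable_powR R (-1)) m2).
rewrite /cofactor; apply: measurable_funM; first exact: measurable_cst.
apply: measurable_det => k l.
by under eq_fun do rewrite !mxE; exact: mM.
Qed.

End MeasurableMatrix.

Section RandomDesign.
Context {R : realType} {K : R -> R -> R} (H : rkhs K) {n : nat} (n0 : (0 < n)%N).
Hypothesis Kmeas : jointly_measurable K.
Local Notation ip := (@rkhs_ip R K H).
Local Notation mu := (@lebesgue_measure R).

Definition design_features (x : n.-tuple R) (i : 'I_n) : H := feature H (tnth x i).

Lemma measurable_smoother t : 0 < t -> forall i j,
  measurable_fun [set: n.-tuple R] (fun x => smoother (design_features x) t i j).
Proof.
move=> t0 i j.
have mG k l : measurable_fun [set: n.-tuple R] (fun x => gram (design_features x) k l).
  under eq_fun do rewrite mxE.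
  have mp : measurable_fun [set: n.-tuple R] (fun x => (tnth x k, tnth x l)).
    by apply/measurable_fun_pair; exact: measurable_tnth.
  exact: (measurableT_comp (measurable_feature2 H Kmeas) mp).
under eq_fun do rewrite !mxE.
apply: measurable_funM; first exact: measurable_cst.
apply: measurable_sum => k; apply: measurable_funM; first exact: mG.
apply: measurable_invmx => [x|l m]; first exact: ridge_mx_unit.
under eq_fun do rewrite mxE.
apply: measurable_funD; first exact: mG.
by under eq_fun do rewrite mxE; exact: measurable_cst.
Qed.

Lemma measurable_eff_dim t : 0 < t ->
  measurable_fun [set: n.-tuple R] (fun x => eff_dim (design_features x) t).
Proof. by move=> t0; apply: measurable_sum => i; exact: measurable_smoother. Qed.

Section Expectations.
Context {d : measure_display} {Omega : measurableType d} {P : probability Omega R}.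
Variables (X Z : 'I_n -> {RV P >-> R}).
Local Notation XX := (random_vector X).
Local Notation ZZ := (random_vector Z).

Section Energy.
Hypothesis indep : mutually_independent (fun s : 'I_n + 'I_n =>
  match s with inl i => X i | inr i => Z i end).
Hypothesis normal : forall i (A : set R), measurable A ->
  distribution P (Z i) A = normal_prob 0 1 A.

(** By independence the noise can be integrated out with the design held fixed,
    which leaves the trace of the smoother; an event of the design factors out. *)
Lemma ridge_energy_mean (V : set (n.-tuple R)) t : measurable V -> 0 < t ->
  (\int[P]_w (\1_V (XX w) * ridge_energy (design_features (XX w)) t (fun i => Z i w))%:E =
   \int[P]_w (\1_V (XX w) * eff_dim (design_features (XX w)) t)%:E)%E.
Proof.
move=> mV t0.
pose F (p : n.-tuple R * n.-tuple R) : \bar R :=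
  (\1_V p.1 * ridge_energy (design_features p.1) t (tnth p.2))%:E.
have mF : measurable_fun setT F.
  apply/measurable_EFinP; apply: measurable_funM.
    by apply: (measurableT_comp (measurable_indic _)).
  apply: measurable_sum => i; apply: measurable_sum => j.
  apply: measurable_funM; last exact: (measurableT_comp (measurable_tnth j)).
  apply: measurable_funM; last exact: (measurableT_comp (measurable_tnth i)).
  exact: (measurableT_comp (measurable_smoother t0 i j)).
have F0 p : (0 <= F p)%E.
  by rewrite lee_fin mulr_ge0 ?ridge_energy_ge0// indicE ler0n.
have := indep_expectation (indep_design_noise indep) mF F0.
rewrite /F /= => h.
transitivity (\int[P]_w (\1_V (XX w) *
    ridge_energy (design_features (XX w)) t (tnth (ZZ w)))%:E)%E.
  apply: eq_integral => w _; congr (_ * _)%:E.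
  by apply: eq_bigr => i _; apply: eq_bigr => j _; rewrite !tnth_mktuple.
rewrite h; apply: eq_integral => w _.
under eq_integral do rewrite EFinM.
rewrite ge0_integralZl//.
- rewrite EFinM; congr (_ * _)%E.
  rewrite -[RHS](noise_quadform_mean indep normal (smoother (design_features (XX w)) t)).
  apply: eq_integral => w' _; congr EFin.
  by apply: eq_bigr => i _; apply: eq_bigr => j _; rewrite !tnth_mktuple.
- apply/measurable_EFinP; apply: measurable_sum => i; apply: measurable_sum => j.
  under eq_fun do rewrite !tnth_mktuple.
  by apply: measurable_funM => //; apply: measurable_funM.
- by move=> w' _; rewrite lee_fin ridge_energy_ge0.
Qed.

End Energy.

Lemma bessel k (e : 'I_k -> H) v : (forall i j, ip (e i) (e j) = (i == j)%:R) ->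
  \sum_j ip v (e j) ^+ 2 <= `|v| ^+ 2.
Proof.
move=> ee; pose p := \sum_j ip v (e j) *: e j.
have pe j : ip p (e j) = ip v (e j).
  rewrite /p ip_suml (bigD1 j)//= ipZl ee eqxx mulr1 big1 ?addr0//.
  by move=> l /negbTE lj; rewrite ipZl ee lj mulr0.
have pp u : ip u p = \sum_j ip v (e j) * ip u (e j).
  by rewrite /p ip_sumr; apply: eq_bigr => j _; rewrite ipZr.
have vp : ip v p = \sum_j ip v (e j) ^+ 2.
  by rewrite pp; apply: eq_bigr => j _; rewrite expr2.
have pv : ip p p = \sum_j ip v (e j) ^+ 2.
  by rewrite pp; apply: eq_bigr => j _; rewrite pe expr2.
have := ip_amgm v p; rewrite !vp -!rkhs_ip_norm pv.
lra.
Qed.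

Hypothesis unif : forall i (A : set R), measurable A ->
  distribution P (X i) A = uniform_prob (@ltr01 R) A.

Lemma uniform_mean i (f : R -> \bar R) : measurable_fun [set: R] f ->
  (forall x, 0 <= f x)%E -> (\int[P]_w f (X i w) = \int[mu]_(x in I01) f x)%E.
Proof.
move=> mf f0; rewrite (@integral_law _ _ _ _ _ (uniform_prob (@ltr01 R)) _ (unif i))//.
by rewrite integral_uniform// subr0 invr1 mul1e.
Qed.

Lemma design_in_I01 : {ae P, forall w, forall i, I01 (X i w)}.
Proof.
have mI : measurable (~` (@I01 R)) by apply: measurableC; exact: measurable_I01.
apply: filter_forall => i.
exists (X i @^-1` ~` I01); split => //.
  by rewrite -[X in measurable X]setTI; apply: measurable_funP.
apply: etrans (unif i mI) _.
by rewrite /uniform_prob integral_uniform_pdf /I01 setICl integral_set0.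
Qed.

(** A finite-dimensional approximation of the kernel sections bounds the
    effective dimension; with the leading eigenvectors it balances rank against
    residual trace. *)
Lemma eff_dim_mean k (e : 'I_k -> H) t : 0 < t ->
  (forall i j, ip (e i) (e j) = (i == j)%:R) ->
  (t%:E * \int[P]_w (eff_dim (design_features (XX w)) t)%:E <=
   n%:R^-1%:E * ((k%:R * t)%:E + \int[mu]_(x in I01)
      (`|feature H x| ^+ 2 - \sum_j ip (feature H x) (e j) ^+ 2)%:E))%E.
Proof.
move=> t0 ee.
pose res x := `|feature H x| ^+ 2 - \sum_j ip (feature H x) (e j) ^+ 2.
have res0 x : 0 <= res x by rewrite subr_ge0 bessel.
have mres : measurable_fun [set: R] (EFin \o res).
  apply/measurable_EFinP; apply: measurable_funB.
    by under eq_fun do rewrite -rkhs_ip_norm; exact: measurable_feature_diag.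
  apply: measurable_sum => j; apply: measurable_funX.
  by under eq_fun do rewrite ipC; exact: measurable_eval.
have nR : (0 < n%:R :> R) by rewrite ltr0n.
have mX i : measurable_fun [set: Omega] (fun w => (res (X i w))%:E).
  exact: (measurableT_comp mres).
rewrite -ge0_integralZl//; last 3 first.
- apply/measurable_EFinP.
  by apply: (measurableT_comp (measurable_eff_dim t0)) => //; exact: measurable_random_vector.
- by move=> w _; rewrite lee_fin eff_dim_ge0.
- by rewrite lee_fin ltW.
apply: (@le_trans _ _ (\int[P]_w ((n%:R^-1 * (k%:R * t))%:E +
    (n%:R^-1 ^+ 2)%:E * \sum_i (res (X i w))%:E))%E).
  apply: ge0_le_integral_nonmeas => w.
    by rewrite -EFinM lee_fin mulr_ge0 ?eff_dim_ge0// ltW.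
  rewrite sumEFin -!EFinM -EFinD lee_fin.
  have := eff_dim_rank (design_features (XX w)) n0 t0 ee.
  have -> : \sum_i (`|design_features (XX w) i| ^+ 2 -
      \sum_j ip (design_features (XX w) i) (e j) ^+ 2) = \sum_i res (X i w).
    by apply: eq_bigr => i _; rewrite /design_features tnth_mktuple.
  set D := eff_dim _ _; set S := \sum_i _ => h.
  have /ler_wpM2l/(_ _ _ h) : 0 <= t / n%:R by rewrite divr_ge0 ?ltW.
  rewrite mulrA mulfVK ?gt_eqF// => /le_trans; apply.
  rewrite le_eqVlt; apply/orP; left; apply/eqP; field.
  by rewrite !gt_eqF.
rewrite ge0_integralD//; last 3 first.
- by move=> w _; rewrite lee_fin !mulr_ge0 ?invr_ge0 ?(ltW t0)// ltW.
- move=> w _; rewrite mule_ge0 ?lee_fin ?sqr_ge0// sume_ge0// => i _.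
  by rewrite lee_fin.
- by apply: measurable_funeM; apply: emeasurable_sum => i; exact: mX.
rewrite integral_cst//= probability_setT mule1 ge0_integralZl//; last 2 first.
- by apply: emeasurable_sum => i; exact: mX.
- by move=> w _; rewrite sume_ge0// => i _; rewrite lee_fin.
rewrite ge0_integral_sum//; last by move=> i w _; rewrite lee_fin.
have -> : (\sum_i \int[P]_w (res (X i w))%:E =
    n%:R%:E * \int[mu]_(x in I01) (res x)%:E)%E.
  under eq_bigr do rewrite (uniform_mean _ mres)//.
  transitivity (\sum_(i < n) (1%:E * \int[mu]_(x in I01) (res x)%:E))%E.
    by apply: eq_bigr => i _; rewrite mul1e.
  by rewrite -ge0_sume_distrl// sumEFin sumr_const card_ord.
have I0 : (0 <= \int[mu]_(x in I01) (res x)%:E)%E.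
  by apply: integral_ge0 => x _; rewrite lee_fin.
move: I0.
rewrite (_ : (\int[mu]_(x in I01) (`|feature H x| ^+ 2 -
    \sum_j ip (feature H x) (e j) ^+ 2)%:E) = \int[mu]_(x in I01) (res x)%:E)%E//.
move: (\int[mu]_(x in I01) (res x)%:E)%E => I I0.
rewrite ge0_muleDr//; last by rewrite lee_fin mulr_ge0// ltW.
rewrite -EFinM; apply: leeD2l; rewrite muleA -EFinM expr2 -mulrA mulVf ?mulr1//.
by rewrite gt_eqF.
Qed.

End Expectations.
End RandomDesign.

(** * The oracle inequality at a fixed design and noise *)

Section Oracle.
Context {R : realType} {K : R -> R -> R} (H : rkhs K) {n : nat} (n0 : (0 < n)%N).
Local Notation ip := (@rkhs_ip R K H).
Variables (x : 'I_n -> R) (xI : forall i, I01 (x i)) (f : R -> R) (z : 'I_n -> R).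
Variables (lam : R) (ghat : H).
Implicit Types (g : H) (r : R).
Hypothesis ghat_min : krr_minimizer x (fun i => f (x i) + z i) lam ghat.
Let kv i := rkhs_section H (x i).

Lemma emp_loss_ge0 g : 0 <= emp_loss f x g :> R.
Proof. by rewrite sqr_ge0. Qed.

Lemma best_emp_loss_ge0 r : 0 <= best_emp_loss H f x r.
Proof.
rewrite /best_emp_loss; have [->|/set0P S0] :=
  eqVneq [set emp_loss f x g | g in [set g : H | `|g| <= r]] set0; first by rewrite inf0.
by apply: lb_le_inf => // _ [g _ <-]; exact: emp_loss_ge0.
Qed.

Lemma best_emp_loss_le r g : `|g| <= r -> best_emp_loss H f x r <= emp_loss f x g.
Proof.
move=> gr; apply: ge_inf; last by exists g.
by exists 0 => _ [h _ <-]; exact: emp_loss_ge0.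
Qed.

(** The minimizing property turns the loss into that of g plus the correlation of
    the noise with ghat - g. The energy at penalty t, tested with a quarter of
    ghat - g, bounds the correlation by the energy of the noise, half of the loss
    and a penalty term that t <= 4 * lam lets the objective absorb. *)
Lemma oracle_pointwise t g r : 0 < t -> t <= 4 * lam -> `|g| <= r ->
  emp_loss f x ghat <= 3 * emp_loss f x g + 8 * lam * r ^+ 2 + 8 * ridge_energy kv t z.
Proof.
move=> t0 tl gr; have lam0 : 0 < lam by lra.
pose u := ghat - g.
pose a i := f (x i) - vals kv g i.
pose v := vals kv u.
have vE i : v i = vals kv ghat i - vals kv g i by rewrite /v /u /vals ipBl.
have aE h : emp_loss f x h = emp_ip (fun i => f (x i) - vals kv h i)
    (fun i => f (x i) - vals kv h i).
  by rewrite /emp_loss emp_norm_sqr (at_designE xI).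
have eE : (fun i => f (x i) - vals kv ghat i) = (fun i => a i - v i).
  by apply/funext => i; rewrite /a vE; ring.
have := ghat_min g; rewrite /krr_objective !emp_norm_sqr !(at_designE xI).
have -> : (fun i => f (x i) + z i - vals kv ghat i) = (fun i => (a i - v i) + z i).
  by apply/funext => i; rewrite /a vE; ring.
have -> : (fun i => f (x i) + z i - vals kv g i) = (fun i => a i + z i).
  by apply/funext => i; rewrite /a; ring.
rewrite !aE eE -/a.
have := ridge_energy_max kv n0 t0 z (4^-1 *: u).
have -> : vals kv (4^-1 *: u) = (fun i => 4^-1 * v i).
  by apply/funext => i; rewrite /vals ipZl.
have := emp_ip_ge0 (fun i => a i + (a i - v i)).
rewrite normrZ ger0_norm ?invr_ge0// exprMn; clearbody a v.
rewrite !(emp_ipBl, emp_ipBr, emp_ipDl, emp_ipDr, emp_ipZl, emp_ipZr) (emp_ipC z v) (emp_ipC z a) !(emp_ipC v a).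
have u2 : `|u| ^+ 2 <= 2 * `|ghat| ^+ 2 + 2 * `|g| ^+ 2.
  have := ip_ge0 (ghat + g); rewrite /u -!rkhs_ip_norm !(ipBl, ipBr, ipDl, ipDr) (ipC g ghat).
  lra.
have g2 : lam * `|g| ^+ 2 <= lam * r ^+ 2.
  by apply: ler_wpM2l; rewrite ?(ltW lam0)// ler_pXn2r ?nnegrE// (le_trans _ gr).
have tu : t * `|u| ^+ 2 <= 4 * lam * (2 * `|ghat| ^+ 2 + 2 * `|g| ^+ 2).
  apply: (@le_trans _ _ (4 * lam * `|u| ^+ 2)).
    by apply: ler_wpM2r => //; exact: sqr_ge0.
  by apply: ler_wpM2l => //; lra.
move: (emp_ip a a) (emp_ip a v) (emp_ip v v) (emp_ip z z) (emp_ip a z) (emp_ip v z).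
move=> aa av vv zz az vz.
have -> : t * (4^-1 ^+ 2 * `|u| ^+ 2) = t * `|u| ^+ 2 / 16 by field.
have -> : 8 * lam * r ^+ 2 = 8 * (lam * r ^+ 2) by ring.
have {}tu : t * `|u| ^+ 2 <= 8 * (lam * `|ghat| ^+ 2) + 8 * (lam * `|g| ^+ 2).
  by apply: le_trans tu _; rewrite le_eqVlt; apply/orP; left; apply/eqP; ring.
move: (lam * `|ghat| ^+ 2) (lam * `|g| ^+ 2) (lam * r ^+ 2) (t * `|u| ^+ 2) tu g2.
move=> lG0 lG1 lr tU tu g2.
lra.
Qed.

Lemma oracle_best t r : 0 < t -> t <= 4 * lam -> 0 < r ->
  emp_loss f x ghat <=
  3 * best_emp_loss H f x r + 8 * lam * r ^+ 2 + 8 * ridge_energy kv t z.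
Proof.
move=> t0 tl r0; rewrite -lerBlDr -lerBlDr -ler_pdivrMl//.
apply: lb_le_inf; first by exists (emp_loss f x (0 : H)), 0 => //=; rewrite normr0 ltW.
move=> _ [g /= gr <-]; rewrite ler_pdivrMl// lerBlDr lerBlDr.
exact: oracle_pointwise.
Qed.

(** Without features all elements of the space have the same values on the
    design. *)
Lemma oracle_degenerate r : 0 < r -> (forall i, kv i = 0) ->
  emp_loss f x ghat <= best_emp_loss H f x r.
Proof.
move=> r0 kv0; apply: lb_le_inf.
  by exists (emp_loss f x (0 : H)), 0 => //=; rewrite normr0 ltW.
move=> _ [g _ <-]; rewrite /emp_loss !(at_designE xI).
by rewrite (_ : vals _ ghat = vals (fun i => rkhs_section H (x i)) g)//;
  apply/funext => i; rewrite /vals -/(kv i) kv0 !ip0r.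
Qed.

End Oracle.

(** * The radius of the kernel complexity *)
Section Gamma.
Context {R : realType} (ev : nat -> R) (ev0 : forall j, 0 <= ev j).
Variables (n : nat) (n0 : (0 < n)%N).

Lemma solutionP (d : R) : 0 < d ->
  positive_solutions (kernel_complexity ev n) d <->
  (n%:R^-1%:E * \sum_(0 <= j <oo) (Num.min (ev j) (d ^+ 2))%:E <= (d ^+ 4 / 8)%:E)%E.
Proof.
move=> d0; have nR : 0 < n%:R :> R by rewrite ltr0n.
have nV : 0 < n%:R^-1 :> R by rewrite invr_gt0.
rewrite /positive_solutions /kernel_complexity /=.
have : (0 <= \sum_(0 <= j <oo) (Num.min (ev j) (d ^+ 2))%:E)%E.
  by apply: nneseries_ge0 => j _ _; rewrite lee_fin le_min ev0 sqr_ge0.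
case: (\sum_(0 <= j <oo) _)%E => [s| |]//; last first.
  move=> _; rewrite !gt0_muley ?lte_fin ?mulr_gt0//=.
  by split => [[_]|]; rewrite leye_eq.
rewrite lee_fin => s0; rewrite -!EFinM /= lee_fin.
have t0 : 0 <= 2 / n%:R * s by rewrite mulr_ge0// divr_ge0// ltW.
have -> : n%:R^-1 * s = (2 / n%:R * s) / 2 by field; rewrite gt_eqF.
move: (2 / n%:R * s) t0 => t t0.
have tE := sqr_sqrtr t0; have st := sqrtr_ge0 t.
move: (Num.sqrt t) tE st => q <- q0; rewrite lee_fin.
have -> : d ^+ 4 = (d ^+ 2) ^+ 2 by rewrite -exprM.
have d2 : 0 < d ^+ 2 by rewrite exprn_gt0.
move: (d ^+ 2) d2 => D D0.
split => [[_ h]|h]; first by nra.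
by split => //; nra.
Qed.

(** A summable spectrum keeps the complexity bounded while delta ^ 2 grows. *)
Lemma solutions_nonempty : (\sum_(0 <= j <oo) (ev j)%:E < +oo)%E ->
  exists d, positive_solutions (kernel_complexity ev n) d.
Proof.
move=> sumfin.
have S0 : (0 <= \sum_(0 <= j <oo) (ev j)%:E)%E.
  by apply: nneseries_ge0 => j _ _; rewrite lee_fin.
have [M ME] : exists M, (\sum_(0 <= j <oo) (ev j)%:E = M%:E)%E.
  exists (fine (\sum_(0 <= j <oo) (ev j)%:E)%E).
  by rewrite fineK// ge0_fin_numE.
have M0 : 0 <= M by rewrite -lee_fin -ME.
have d0 : 0 < 1 + 8 * M by lra.
exists (1 + 8 * M); apply/(solutionP d0).
apply: (@le_trans _ _ (n%:R^-1%:E * M%:E)%E).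
  apply: lee_wpmul2l; first by rewrite lee_fin invr_ge0.
  rewrite -ME; apply: lee_nneseries => j _; first by rewrite lee_fin le_min ev0 sqr_ge0.
  by rewrite lee_fin ge_min lexx.
rewrite -EFinM lee_fin.
have : n%:R^-1 * M <= M by rewrite ler_piMl// invf_le1 ?ler1n ?ltr0n.
have : 1 + 8 * M <= (1 + 8 * M) ^+ 4 by rewrite ler_eXnr//; lra.
lra.
Qed.

Lemma gamma_radius_ge0 : 0 <= gamma_radius ev n.
Proof.
rewrite /gamma_radius /smallest_positive_solution.
have [->|/set0P S0] := eqVneq (positive_solutions (kernel_complexity ev n)) set0.
  by rewrite inf0.
by apply: lb_le_inf => // d [d0 _]; exact: ltW.
Qed.

Lemma gamma_radius_le d : positive_solutions (kernel_complexity ev n) d ->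
  gamma_radius ev n <= d.
Proof.
by move=> Sd; apply: ge_inf => //; exists 0 => e [e0 _]; exact: ltW.
Qed.

(** The radius is an infimum of solutions, which may fail to be attained when it
    vanishes; bounds that are continuous in the solution pass to it. *)
Lemma le_gamma_radius (a : \bar R) (b : \bar R) (c : R) :
  (\sum_(0 <= j <oo) (ev j)%:E < +oo)%E -> 0 < c ->
  (forall d, positive_solutions (kernel_complexity ev n) d ->
     (a <= (c * d ^+ 2)%:E + b)%E) ->
  (a <= (c * gamma_radius ev n ^+ 2)%:E + b)%E.
Proof.
move=> sumfin c0 ab; apply/lee_addgt0Pr => e e0.
set g := gamma_radius ev n; have g0 : 0 <= g := gamma_radius_ge0.
have ec : 0 < e / c by rewrite divr_gt0.
pose h := Num.sqrt (g ^+ 2 + e / c).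
have h2 : h ^+ 2 = g ^+ 2 + e / c by rewrite sqr_sqrtr// addr_ge0 ?sqr_ge0// ltW.
have gh : g < h.
  by rewrite -(@ltr_pXn2r _ 2) ?nnegrE ?sqrtr_ge0// h2 ltrDl.
have hinf : has_inf (positive_solutions (kernel_complexity ev n)).
  split; first exact: solutions_nonempty.
  by exists 0 => d [d0 _]; exact: ltW.
have hg : 0 < h - g by rewrite subr_gt0.
have [d dS] := inf_adherent hg hinf.
rewrite -/(smallest_positive_solution _) -/(gamma_radius ev n) -/g addrC subrK => dh.
apply: le_trans (ab d dS) _; rewrite addeAC -EFinD; apply: leeD2r.
rewrite lee_fin; have : d ^+ 2 <= h ^+ 2.
  by rewrite ler_pXn2r ?nnegrE ?sqrtr_ge0 ?ltW//; case: dS.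
move=> /(ler_wpM2l (ltW c0)); rewrite h2 mulrDr (mulrC c (e / c)) divfK//.
by rewrite gt_eqF.
Qed.

End Gamma.

(** * The risk bound *)

Section Risk.
Context {R : realType} {K : R -> R -> R} (H : rkhs K).
Hypotheses (Kmeas : jointly_measurable K) (Kbd : bounded_kernel K) (sep : separable H).
Variables (ev : nat -> R) (C0 r : R).
Hypotheses (Kev : kernel_eigenvalues K ev) (hC0 : 2 < C0) (hr : 0 < r).
Context {n : nat} (n0 : (0 < n)%N).
Context {d : measure_display} {Omega : measurableType d} {P : probability Omega R}.
Variables (X Z : 'I_n -> {RV P >-> R}) (f : R -> R) (lambda : {RV P >-> R})
  (fhat : Omega -> H).
Hypothesis reg : rkhs_regression C0 X Z f lambda fhat.

Let ev0 j : 0 <= ev j. Proof. by case: Kev. Qed.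

Let C0_ge0 : 0 <= C0. Proof. by apply: ltW; apply: lt_trans hC0. Qed.

Local Notation XX := (random_vector X).
Let kv w : 'I_n -> H := design_features H (XX w).
Let D t w := eff_dim (kv w) t.
Let Q t w := ridge_energy (kv w) t (fun i => Z i w).

Lemma spectrum_summable : (\sum_(0 <= j <oo) (ev j)%:E < +oo)%E.
Proof.
case: Kev => _ _ [phi [phi2 phio phie _]].
exact: (eigenvalues_summable Kmeas Kbd phi2 phio phie).
Qed.

Section Solution.
Variable delta : R.
Hypothesis sol : positive_solutions (kernel_complexity ev n) delta.

Let delta0 : 0 < delta. Proof. by case: sol. Qed.
Let t0 : 0 < delta ^+ 2 / 9. Proof. by rewrite divr_gt0 ?exprn_gt0. Qed.

Let mD t : 0 < t -> measurable_fun [set: Omega] (fun w => (D t w)%:E).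
Proof.
move=> tp; apply/measurable_EFinP.
exact: (measurableT_comp (measurable_eff_dim H n0 Kmeas tp) (measurable_random_vector X)).
Qed.

Let D0 t w : 0 < t -> 0 <= D t w. Proof. by move=> tp; exact: eff_dim_ge0. Qed.

Let Q0 t w : 0 < t -> 0 <= Q t w. Proof. by move=> tp; exact: ridge_energy_ge0. Qed.

Let mQ t : 0 < t -> measurable_fun [set: Omega] (Q t).
Proof.
move=> tp; apply: measurable_sum => i; apply: measurable_sum => j.
apply: measurable_funM => //; apply: measurable_funM => //.
exact: (measurableT_comp (measurable_smoother H n0 Kmeas tp i j) (measurable_random_vector X)).
Qed.

(** At t = delta ^ 2 / 9 the mean of t times the effective dimension is at most
    the normalized sum of min(mu_j, delta ^ 2), which the critical inequality
    bounds by delta ^ 4 / 8. *)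
Lemma expected_eff_dim_le : (\int[P]_w (D (delta ^+ 2 / 9) w)%:E <= (9 / 8 * delta ^+ 2)%:E)%E.
Proof.
case: Kev => _ ev_anti [phi [phi2 phio phie phic]].
have [k [e [ee trace]]] := residual_trace Kmeas Kbd sep phi2 phio phie phic ev0 ev_anti t0.
have := eff_dim_mean n0 Kmeas (design_uniform reg) t0 ee.
have nV : (0 <= (n%:R^-1)%:E :> \bar R)%E by rewrite lee_fin invr_ge0.
move=> /le_trans/(_ (lee_wpmul2l nV trace)) le1.
have le2 : (n%:R^-1%:E * \sum_(0 <= j <oo) (Num.min (ev j) (delta ^+ 2 / 9))%:E <=
    (delta ^+ 4 / 8)%:E)%E.
  apply: le_trans ((solutionP ev0 n0 delta0).1 sol).
  apply: lee_wpmul2l => //; apply: lee_nneseries => j _.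
    by rewrite lee_fin le_min ev0 ltW.
  rewrite lee_fin le_min ge_min lexx /= ge_min; apply/orP; right.
  by rewrite ler_pdivrMr// ler_peMr ?sqr_ge0// ler1n.
have := le_trans le1 le2; rewrite -lee_pdivlMl//; move/le_trans; apply.
rewrite -EFinM lee_fin le_eqVlt; apply/orP; left; apply/eqP.
by field; rewrite gt_eqF.
Qed.

(** Dyadic scales for the square of the random radius. *)
Let s k := delta ^+ 2 / 4 ^+ k.

Let s_gt0 k : 0 < s k. Proof. by rewrite divr_gt0 ?exprn_gt0. Qed.

Let s9_gt0 k : 0 < s k / 9. Proof. by rewrite divr_gt0. Qed.

Let s0E : s 0 = delta ^+ 2. Proof. by rewrite /s expr0 divr1. Qed.

Let sS k : s k = 4 * s k.+1.
Proof. rewrite /s [4 ^+ k.+1]exprS; have : 4 ^+ k != 0 :> R by rewrite expf_neq0.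
by move: (4 ^+ k) => q q0; field. Qed.

Let sqr_s k : (delta / 2 ^+ k) ^+ 2 = s k.
Proof. by rewrite expr_div_n -exprM mulnC exprM /s (_ : 2 ^+ 2 = 4)//; ring. Qed.

(** Outside of V k the random radius is at least the square root of s k. *)
Let V k : set (n.-tuple R) := [set x | eff_dim (design_features H x) (s k / 9) <= s k].

Let mV k : measurable (V k).
Proof.
have := measurable_eff_dim H n0 Kmeas (s9_gt0 k) measurableT (measurable_itv `]-oo, (s k)]).
by rewrite setTI; congr measurable; apply/seteqP; split => x /=; rewrite in_itv.
Qed.

(** The regularization is random and may depend on the noise; this sum dominates
    the noise energy at whichever scale the regularization selects. *)
Let noise w : \bar R := ((Q (s 0 / 9) w)%:E +
  \sum_(0 <= k <oo) (\1_(V k) (XX w) * Q (s k / 9) w)%:E)%E.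

Let term_ge0 k w : (0 <= (\1_(V k) (XX w) * Q (s k / 9) w)%:E)%E.
Proof. by rewrite lee_fin mulr_ge0 ?Q0// indicE ler0n. Qed.

Let mterm k : measurable_fun [set: Omega] (fun w => (\1_(V k) (XX w) * Q (s k / 9) w)%:E).
Proof.
apply/measurable_EFinP; apply: measurable_funM; last exact: mQ.
exact: (measurableT_comp (measurable_indic (mV k)) (measurable_random_vector X)).
Qed.

Let noise_ge0 w : (0 <= noise w)%E.
Proof.
rewrite adde_ge0 ?lee_fin ?Q0//; apply: nneseries_ge0 => k _ _.
exact: term_ge0.
Qed.

Let mnoise : measurable_fun [set: Omega] noise.
Proof.
apply: emeasurable_funD; first by apply/measurable_EFinP; exact: mQ.
by apply: ge0_emeasurable_sum => k *; [exact: term_ge0|exact: mterm].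
Qed.

(** The sum over scales is geometric because the event V k caps the effective
    dimension, hence the mean energy, at s k. *)
Lemma noise_mean_le : (\int[P]_w noise w <= (25 / 8 * delta ^+ 2)%:E)%E.
Proof.
have indep := design_noise_independent reg.
have normal := noise_normal reg.
rewrite ge0_integralD//; last 4 first.
- by move=> w _; rewrite lee_fin Q0.
- by apply/measurable_EFinP; exact: mQ.
- by move=> w _; apply: nneseries_ge0 => k _ _; exact: term_ge0.
- by apply: ge0_emeasurable_sum => k *; [exact: term_ge0|exact: mterm].
have -> : 25 / 8 * delta ^+ 2 = 9 / 8 * delta ^+ 2 + 2 * delta ^+ 2 by field.
rewrite EFinD; apply: leeD.
  rewrite (eq_integral (fun w => (\1_[set: n.-tuple R] (XX w) * Q (s 0 / 9) w)%:E)); last first.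
    by move=> w _; rewrite indicE in_setT mul1r.
  rewrite (ridge_energy_mean H n0 Kmeas indep normal measurableT (s9_gt0 0)).
  rewrite (eq_integral (fun w => (D (delta ^+ 2 / 9) w)%:E)); last first.
    by move=> w _; rewrite indicE in_setT mul1r s0E.
  exact: expected_eff_dim_le.
rewrite integral_nneseries//.
apply: (@le_trans _ _ (\sum_(0 <= k <oo) (s k)%:E)%E).
  apply: lee_nneseries => k _; first by move=> *; apply: integral_ge0 => w *; exact: term_ge0.
  rewrite (ridge_energy_mean H n0 Kmeas indep normal (mV k) (s9_gt0 k)).
  apply: (@le_trans _ _ (\int[P]_w (s k)%:E)%E).
    apply: le_integral_nonmeas => w; first by rewrite lee_fin ltW.
    rewrite lee_fin indicE; have [/set_mem wV|_] := boolP (_ \in V k).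
      by rewrite mul1r.
    by rewrite mul0r ltW.
  by rewrite integral_cst//= probability_setT mule1.
apply: lime_le; first by apply: is_cvg_nneseries => k _ _; rewrite lee_fin ltW.
apply: nearW => m; rewrite sumEFin lee_fin.
suff : \sum_(0 <= k < m) s k <= 2 * delta ^+ 2 - 2 * s m.
  by move=> /le_trans; apply; rewrite gerBl mulr_ge0// ltW.
elim: m => [|m IH]; first by rewrite big_geq// s0E subrr.
rewrite big_nat_recr//=; have := sS m; have := s_gt0 m; lra.
Qed.

Let scale_small e : 0 < e -> exists k, s k <= e.
Proof.
move=> e0; have d2 : 0 < delta ^+ 2 by rewrite exprn_gt0.
exists (Num.bound (delta ^+ 2 / e)); rewrite /s ler_pdivrMr ?exprn_gt0// mulrC -ler_pdivrMr//.
have := archi_boundP (ltW (divr_gt0 d2 e0)); move: (Num.bound _) => m /ltW /le_trans; apply.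
elim: m => [|m IH]; first by rewrite expr0.
rewrite exprS -natr1; have : 1 <= 4 ^+ m :> R by rewrite exprn_ege1// ler1n.
lra.
Qed.

(** Let k be the first scale with the design outside of V k. Then lambda is at
    least 2 * s k, so the pointwise oracle inequality applies at penalty s 0 / 9 if
    k = 0 and at s (k - 1) / 9, a penalty whose event holds, otherwise. If there is
    no such k then all features vanish at the design. *)
Lemma loss_le (b : Omega -> \bar R) :
  {ae P, forall w, ((best_emp_loss H f (design_at X w) r)%:E <= b w)%E} ->
  {ae P, forall w, ((emp_loss f (design_at X w) (fhat w))%:E <=
     3%:E * b w + (8 * r ^+ 2 * C0 * (delta ^+ 2 + 8 * D (delta ^+ 2 / 9) w))%:E +
     8%:E * noise w)%E}.
Proof.
move=> bb.
apply: (filterS _ (filterI (design_in_I01 (design_uniform reg))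
  (filterI (lambda_range reg) (filterI (fhat_minimizer reg) bb)))) => w [wI [/andP[lam1 lam2] [ghat_min wb]]].
have kvE : kv w = (fun i => rkhs_section H (design_at X w i)).
  by apply/funext => i; rewrite /kv /design_features tnth_mktuple feature_section.
have xI i : I01 (design_at X w i) by exact: wI.
have lamle : 8 * r ^+ 2 * lambda w <=
    8 * r ^+ 2 * C0 * (delta ^+ 2 + 8 * D (delta ^+ 2 / 9) w).
  rewrite -[leRHS]mulrA; apply: ler_wpM2l; first by rewrite mulr_ge0// sqr_ge0.
  apply: le_trans lam2 _; apply: ler_wpM2l => //.
  by rewrite /D kvE; exact: delta_radius_le.
have lam0 : 0 <= lambda w.
  by apply: le_trans lam1; rewrite mulr_ge0// sqr_ge0.
have S0 : (0 <= \sum_(0 <= k <oo) (\1_(V k) (XX w) * Q (s k / 9) w)%:E)%E.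
  by apply: nneseries_ge0 => k _ _; exact: term_ge0.
(* it suffices to find one scale whose energy is part of the noise term *)
have main t : 0 < t -> t <= 4 * lambda w -> ((Q t w)%:E <= noise w)%E ->
    ((emp_loss f (design_at X w) (fhat w))%:E <=
     3%:E * b w + (8 * r ^+ 2 * C0 * (delta ^+ 2 + 8 * D (delta ^+ 2 / 9) w))%:E +
     8%:E * noise w)%E.
  move=> tp tl Qn.
  have := oracle_best n0 xI ghat_min tp tl hr; rewrite -kvE -/(Q t w) => ob.
  apply: (@le_trans _ _ (3%:E * (best_emp_loss H f (design_at X w) r)%:E +
      (8 * r ^+ 2 * lambda w)%:E + 8%:E * (Q t w)%:E)%E).
    have -> : 8 * r ^+ 2 * lambda w = 8 * lambda w * r ^+ 2 by ring.
    by rewrite -!EFinM -!EFinD lee_fin.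
  apply: leeD; last exact: lee_wpmul2l.
  by apply: leeD; [exact: lee_wpmul2l|rewrite lee_fin].
have [allV|/existsNP[k0 nV0]] := pselect (forall k, V k (XX w)).
  have kv0 : forall i, kv w i = 0.
    apply: (eff_dim_small n0) => e e0.
    have [k ke] : exists k, s k <= Num.min e 9.
      by apply: scale_small; rewrite lt_min e0 ltr0n.
    move: ke; rewrite le_min => /andP[ke k9].
    exists (s k / 9); split => //; first by rewrite ler_pdivrMr// mul1r.
    exact: le_trans (allV k) ke.
  have le : emp_loss f (design_at X w) (fhat w) <= best_emp_loss H f (design_at X w) r.
    by apply: oracle_degenerate => // i; rewrite -[RHS](kv0 i) kvE.
  apply: (@le_trans _ _ (best_emp_loss H f (design_at X w) r)%:E); first by rewrite lee_fin.
  have b0 := best_emp_loss_ge0 H (design_at X w) f r.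
  apply: (@le_trans _ _ (3%:E * (best_emp_loss H f (design_at X w) r)%:E)%E).
    by rewrite -EFinM lee_fin; lra.
  apply: (@le_trans _ _ (3%:E * b w)%E); first exact: lee_wpmul2l.
  rewrite -addeA leeDl// adde_ge0//; last by rewrite mule_ge0.
  by rewrite lee_fin (le_trans _ lamle)// mulr_ge0// mulr_ge0// sqr_ge0.
have exV : exists k, `[< ~ V k (XX w) >] by exists k0; exact/asboolP.
pose k := ex_minn exV.
have [nV kmin] : ~ V k (XX w) /\ forall j, (j < k)%N -> V j (XX w).
  rewrite /k; case: ex_minnP => m /asboolP mV' mmin; split => // j jm.
  by apply: contrapT => /asboolP /mmin; rewrite leqNgt jm.
have lams : 2 * s k <= lambda w.
  apply: le_trans lam1; apply: ler_wpM2l => //; rewrite -sqr_s.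
  have dk : 0 < delta / 2 ^+ k by rewrite divr_gt0 ?exprn_gt0.
  rewrite ler_pXn2r ?nnegrE ?(ltW dk) ?delta_radius_ge0//.
  rewrite leNgt; apply/negP => /(delta_radius_lt n0 xI dk).
  by rewrite -kvE sqr_s.
have sk := s_gt0 k.
move: sk lams nV kmin; case: (k) => [|j] sk lams nV kmin.
  by apply: (main (s 0 / 9)) => //; [lra|rewrite /noise leeDl].
have := sS j; have := s_gt0 j => sj sjS.
apply: (main (s j / 9)) => //; first by lra.
apply: (@le_trans _ _ (\sum_(0 <= k <oo) (\1_(V k) (XX w) * Q (s k / 9) w)%:E)%E); last first.
  by rewrite /noise leeDr// lee_fin Q0.
apply: le_trans (nneseries_lim_ge j.+1 _); last by move=> *; exact: term_ge0.
rewrite big_nat_recr//= indicE mem_set ?mul1r; last exact: kmin.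
by rewrite leeDr// sume_ge0.
Qed.

Lemma risk_le_solution (b : Omega -> \bar R) : measurable_fun [set: Omega] b ->
  (forall w, 0 <= b w)%E ->
  {ae P, forall w, ((best_emp_loss H f (design_at X w) r)%:E <= b w)%E} ->
  (risk X f fhat <= ((80 * r ^+ 2 * C0 + 25) * delta ^+ 2)%:E + 3%:E * \int[P]_w b w)%E.
Proof.
move=> mb b0 bb.
have d2 : 0 <= delta ^+ 2 by exact: sqr_ge0.
have c0 : 0 <= 8 * r ^+ 2 * C0 by rewrite mulr_ge0// mulr_ge0// sqr_ge0.
have e0 w : 0 <= delta ^+ 2 + 8 * D (delta ^+ 2 / 9) w by rewrite addr_ge0// mulr_ge0// D0.
have me : measurable_fun [set: Omega]
    (fun w => (8 * r ^+ 2 * C0 * (delta ^+ 2 + 8 * D (delta ^+ 2 / 9) w))%:E).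
  apply/measurable_EFinP; apply: measurable_funM => //; apply: measurable_funD => //.
  by apply: measurable_funM => //; apply/measurable_EFinP; exact: mD.
have n1 w : (0 <= 3%:E * b w)%E by rewrite mule_ge0.
have n2 w : (0 <= (8 * r ^+ 2 * C0 * (delta ^+ 2 + 8 * D (delta ^+ 2 / 9) w))%:E)%E.
  by rewrite lee_fin mulr_ge0.
have n3 w : (0 <= 8%:E * noise w)%E by rewrite mule_ge0.
rewrite /risk unlock.
apply: le_trans (ae_le_integral_nonmeas _ _ _ (loss_le bb)) _.
- apply: emeasurable_funD; last exact: measurable_funeM.
  by apply: emeasurable_funD => //; exact: measurable_funeM.
- by move=> w; rewrite lee_fin emp_loss_ge0.
- by move=> w; rewrite !adde_ge0.
rewrite ge0_integralD//; last 3 first.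
- by move=> w _; rewrite adde_ge0.
- by apply: emeasurable_funD => //; exact: measurable_funeM.
- exact: measurable_funeM.
rewrite ge0_integralD//; last first.
- exact: measurable_funeM.
rewrite ge0_integralZl// [X in (_ + X)%E]ge0_integralZl//.
rewrite -addeA addeC; apply: leeD => //.
have -> : (80 * r ^+ 2 * C0 + 25) * delta ^+ 2 =
  8 * r ^+ 2 * C0 * (delta ^+ 2 + 9 * delta ^+ 2) + 8 * (25 / 8 * delta ^+ 2) by field.
rewrite [leRHS]EFinD; apply: leeD; last first.
  by rewrite EFinM; apply: lee_wpmul2l => //; exact: noise_mean_le.
rewrite (eq_integral (fun w => ((8 * r ^+ 2 * C0)%:E *
  ((delta ^+ 2)%:E + 8%:E * (D (delta ^+ 2 / 9) w)%:E))%E)); last first.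
  by [].
rewrite ge0_integralZl//; last 2 first.
- apply: emeasurable_funD => //; apply: measurable_funeM; exact: mD.
- by move=> w _; rewrite adde_ge0 ?mule_ge0 ?lee_fin ?D0.
rewrite [leRHS]EFinM; apply: lee_wpmul2l; first by rewrite lee_fin.
rewrite ge0_integralD//; last 2 first.
- by move=> w _; rewrite mule_ge0 ?lee_fin ?D0.
- by apply: measurable_funeM; exact: mD.
rewrite integral_cst//= probability_setT mule1 [leRHS]EFinD; apply: leeD2l.
rewrite ge0_integralZl//; last 2 first.
- exact: mD.
- by move=> w _; rewrite lee_fin D0.
have -> : 9 * delta ^+ 2 = 8 * (9 / 8 * delta ^+ 2) by field.
by rewrite [leRHS]EFinM; apply: lee_wpmul2l => //; exact: expected_eff_dim_le.
Qed.

End Solution.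

Lemma risk_le (b : Omega -> \bar R) : measurable_fun [set: Omega] b ->
  (forall w, 0 <= b w)%E ->
  {ae P, forall w, ((best_emp_loss H f (design_at X w) r)%:E <= b w)%E} ->
  (risk X f fhat <=
    ((80 * r ^+ 2 * C0 + 25) * gamma_radius ev n ^+ 2)%:E + 3%:E * \int[P]_w b w)%E.
Proof.
move=> mb b0 bb; apply: le_gamma_radius => //.
- exact: spectrum_summable.
- by rewrite ltr_wpDl// mulr_ge0// mulr_ge0// sqr_ge0.
- by move=> delta sol; exact: risk_le_solution.
Qed.

End Risk.

(** * Measurability of the approximation error *)

Section BestLoss.
Context {R : realType} {K : R -> R -> R} (H : rkhs K) {n : nat}.
Hypotheses (Kmeas : jointly_measurable K) (sep : separable H).
Local Notation ip := (@rkhs_ip R K H).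
Variables (f : R -> R) (r : R).
Hypotheses (fmeas : measurable_fun (@I01 R) f) (r0 : 0 < r).

(** Projecting a vector radially to the ball moves it by at most its distance to
    any point of the ball. *)
Lemma dense_sequence_ball : exists D : nat -> H, (forall m, `|D m| <= r) /\
  forall g e, `|g| <= r -> 0 < e -> exists m, `|g - D m| < e.
Proof.
have [D Ddense] := dense_sequence sep.
pose D' m := if `|D m| <= r then D m else (r / `|D m|) *: D m.
exists D'; split => [m|g e gr e0].
  rewrite /D'; case: ifPn => //; rewrite -ltNge => rD.
  have D0 : 0 < `|D m| by exact: lt_trans rD.
  by rewrite normrZ ger0_norm ?divr_ge0 ?(ltW r0)// divfK// gt_eqF.
have [m gm] := Ddense g (e / 2) (divr_gt0 e0 (ltr0Sn R 1)); exists m.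
rewrite /D'; case: ifPn => [_|]; first by rewrite (lt_trans gm)// ltr_pdivrMr// ltr_pMr// ltr1n.
rewrite -ltNge => rD; have D0 : 0 < `|D m| by exact: lt_trans rD.
have -> : g - (r / `|D m|) *: D m = (g - D m) + (1 - r / `|D m|) *: D m.
  by rewrite scalerBl scale1r addrA subrK.
apply: le_lt_trans (ler_normD _ _) _.
have -> : `|(1 - r / `|D m|) *: D m| = `|D m| - r.
  rewrite normrZ ger0_norm; last by rewrite subr_ge0 ler_pdivrMr// mul1r ltW.
  by rewrite mulrBl mul1r divfK// gt_eqF.
have := lerB_dist (D m) g; rewrite distrC; lra.
Qed.

Lemma emp_loss_sum (x : 'I_n -> R) (g : H) : (forall i, I01 (x i)) ->
  emp_loss f x g = n%:R^-1 * \sum_i (f (x i) - ip g (feature H (x i))) ^+ 2.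
Proof.
move=> xI; rewrite /emp_loss emp_norm_sqr; congr (_ * _); apply: eq_bigr => i _.
by rewrite /at_design -ip_feature// expr2.
Qed.

Lemma emp_loss_cvg (x : 'I_n -> R) (u : nat -> H) (g : H) : (forall i, I01 (x i)) ->
  u @ \oo --> g -> (fun m => emp_loss f x (u m)) @ \oo --> emp_loss f x g.
Proof.
move=> xI ug; rewrite emp_loss_sum//.
rewrite (_ : (fun m => _) = (fun m => n%:R^-1 *
  \sum_i (f (x i) - ip (u m) (feature H (x i))) ^+ 2)); last first.
  by apply/funext => m; rewrite emp_loss_sum.
apply: cvgM; first exact: cvg_cst.
apply: cvg_big => [|i _]; first exact: add_continuous.
under eq_cvg do rewrite expr2.
by rewrite expr2; apply: cvgM; (apply: cvgB; [exact: cvg_cst|exact: ip_cvgl]).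
Qed.

(** Separability and continuity of the loss reduce the infimum over the ball to a
    countable one. *)
Lemma best_emp_loss_measurable : exists b : n.-tuple R -> R,
  measurable_fun [set: n.-tuple R] b /\
  forall x : 'I_n -> R, (forall i, I01 (x i)) ->
    best_emp_loss H f x r = b [tuple x i | i < n].
Proof.
have [D [Dr Ddense]] := dense_sequence_ball.
pose f1 := f \_ (@I01 R).
have mf1 : measurable_fun [set: R] f1.
  exact: (measurable_restrictT _ (measurable_I01 (R := R))).1 fmeas.
pose F m (t : n.-tuple R) : R :=
  n%:R^-1 * \sum_i (f1 (tnth t i) - ip (D m) (feature H (tnth t i))) ^+ 2.
have F0 m t : 0 <= F m t by rewrite mulr_ge0// sumr_ge0// => i _; exact: sqr_ge0.
exists (fun t => infs (F ^~ t) 0); split.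
  apply: measurable_fun_infs => [t _|m].
    by exists 0 => _ [m _ <-]; exact: F0.
  apply: measurable_funM; first exact: measurable_cst.
  apply: measurable_sum => i; apply: measurable_funX; apply: measurable_funB.
    exact: (measurableT_comp mf1 (measurable_tnth i)).
  exact: (measurableT_comp (measurable_eval (D m) Kmeas) (measurable_tnth i)).
move=> x xI.
have FE m : F m [tuple x i | i < n] = emp_loss f x (D m).
  rewrite emp_loss_sum//; congr (_ * _); apply: eq_bigr => i _.
  by rewrite tnth_mktuple /f1 patchE mem_set.
apply/eqP; rewrite eq_le; apply/andP; split.
  apply: lb_le_inf; first by exists (F 0%N [tuple x i | i < n]), 0%N.
  by move=> _ [m _ <-]; rewrite FE; exact: best_emp_loss_le.
apply: lb_le_inf; first by exists (emp_loss f x (0 : H)), 0 => //=; rewrite normr0 ltW.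
move=> _ [g /= gr <-].
have /choice[m mP] : forall k : nat, exists m, `|g - D m| < k.+1%:R^-1.
  by move=> k; apply: Ddense => //; rewrite invr_gt0.
have ug : (fun k => D (m k)) @ \oo --> g.
  apply/cvgrPdist_lt => e e0; near=> k; apply: lt_trans (mP k) _.
  by near: k; exact: (near_infty_natSinv_lt (PosNum e0)).
apply: (cvgr_to_ge (emp_loss_cvg xI ug)); apply: nearW => k.
rewrite -FE; apply: ge_inf; last by exists (m k).
by exists 0 => _ [j _ <-]; exact: F0.
Unshelve. all: by end_near. Qed.

End BestLoss.

(** * Polynomially decaying spectra *)

Section PowerDecay.
Context {R : realType}.
Implicit Types (a p : R).

(** Convexity of x ^ (1 - a), in the form of Bernoulli's inequality for a
    negative exponent. *)
Lemma powR_telescope a (j : nat) : 1 < a -> (0 < j)%N ->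
  (a - 1) * j.+1%:R `^ (- a) <= j%:R `^ (1 - a) - j.+1%:R `^ (1 - a).
Proof.
move=> a1 j0.
have J0 : 0 < j%:R :> R by rewrite ltr0n.
have J1 : 0 < j.+1%:R :> R by rewrite ltr0n.
pose q : R := j%:R / j.+1%:R.
have q0 : 0 < q by rewrite divr_gt0.
have jE : j%:R = q * j.+1%:R by rewrite /q divfK// gt_eqF.
have lnq : ln q <= q - 1.
  by have := @le_ln1Dx R (q - 1); rewrite addrCA subrr addr0; apply; rewrite ltrBrDr addNr.
have bern : 1 + (a - 1) * (1 - q) <= q `^ (1 - a).
  rewrite /powR gt_eqF//; apply: le_trans (expR_ge1Dx _); rewrite lerD2l.
  have : 0 <= a - 1 by lra.
  nra.
have -> : j%:R `^ (1 - a) = q `^ (1 - a) * j.+1%:R `^ (1 - a).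
  by rewrite jE powRM// ltW.
have E : j.+1%:R `^ (1 - a) = j.+1%:R * j.+1%:R `^ (- a) :> R.
  by rewrite powRD ?powRr1 ?ltW// (gt_eqF J1) implybT.
have P0 : 0 < j.+1%:R `^ (- a) :> R by exact: powR_gt0.
rewrite E -[X in _ <= _ - X]mul1r -mulrBl mulrA.
apply: ler_wpM2r; first exact: ltW.
have -> : a - 1 = ((a - 1) * (1 - q)) * j.+1%:R.
  by rewrite /q -natr1; field; rewrite natr1 gt_eqF.
by apply: ler_wpM2r; [exact: ltW|rewrite lerBrDl].
Qed.

(** Telescoping comparison of the sum with the integral of x ^ (- a). *)
Lemma powR_tail a (k : nat) : 1 < a -> (0 < k)%N ->
  (\sum_(k <= j <oo) (j.+1%:R `^ (- a))%:E <= ((a - 1)^-1 * k%:R `^ (1 - a))%:E)%E.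
Proof.
move=> a1 k0; have a10 : 0 < a - 1 by rewrite subr_gt0.
apply: lime_le; first by apply: is_cvg_nneseries => j _ _; rewrite lee_fin powR_ge0.
near=> m; rewrite sumEFin lee_fin mulrC ler_pdivlMr// mulrC.
suff : (a - 1) * \sum_(k <= j < m) j.+1%:R `^ (- a) <= k%:R `^ (1 - a) - m%:R `^ (1 - a).
  by move=> /le_trans; apply; rewrite gerBl powR_ge0.
have km : (k <= m)%N by near: m; exact: nbhs_infty_ge.
rewrite -(subnKC km); elim: (m - k)%N => [|i IH].
  by rewrite addn0 big_geq// mulr0 subrr.
rewrite addnS big_nat_recr ?leq_addr//= mulrDr.
have := powR_telescope a1 (leq_trans k0 (leq_addr i k)); lra.
Unshelve. all: by end_near. Qed.

(** Splitting the spectrum at k = n ^ (1 / (a + 1)) balances the k leading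
    eigenvalues, cut at delta ^ 2, against the tail. *)
Lemma gamma_radius_power (ev : nat -> R) a c (n : nat) : 1 < a -> 0 < c ->
  (forall j, 0 <= ev j <= c * j.+1%:R `^ (- a)) -> (0 < n)%N ->
  gamma_radius ev n ^+ 2 <= (16 + 8 * (c / (a - 1))) * n%:R `^ (- (a / (a + 1))).
Proof.
move=> a1 c0 evP n0.
have ev0 j : 0 <= ev j by have /andP[] := evP j.
have a10 : 0 < a - 1 by rewrite subr_gt0.
have a11 : a + 1 != 0 by rewrite gt_eqF// addr_gt0// (lt_trans ltr01).
have n1 : 1 <= n%:R :> R by rewrite ler1n.
(* with n = p ^ (a + 1) all terms become multiples of powers of p *)
pose p : R := n%:R `^ (a + 1)^-1.
have p1 : 1 <= p.
  rewrite /p -[leLHS](powRr0 n%:R); apply: ler_powR => //.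
  by rewrite invr_ge0 addr_ge0// ltW// (lt_trans ltr01).
have p0 : 0 < p by exact: lt_le_trans p1.
have nE : n%:R = p * p `^ a :> R.
  have -> : p * p `^ a = p `^ (a + 1) by rewrite powRD ?powRr1 ?(ltW p0) 1?mulrC// (gt_eqF p0) implybT.
  by rewrite /p -powRrM mulVf// powRr1.
pose q : R := p `^ (- a).
have q0 : 0 < q by exact: powR_gt0.
have qE : n%:R `^ (- (a / (a + 1))) = q.
  by rewrite /q /p -powRrM mulrN mulrC.
rewrite qE; set A := 16 + _.
have cA : 0 < c / (a - 1) by rewrite divr_gt0.
have A0 : 16 <= A by rewrite /A lerDl mulr_ge0// ltW.
pose d : R := Num.sqrt (A * q).
have Aq : 0 < A * q by rewrite mulr_gt0//; lra.
have d0 : 0 < d by rewrite sqrtr_gt0.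
have d2 : d ^+ 2 = A * q by rewrite sqr_sqrtr// ltW.
(* A is large enough for A ^ 2 >= 16 * A + 8 * (c / (a - 1)), the critical
   inequality after cancelling powers of p *)
suff sol : positive_solutions (kernel_complexity ev n) d.
  rewrite -d2 ler_pXn2r ?nnegrE ?gamma_radius_ge0 ?(ltW d0)//.
  exact: gamma_radius_le.
apply/(solutionP ev0 n0 d0); rewrite d2.
have -> : d ^+ 4 = (A * q) ^+ 2 by rewrite -d2 -exprM.
pose k := (Num.truncn p).+1.
have kp : p <= k%:R by rewrite ltW// /k truncnS_gt.
have k2p : k%:R <= 2 * p.
  by rewrite /k -natr1; have := truncn_le p; rewrite (ltW p0) => /idP; lra.
rewrite (nneseries_split 0%N k); last by move=> j _; rewrite lee_fin le_min ev0 ltW.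
rewrite add0n.
have head : (\sum_(0 <= j < k) (Num.min (ev j) (A * q))%:E <= (2 * p * (A * q))%:E)%E.
  rewrite sumEFin lee_fin big_mkord; apply: (@le_trans _ _ (k%:R * (A * q))).
    rewrite mulr_natl -[k in leRHS]card_ord -sumr_const; apply: ler_sum => j _.
    by rewrite ge_min lexx orbT.
  by apply: ler_wpM2r => //; exact: ltW.
have tail : (\sum_(k <= j <oo) (Num.min (ev j) (A * q))%:E <=
    (c / (a - 1) * (p * q))%:E)%E.
  apply: (@le_trans _ _ (\sum_(k <= j <oo) (c%:E * (j.+1%:R `^ (- a))%:E))%E).
    apply: lee_nneseries => j _; first by rewrite lee_fin le_min ev0 ltW.
    by rewrite -EFinM lee_fin ge_min; have /andP[_ ->] := evP j.
  rewrite nneseriesZl//.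
  apply: (@le_trans _ _ (c%:E * ((a - 1)^-1 * k%:R `^ (1 - a))%:E)%E).
    by apply: lee_wpmul2l; [rewrite lee_fin ltW|exact: powR_tail].
  rewrite -EFinM lee_fin mulrA; apply: ler_wpM2l; first exact: ltW.
  have -> : p * q = p `^ (1 - a).
    by rewrite powRD ?powRr1 ?(ltW p0)// (gt_eqF p0) implybT.
  have k0R : 0 < k%:R :> R := lt_le_trans p0 kp.
  rewrite (_ : 1 - a = - (a - 1)); last by ring.
  rewrite !powRN lef_pV2 ?posrE ?powR_gt0 ?ltr0n//.
  by apply: ge0_ler_powR; rewrite ?nnegrE ?(ltW p0) ?(ltW k0R) ?(ltW a10).
apply: (@le_trans _ _ (n%:R^-1%:E * ((2 * p * (A * q))%:E + (c / (a - 1) * (p * q))%:E))%E).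
  by apply: lee_wpmul2l; [rewrite lee_fin invr_ge0|exact: leeD].
rewrite -EFinD -EFinM lee_fin nE.
have -> : (p * p `^ a)^-1 = p^-1 * q by rewrite invfM /q powRN.
have -> : p^-1 * q * (2 * p * (A * q) + c / (a - 1) * (p * q)) =
    q ^+ 2 * (2 * A + c / (a - 1)) by field; rewrite gt_eqF// gt_eqF.
have -> : (A * q) ^+ 2 / 8 = q ^+ 2 * (A ^+ 2 / 8) by field.
apply: ler_wpM2l; first exact: sqr_ge0.
move: (c / (a - 1)) cA @A A0 {Aq d d0 d2 head tail} => e e0 A A16.
have -> : e = (A - 16) / 8 by rewrite /A; field.
nra.
Qed.

End PowerDecay.

Theorem theorem6p3 (R : realType) (K : R -> R -> R) (H : rkhs K)
  (mu : nat -> R) (C0 r : R)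
  (Kmeas : jointly_measurable K) (Kpsd : psd_kernel K)
  (Kbounded : bounded_kernel K) (Hsep : separable H)
  (Kmu : kernel_eigenvalues K mu) (hC0 : 2 < C0) (hr : 0 < r) :
  [/\ exists C : R, 0 < C /\
        forall (n : nat) (d : measure_display) (Omega : measurableType d)
          (P : probability Omega R) (X Z : 'I_n -> {RV P >-> R})
          (f : R -> R) (lambda : {RV P >-> R}) (fhat : Omega -> H),
          (0 < n)%N ->
          rkhs_regression C0 X Z f lambda fhat ->
          (risk X f fhat <=
            C%:E * ((gamma_radius mu n ^+ 2)%:E
                    + expected_approx_error H X f r))%E,
      exists C : R, 0 < C /\
        forall (n : nat) (d : measure_display) (Omega : measurableType d)
          (P : probability Omega R) (X Z : 'I_n -> {RV P >-> R})
          (f : R -> R) (lambda : {RV P >-> R}) (fhat : Omega -> H),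
          (0 < n)%N ->
          rkhs_regression C0 X Z f lambda fhat ->
          (exists g : H, `|g| <= r /\
             forall x, I01 x -> f x = rkhs_eval g x) ->
          (risk X f fhat <= (C * gamma_radius mu n ^+ 2)%:E)%E
    & forall alpha : R, 1 < alpha ->
        (exists c1 c2 : R, [/\ 0 < c1, 0 < c2 &
           forall i : nat,
             c1 * i.+1%:R `^ (- alpha) <= mu i <= c2 * i.+1%:R `^ (- alpha)]) ->
        exists C : R, 0 < C /\
          forall (n : nat) (d : measure_display) (Omega : measurableType d)
            (P : probability Omega R) (X Z : 'I_n -> {RV P >-> R})
            (f : R -> R) (lambda : {RV P >-> R}) (fhat : Omega -> H),
            (0 < n)%N ->
            rkhs_regression C0 X Z f lambda fhat ->
            (exists g : H, `|g| <= r /\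
               forall x, I01 x -> f x = rkhs_eval g x) ->
            (risk X f fhat <= (C * n%:R `^ (- (alpha / (alpha + 1))))%:E)%E].
Proof.
pose C := 80 * r ^+ 2 * C0 + 25.
have C0pos : 0 < C0 by apply: lt_trans hC0.
have Cpos : 0 < C by rewrite ltr_wpDl// mulr_ge0 ?(ltW C0pos)// mulr_ge0// sqr_ge0.
have part2 (n : nat) (d : measure_display) (Omega : measurableType d)
    (P : probability Omega R) (X Z : 'I_n -> {RV P >-> R})
    (f : R -> R) (lambda : {RV P >-> R}) (fhat : Omega -> H) :
    (0 < n)%N -> rkhs_regression C0 X Z f lambda fhat ->
    (exists g : H, `|g| <= r /\ forall x, I01 x -> f x = rkhs_eval g x) ->
    (risk X f fhat <= (C * gamma_radius mu n ^+ 2)%:E)%E.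
  move=> n0 reg [g [gr fg]].
  have := risk_le Kmeas Kbounded Hsep Kmu hC0 hr n0 reg (b := fun=> 0%E).
  rewrite integral0 mule0 adde0; apply => //.
  apply: filterS (design_in_I01 (design_uniform reg)) => w wI.
  rewrite lee_fin; apply: le_trans (best_emp_loss_le (design_at X w) f gr) _.
  rewrite /emp_loss (_ : (fun i => _) = (fun=> 0)).
    by rewrite emp_norm_sqr /emp_ip big1 ?mulr0// => i _; rewrite mulr0.
  by apply/funext => i; rewrite /at_design fg ?subrr//; exact: wI.
split.
- exists (C + 3); split; first by rewrite addr_gt0.
  move=> n d Omega P X Z f lambda fhat n0 reg.
  have [b [mb bE]] := @best_emp_loss_measurable R K H n Kmeas Hsep f r
    (regression_fun_measurable reg) hr.
  pose E : set Omega := random_vector X @^-1` box (fun=> I01).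
  have mE : measurable E.
    rewrite -[E]setTI; apply: measurable_random_vector => //.
    by apply: measurable_box => i; exact: measurable_I01.
  have EP w : E w <-> forall i, I01 (X i w).
    by split => h i; have := h i; rewrite tnth_mktuple.
  pose b1 w := (\1_E w * b (random_vector X w))%:E.
  have b1E w : E w -> b1 w = (best_emp_loss H f (design_at X w) r)%:E.
    move=> Ew; rewrite /b1 indicE mem_set// mul1r bE//; exact/EP.
  have b1N w : ~ E w -> b1 w = 0%E by move=> nE; rewrite /b1 indicE memNset// mul0r.
  have best0 w : (0 <= (best_emp_loss H f (design_at X w) r)%:E)%E.
    by rewrite lee_fin best_emp_loss_ge0.
  have b10 w : (0 <= b1 w)%E.
    by have [/b1E ->|/b1N ->] := pselect (E w).
  have b1le : (\int[P]_w b1 w <= expected_approx_error H X f r)%E.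
    rewrite /expected_approx_error unlock; apply: ge0_le_integral_nonmeas => // w.
    by have [/b1E ->|/b1N ->] := pselect (E w).
  apply: le_trans (risk_le Kmeas Kbounded Hsep Kmu hC0 hr n0 reg _ b10 _) _.
  + apply/measurable_EFinP; apply: measurable_funM; first exact: measurable_indic.
    exact: (measurableT_comp mb (measurable_random_vector X)).
  + apply: filterS (design_in_I01 (design_uniform reg)) => w wI.
    by rewrite b1E//; exact/EP.
  + have e0 : (0 <= expected_approx_error H X f r)%E.
      by apply: le_trans b1le; exact: integral_ge0.
    move: e0 b1le; move: (expected_approx_error H X f r) => e e0 b1le.
    rewrite [leRHS]ge0_muleDr ?lee_fin ?sqr_ge0//; apply: leeD.
      by rewrite -EFinM lee_fin; apply: ler_wpM2r; rewrite ?sqr_ge0// lerDl.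
    apply: (@le_trans _ _ (3%:E * e)%E).
      exact: lee_wpmul2l.
    by apply: lee_wpmul2r => //; rewrite lee_fin lerDr ltW.
- by exists C.
move=> alpha a1 [c1 [c2 [c10 c20 muP]]].
have A0 : 0 < 16 + 8 * (c2 / (alpha - 1)).
  by rewrite ltr_wpDr// mulr_ge0// divr_ge0 ?(ltW c20)// subr_ge0 ltW.
exists (C * (16 + 8 * (c2 / (alpha - 1)))); split; first exact: mulr_gt0.
move=> n d Omega P X Z f lambda fhat n0 reg fH.
apply: le_trans (part2 _ _ _ _ _ _ _ _ _ n0 reg fH) _.
rewrite lee_fin -mulrA; apply: ler_wpM2l; first exact: ltW.
apply: gamma_radius_power => // j; have /andP[_ ->] := muP j.
by case: Kmu => ->.
Qed.
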